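(* Let $\alpha\in(0,1)$, $0<\beta\le2$ and let $d\ge1$ be an integer. Let $u_0\in L^1(\mathbb{R}^d)\cap L^2(\mathbb{R}^d)$ and let $u$ be the mild solution, with $f\equiv0$, of the Cauchy problem $\partial_t^\alpha(u-u_0)+(-\Delta)^{\beta/2}u=0$ in $(0,\infty)\times\mathbb{R}^d$, $u(0,\cdot)=u_0$. If $d\neq2\beta$, then $$\|u(t,\cdot)\|_{L^2(\mathbb{R}^d)}\lesssim t^{-\alpha\min\{1,\frac{d}{2\beta}\}},\qquad t>0 .$$ Moreover, in the case $d=2\beta$, $$\|u(t,\cdot)\|_{L^{2,\infty}(\mathbb{R}^d)}\lesssim t^{-\alpha},\qquad t>0 .$$
   Context: The notation $A(t)\lesssim B(t)$ means $A(t)\le C\,B(t)$ with a constant $C>0$ independent of $t$. $L^{2,\infty}$ is the weak $L^2$ space with quasi-norm $\sup_{\lambda>0}\lambda\,|\{x:|g(x)|>\lambda\}|^{1/2}$. Function $Z$: for $t>0$ and $x\in\mathbb{R}^d\setminus\{0\}$ put $z=2^\beta t^\alpha|x|^{-\beta}$ and $$Z(t,x)=\pi^{-d/2}|x|^{-d}\,\frac{1}{2\pi i}\int_{\mathcal{C}}\frac{\Gamma(s)\,\Gamma(\frac d2-\frac\beta2 s)\,\Gamma(1-s)}{\Gamma(\frac\beta2 s)\,\Gamma(1-\alpha s)}\,z^{-s}\,ds,$$ where $\mathcal{C}$ is an infinite contour (e.g. the upward vertical line $\operatorname{Re}s=c$ with $0<c<\min\{1,d/\beta\}$) separating the poles of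 $\Gamma(s)$ (to its left) from those of $\Gamma(\frac d2-\frac\beta2 s)$ and $\Gamma(1-s)$ (to its right). For $f\equiv0$ the mild solution with initial datum $u_0$ is $u(t,x)=\int_{\mathbb{R}^d}Z(t,x-y)u_0(y)\,dy$. *)

(* Defs.v *)
From HB Require Import structures.
From mathcomp Require Import all_boot all_order all_algebra.
From mathcomp Require Import all_classical all_reals all_analysis.
From mathcomp Require Import complex.

Set Implicit Arguments.
Unset Strict Implicit.
Unset Printing Implicit Defensive.

Import Order.TTheory GRing.Theory Num.Theory.
Import numFieldNormedType.Exports.
Import Normc.

Local Open Scope classical_set_scope.
Local Open Scope complex_scope.
Local Open Scope ring_scope.

Section euclid.
Context {R : realType}.

Definition euclid (d : nat) := d.-tuple (measurableTypeR R).

Definition esub {d} (x y : euclid d) : euclid d :=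
  [tuple tnth x i - tnth y i | i < d].

Definition enorm {d} (x : euclid d) : R :=
  Num.sqrt (\sum_(i < d) tnth x i ^+ 2).

End euclid.
Arguments euclid : clear implicits.

(* Lebesgue measure on R^(n+1) is the image of the product measure on
   R * R^n under (x, y) |-> x :: y. *)
Section lebesgue_step.
Local Open Scope ereal_scope.
Context {R : realType} {n : nat}.
Variable m : {sigma_finite_measure set (euclid R n) -> \bar R}.

Let consp (p : measurableTypeR R * euclid R n) : euclid R n.+1 :=
  [tuple of p.1 :: p.2].

Let measurable_consp : measurable_fun setT consp.
Proof. exact: measurable_cons. Qed.

Definition lebesgue_step : set (euclid R n.+1) -> \bar R :=
  pushforward (lebesgue_measure \x m) consp.

Let measurable_preimage A : measurable A -> measurable (consp @^-1` A).
Proof. by move=> mA; rewrite -[X in measurable X]setTI; exact: measurable_consp. Qed.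

Let step0 : lebesgue_step set0 = 0.
Proof. by rewrite /lebesgue_step /pushforward preimage_set0 measure0. Qed.

Let step_ge0 A : 0 <= lebesgue_step A.
Proof. exact: measure_ge0. Qed.

Let step_sigma_additive : semi_sigma_additive lebesgue_step.
Proof.
move=> F mF tF mUF; rewrite /lebesgue_step /pushforward preimage_bigcup.
apply: measure_semi_sigma_additive.
- by move=> k; exact: measurable_preimage.
- apply/trivIsetP => /= i j _ _ ij; rewrite -preimage_setI.
  by move/trivIsetP : tF => /(_ _ _ _ _ ij) ->//; rewrite preimage_set0.
- by rewrite -preimage_bigcup; exact: measurable_preimage.
Qed.

HB.instance Definition _ := isMeasure.Build _ _ _
  lebesgue_step step0 step_ge0 step_sigma_additive.

Lemma lebesgue_step_box (A : set (measurableTypeR R)) (B : set (euclid R n)) :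
  measurable A -> measurable B ->
  lebesgue_step [set x | A (thead x) /\ B [tuple of behead x]] =
  lebesgue_measure A * m B.
Proof.
move=> mA mB; rewrite -product_measure1E// /lebesgue_step /pushforward.
congr (_ _); apply/seteqP; split=> -[a b] /=;
  by rewrite theadE (_ : [tuple of _] = b)//; exact: val_inj.
Qed.

Let step_sigma_finite : sigma_finite setT lebesgue_step.
Proof.
have /sigma_finiteP[F [TF ndF Foo]] := sigma_finiteT (@lebesgue_measure R).
have /sigma_finiteP[G [TG ndG Goo]] := sigma_finiteT m.
exists (fun k => [set x : euclid R n.+1 |
    F k (thead x) /\ G k [tuple of behead x]]).
  apply/seteqP; split=> // x _.
  have : setT (thead x) by []; rewrite {1}TF => -[k _ Fk].
  have : setT [tuple of behead x] by []; rewrite {1}TG => -[l _ Gl].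
  exists (maxn k l) => //; split.
  - by move: (thead x) Fk; exact/subsetPset/ndF/leq_maxl.
  - by move: [tuple of behead x] Gl; exact/subsetPset/ndG/leq_maxr.
move=> k; have [mF Foo'] := Foo k; have [mG Goo'] := Goo k; split.
  apply: measurableI; rewrite -[X in measurable X]setTI.
  - exact: measurable_tnth.
  - exact: measurable_behead.
by rewrite lebesgue_step_box// lte_mul_pinfty// ge0_fin_numE.
Qed.

HB.instance Definition _ := Measure_isSigmaFinite.Build _ _ _
  lebesgue_step step_sigma_finite.

End lebesgue_step.

Fixpoint lebesgue_measure_euclid {R : realType} (d : nat) :
    {sigma_finite_measure set (euclid R d) -> \bar R} :=
  match d with
  | 0 => \d_([tuple] : euclid R 0)
  | n.+1 => lebesgue_step (lebesgue_measure_euclid n)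
  end.

Lemma lebesgue_measure_euclid_box {R : realType} (d : nat)
    (A : 'I_d -> set (measurableTypeR R)) :
  (forall i, measurable (A i)) ->
  lebesgue_measure_euclid d [set x : euclid R d | forall i, A i (tnth x i)] =
  (\prod_(i < d) lebesgue_measure (A i))%E.
Proof.
elim: d A => [|n IH] A mA.
  by rewrite big_ord0 /= diracE mem_set// => -[].
rewrite big_ord_recl -IH//= -lebesgue_step_box//; last first.
  rewrite (_ : mkset _ = \bigcap_(i in [set: 'I_n])
      ((@tnth n _ ^~ i) @^-1` A (lift ord0 i))); last first.
    by apply/seteqP; split=> x xA i; [move=> _|]; exact: xA.
  apply: fin_bigcap_measurable => [|i _]; first exact: finite_finset.
  by rewrite -[X in measurable X]setTI; exact: measurable_tnth.
congr (lebesgue_step _ _); apply/seteqP; split=> x /=.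
  move=> xA; split=> [|i]; first exact: xA.
  by rewrite tnth_behead (_ : inord _ = lift ord0 i)//; apply: val_inj; rewrite /= inordK ?ltnS.
move=> [xA0 xA] i; case: (unliftP ord0 i) => [j ->|->//].
have := xA j; rewrite tnth_behead (_ : inord _ = lift ord0 j)//.
by apply: val_inj; rewrite /= inordK ?ltnS.
Qed.

Section complex_analysis.
Context {R : realType}.

Definition cintegral {dd} {T : measurableType dd}
    (mu : {measure set T -> \bar R}) (D : set T) (f : T -> R[i]) : R[i] :=
  (\int[mu]_(x in D) complex.Re (f x)) +i* (\int[mu]_(x in D) complex.Im (f x)).

Definition cexp (z : R[i]) : R[i] :=
  (expR (complex.Re z) * cos (complex.Im z)) +i* (expR (complex.Re z) * sin (complex.Im z)).

(* x ^ s for x > 0 (principal branch). *)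
Definition cpow (x : R) (s : R[i]) : R[i] := cexp (s * (ln x)%:C).

(* Euler's integral, i.e. the Gamma function on the half plane 0 < Re s. *)
Definition cGamma (s : R[i]) : R[i] :=
  cintegral lebesgue_measure `]0, +oo[
    (fun x : R => cpow x (s - 1) * (expR (- x))%:C).

(* (2 pi i)^-1 times the integral of F along the upward line Re s = c. *)
Definition mellin_barnes (c : R) (F : R[i] -> R[i]) : R[i] :=
  ((2 * pi)%:C * 'i%C)^-1 *
  cintegral lebesgue_measure setT (fun tau : R => F (c +i* tau) * 'i%C).

End complex_analysis.

Section fundamental_solution.
Context {R : realType} {d : nat}.
Variables (alpha beta c : R).
Local Notation mu := (lebesgue_measure_euclid d).

(* When 0 < c < min(1, d/beta) the five Gamma factors are only evaluated at
   points with positive real part. The integrand at conj s is the conjugate of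
   its value at s, so the value is real; it is kept in R[i]. *)
Definition Zkernel (t : R) (x : euclid R d) : R[i] :=
  let z := 2 `^ beta * t `^ alpha * enorm x `^ (- beta) in
  (pi `^ (- (d%:R / 2)) * (enorm x ^+ d)^-1)%:C *
  mellin_barnes c (fun s =>
    cGamma s * cGamma ((d%:R / 2)%:C - (beta / 2)%:C * s) * cGamma (1 - s) /
    (cGamma ((beta / 2)%:C * s) * cGamma (1 - alpha%:C * s)) *
    cpow z (- s)).

Definition mild_solution (u0 : euclid R d -> R) (t : R) (x : euclid R d) : R[i] :=
  cintegral mu setT (fun y => Zkernel t (esub x y) * (u0 y)%:C).

End fundamental_solution.

Section norms.
Context {R : realType} {dd} {T : measurableType dd}.
Variable mu : {measure set T -> \bar R}.
Implicit Types g : T -> R[i].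

Definition L2norm g : \bar R := Lnorm mu 2%:E (fun x => (normc (g x))%:E).

Definition weakL2norm g : \bar R :=
  ereal_sup [set (l%:E * (mu [set x | (l < normc (g x))%R]) `^ 2^-1)%E
            | l in [set l : R | 0 < l]].

End norms.

(* Main.v *)
(* The decay of |Gamma (a + i tau)| like exp (- pi |tau| / 2), uniform on vertical strips, makes the
   Mellin-Barnes integral of Z absolutely convergent, and the contour can be moved to any abscissa
   a in (0, min (1, d / beta)): |Z (t, x)| <= C t^(- alpha a) |x|^(beta a - d). When d >= 2 beta the
   abscissa a = 1 of the pole of Gamma (1 - s) is reached as well. If H (L) is the contour integral as
   a function of L = ln z, the derivative of e^L H (L) is an integral without this pole, so its
   contour can be moved beyond 1; it is therefore integrable at infinity and e^L H (L) is bounded.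
   For d < 2 beta, using an abscissa below d / (2 beta) for large |x| and one above it for small |x|
   bounds the L^2 norm of Z (t, .), and Young's inequality L^2 * L^1 applies. For d > 2 beta the
   kernel t^(- alpha) |x|^(beta - d) is integrable near 0 and square integrable at infinity. For
   d = 2 beta it is cut at a radius for which the outer part convolved with u0 stays below a quarter
   of the level; the inner part is handled by Markov's inequality. *)
Require Import Defs.
From HB Require Import structures.
From mathcomp Require Import all_boot all_order all_algebra.
From mathcomp Require Import all_classical all_reals all_analysis.
From mathcomp Require Import complex.
From mathcomp Require Import measurable_realfun.
From mathcomp Require Import ring lra.

Set Implicit Arguments.
Unset Strict Implicit.
Unset Printing Implicit Defensive.

Import Order.TTheory GRing.Theory Num.Theory.
Import numFieldNormedType.Exports.
Import Normc.

Local Open Scope classical_set_scope.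
Local Open Scope complex_scope.
Local Open Scope ring_scope.

(** * Complex modulus and exponential *)

(** Contours are moved without path integrals or residues. Through the uniform Taylor remainder of
    [hol], the Cauchy-Riemann relation turns a small change of the abscissa of a vertical integral
    into a translation along the line, which affects only its two ends. Crossing the pole at s = 1
    would require its residue; the differential relation for e^L H (L) avoids this, since
    boundedness of that function is exactly the estimate at abscissa 1. The rate pi / 2 for Gamma
    comes from no asymptotic expansion: the functional equation carries the point far to the right,
    where |Gamma (M + i tau)| and Gamma (M) are comparable. The threshold d = 2 beta is where
    |x|^(beta - d) ceases to be square integrable at infinity. Below it the critical abscissa is d /
    (2 beta) < 1: there |Z|^2 is only bounded by a multiple of |x|^(-d), which diverges
    logarithmically at 0 and at infinity. Hence two abscissae on either side of it are combined at
    the scale |x| = t^(alpha / beta). *)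

Section complex_norm.
Context {R : realType}.
Implicit Types (z w : R[i]) (x : R).

Lemma ReM z w : complex.Re (z * w) = complex.Re z * complex.Re w - complex.Im z * complex.Im w.
Proof. by case: z => a b; case: w. Qed.

Lemma ImM z w : complex.Im (z * w) = complex.Re z * complex.Im w + complex.Im z * complex.Re w.
Proof. by case: z => a b; case: w. Qed.

Lemma ReD z w : complex.Re (z + w) = complex.Re z + complex.Re w.
Proof. by case: z => a b; case: w. Qed.

Lemma ImD z w : complex.Im (z + w) = complex.Im z + complex.Im w.
Proof. by case: z => a b; case: w. Qed.

Lemma ReN z : complex.Re (- z) = - complex.Re z.
Proof. by case: z. Qed.

Lemma ImN z : complex.Im (- z) = - complex.Im z.
Proof. by case: z. Qed.

Definition reimE := (ReM, ImM, ReD, ImD, ReN, ImN).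

Lemma eq_reim z w : complex.Re z = complex.Re w -> complex.Im z = complex.Im w -> z = w.
Proof. by case: z => a b; case: w => c d /= -> ->. Qed.

Lemma normc_ge0 z : 0 <= normc z.
Proof. by case: z => a b; exact: sqrtr_ge0. Qed.

Lemma sqr_normc z : normc z ^+ 2 = complex.Re z ^+ 2 + complex.Im z ^+ 2.
Proof. by case: z => a b; rewrite /= sqr_sqrtr// addr_ge0// sqr_ge0. Qed.

Lemma normc_real x : normc x%:C = `|x|.
Proof. by rewrite /= expr0n/= addr0 sqrtr_sqr. Qed.

Lemma normRe_le z : `|complex.Re z| <= normc z.
Proof.
rewrite -(@ler_pXn2r _ 2)// ?nnegrE ?normc_ge0// real_normK ?num_real//.
by rewrite sqr_normc lerDl sqr_ge0.
Qed.

Lemma normIm_le z : `|complex.Im z| <= normc z.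
Proof.
rewrite -(@ler_pXn2r _ 2)// ?nnegrE ?normc_ge0// real_normK ?num_real//.
by rewrite sqr_normc lerDr sqr_ge0.
Qed.

Lemma normc_le_reim z : normc z <= `|complex.Re z| + `|complex.Im z|.
Proof.
rewrite -(@ler_pXn2r _ 2)// ?nnegrE ?normc_ge0 ?addr_ge0//.
rewrite sqr_normc sqrrD !real_normK ?num_real//.
by rewrite -addrA [X in _ <= _ + X]addrC addrA lerDl mulrn_wge0// mulr_ge0.
Qed.

Lemma normc_eq0 z : (normc z == 0) = (z == 0).
Proof. by apply/eqP/eqP => [/eq0_normc//|->]; rewrite normc0. Qed.

Lemma normc_gt0 z : (0 < normc z) = (z != 0).
Proof. by rewrite lt_neqAle normc_ge0 andbT eq_sym normc_eq0. Qed.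

Lemma normci : normc ('i%C : R[i]) = 1.
Proof. by rewrite /= expr0n/= expr1n add0r sqrtr1. Qed.

Lemma normcX z n : normc (z ^+ n) = normc z ^+ n.
Proof. by elim: n => [|n IH]; rewrite ?expr0 ?normc1// !exprS normcM IH. Qed.

Lemma normc_prod (I : Type) (r : seq I) (P : pred I) (F : I -> R[i]) :
  normc (\prod_(i <- r | P i) F i) = \prod_(i <- r | P i) normc (F i).
Proof. by elim/big_rec2: _ => [|i y1 y2 _ <-]; rewrite ?normc1 ?normcM. Qed.

Lemma cexpD z w : cexp (z + w) = cexp z * cexp w.
Proof.
apply: eq_reim; rewrite ?reimE /cexp /= ?reimE expRD ?cosD ?sinD; ring.
Qed.

Lemma normc_cexp z : normc (cexp z) = expR (complex.Re z).
Proof.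
have := sqr_normc (cexp z); rewrite /cexp /= !exprMn -mulrDr cos2Dsin2 mulr1.
move=> h; apply/eqP; rewrite -(@eqrXn2 _ 2)// ?sqrtr_ge0 ?expR_ge0//.
by rewrite h.
Qed.

Lemma cexp_real x : cexp x%:C = (expR x)%:C :> R[i].
Proof. by rewrite /cexp /= cos0 sin0 mulr1 mulr0. Qed.

End complex_norm.

(** * Taylor remainders and a mean value inequality *)

Section elementary_bounds.
Context {R : realType}.
Implicit Types x u v : R.

Lemma expR_sub1_le x : `|expR x - 1| <= `|x| * expR `|x|.
Proof.
have h y : 0 <= y -> expR y - 1 <= y * expR y.
  move=> y0; have := expR_ge1Dx (- y); rewrite expRN => h.
  have e0 := expR_gt0 y.
  have: (1 - y) * expR y <= 1.
    by rewrite -ler_pdivlMr// div1r.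
  by lra.
have [x0|x0] := leP 0 x.
  by rewrite !ger0_norm ?h// subr_ge0 -expR0 ler_expR.
rewrite ltr0_norm; last by rewrite subr_lt0 -expR0 ltr_expR.
rewrite ltr0_norm// opprB.
have := expR_ge1Dx x; have : 1 <= expR (- x) by rewrite -expR0 ler_expR; lra.
by nra.
Qed.

Lemma le_expR_norm x : expR x <= expR `|x|.
Proof. by rewrite ler_expR ler_norm. Qed.

Lemma expR_ge1_norm x : 1 <= expR `|x|.
Proof. by rewrite -expR0 ler_expR. Qed.

Lemma MVT_bound (f f' : R -> R) (M : R) x :
  (forall y : R, `|y| <= `|x| -> is_derive y (1 : R) f (f' y)) ->
  (forall y, `|y| <= `|x| -> `|f' y| <= M) -> `|f x - f 0| <= M * `|x|.
Proof.
move=> df fM.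
have fc : {in `[- `|x|, `|x|], forall y : R, is_derive y (1 : R) f (f' y)}.
  by move=> y; rewrite in_itv/= -ler_norml => /df.
have cf a b : - `|x| <= a -> b <= `|x| -> {within `[a, b], continuous f}.
  move=> ha hb; apply: derivable_within_continuous => y.
  rewrite in_itv/= => /andP[ay yb]; apply: ex_derive; apply: fc.
  by rewrite in_itv/= (le_trans ha)// (le_trans yb).
have [x0|x0|->] := ltgtP x 0; last by rewrite subrr !normr0 mulr0.
- have nx := ltr0_norm x0.
  have [|y|y] := @MVT R f f' x 0 x0.
  + move=> y; rewrite in_itv/= => /andP[xy y0]; apply: df.
    by rewrite nx ltr0_norm// lerN2 ltW.
  + by apply: cf; rewrite nx ?opprK// oppr_ge0 ltW.
  rewrite in_itv/= => /andP[xy y0]; rewrite -normrN opprB => ->.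
  rewrite normrM add0r normrN ler_wpM2r// fM// nx ltr0_norm// lerN2 ltW//.
- have nx := gtr0_norm x0.
  have [|y|y] := @MVT R f f' 0 x x0.
  + move=> y; rewrite in_itv/= => /andP[xy y0]; apply: df.
    by rewrite nx gtr0_norm// ltW.
  + by apply: cf; rewrite nx // oppr_le0 ltW.
  rewrite in_itv/= => /andP[xy y0]; move => ->.
  by rewrite normrM subr0 ler_wpM2r// fM// nx gtr0_norm// ltW.
Qed.

Lemma sin_le_norm x : `|sin x| <= `|x|.
Proof.
have := @MVT_bound sin cos 1 x; rewrite sin0 subr0 mul1r; apply => y _.
by rewrite ler_norml cos_geN1 cos_le1.
Qed.

Lemma cos_sub1_le x : `|cos x - 1| <= x ^+ 2.
Proof.
have := @MVT_bound cos (fun y => - sin y) `|x| x; rewrite cos0 -expr2.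
rewrite real_normK ?num_real//; apply => y xy.
by rewrite normrN (le_trans (sin_le_norm y)).
Qed.

Lemma cos_ge_sqr x : 1 - x ^+ 2 <= cos x.
Proof. by have := cos_sub1_le x; rewrite ler_norml => /andP[]; lra. Qed.

Lemma sin_sub_le x : `|sin x - x| <= `|x| ^+ 3.
Proof.
have := @MVT_bound (fun y => sin y - y) (fun y => cos y - 1) (`|x| ^+ 2) x.
rewrite sin0 !subr0 -exprSr; apply => y xy.
by rewrite (le_trans (cos_sub1_le y))// -normrX -[leLHS]ger0_norm ?sqr_ge0// !normrX lerXn2r// nnegrE.
Qed.

Lemma sin_sub_le2 x : `|sin x - x| <= 2 * x ^+ 2.
Proof.
rewrite -[x ^+ 2]ger0_norm ?sqr_ge0// normrX.
have [x1|x1] := leP `|x| 1.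
  rewrite (le_trans (sin_sub_le x))// exprS ler_wpM2r// ?exprn_ge0//; lra.
rewrite (le_trans (ler_normB _ _))//.
have h1 := sin_le_norm x; have : `|x| <= `|x| ^+ 2 by rewrite expr2 ler_peMl// ltW.
by lra.
Qed.

Lemma expR_sub1x_le x : `|expR x - 1 - x| <= x ^+ 2 * expR `|x|.
Proof.
have := @MVT_bound (fun y => expR y - 1 - y) (fun y => expR y - 1) (`|x| * expR `|x|) x.
rewrite expR0 subrr !subr0 mulrAC -expr2 real_normK ?num_real//; apply => y xy.
  by rewrite -[X in _ - X]/((1 : R)) -[expR y in X in is_derive _ _ _ X]subr0; exact: is_deriveB.
by rewrite (le_trans (expR_sub1_le y))// ler_pM// ler_expR.
Qed.

(** Only the real part of z enters the exponential factor. This matters for z = s h with s on a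
    vertical line: [normc z] is then unbounded while its real part stays bounded. *)
Lemma cexp_sub1x_le (z : R[i]) :
  normc (cexp z - 1 - z) <= 6 * normc z ^+ 2 * expR `|complex.Re z|.
Proof.
rewrite sqr_normc; apply: le_trans (normc_le_reim _) _.
rewrite !reimE; case: z => u v /=; rewrite subr0.
have e1 := expR_ge1_norm u; have e2 := le_expR_norm u; have e0 := expR_gt0 u.
have -> : expR u * cos v - 1 - u = (expR u - 1 - u) + expR u * (cos v - 1) by ring.
have -> : expR u * sin v - v = expR u * (sin v - v) + (expR u - 1) * v by ring.
have h1 := expR_sub1x_le u; have h2 := cos_sub1_le v.
have h3 := sin_sub_le2 v; have h4 := expR_sub1_le u.
have a1 : `|expR u * (cos v - 1)| <= expR `|u| * v ^+ 2.
  by rewrite normrM ler_pM// ger0_norm// expR_ge0.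
have a2 : `|expR u * (sin v - v)| <= expR `|u| * (2 * v ^+ 2).
  by rewrite normrM ler_pM// ger0_norm// expR_ge0.
have a3 : `|(expR u - 1) * v| <= expR `|u| * (u ^+ 2 + v ^+ 2).
  rewrite normrM (@le_trans _ _ ((`|u| * expR `|u|) * `|v|)) ?ler_wpM2r//.
  rewrite mulrAC mulrC ler_wpM2l ?expR_ge0//.
  rewrite -(real_normK (num_real u)) -(real_normK (num_real v)).
  have := sqr_ge0 (`|u| - `|v|); nra.
have b1 := ler_normD (expR u - 1 - u) (expR u * (cos v - 1)).
have b2 := ler_normD (expR u * (sin v - v)) ((expR u - 1) * v).
have su := sqr_ge0 u; have sv := sqr_ge0 v.
by nra.
Qed.

(* A mean value inequality with no derivative: cut [[a, b]] into n pieces and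
   let n go to infinity. *)
Lemma quasi_MVT (E : R -> R[i]) (A C h0 a b : R) : a <= b -> 0 < h0 -> 0 <= C ->
  (forall y h, a <= y -> 0 < h <= h0 -> y + h <= b ->
     normc (E (y + h) - E y) <= A * h + C * h ^+ 2) ->
  normc (E b - E a) <= A * (b - a).
Proof.
move=> ab h00 C0 EC.
have [ba|ba] := eqVneq a b; first by rewrite ba !subrr normc0 mulr0.
have {}ab : 0 < b - a by rewrite subr_gt0 lt_neqAle ba ab.
apply/ler_addgt0Pl => e e0.
(* The first summand makes the mesh h at most [h0]; the second makes the accumulated quadratic error
   C * (b - a) * h at most [e]. *)
pose n := (Num.trunc ((b - a) / h0 + C * (b - a) ^+ 2 / e)).+1.
have n0 : 0 < n%:R :> R by rewrite ltr0n.
have hn : (b - a) / h0 + C * (b - a) ^+ 2 / e < n%:R by exact: truncnS_gt.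
have p1 : 0 < (b - a) / h0 by rewrite divr_gt0.
have p2 : 0 <= C * (b - a) ^+ 2 / e by rewrite divr_ge0 ?mulr_ge0 ?sqr_ge0// ltW.
pose h := (b - a) / n%:R.
have hpos : 0 < h by rewrite divr_gt0.
have hh0 : h <= h0.
  rewrite ler_pdivrMr// mulrC -ler_pdivrMr//.
  by rewrite (le_trans _ (ltW hn))// lerDl.
have hC : C * (b - a) * h <= e.
  rewrite mulrA ler_pdivrMr// -mulrA -expr2 [leRHS]mulrC -ler_pdivrMr//.
  by rewrite (le_trans _ (ltW hn))// lerDr ltW.
have hk (k : nat) : (k <= n)%N ->
    normc (E (a + k%:R * h) - E a) <= (A * h + C * h ^+ 2) * k%:R.
  elim: k => [|k IH] kn; first by rewrite mul0r addr0 subrr normc0 mulr0.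
  have -> : E (a + k.+1%:R * h) - E a =
     (E (a + k%:R * h + h) - E (a + k%:R * h)) + (E (a + k%:R * h) - E a).
    by rewrite addrA subrK -addrA -[X in _ + X * _]natr1 mulrDl mul1r.
  rewrite (le_trans (le_normcD _ _))// -[k.+1%:R]natr1 mulrDr mulr1 addrC lerD//.
    exact/IH/ltnW.
  apply: EC; first by rewrite lerDl mulr_ge0// ltW.
    by rewrite hpos.
  have -> : b = a + n%:R * h by rewrite mulrCA mulfV ?gt_eqF// mulr1 addrCA subrr addr0.
  rewrite -addrA lerD2l -[X in _ + X]mul1r -mulrDl ler_wpM2r ?(ltW hpos)//.
  by rewrite natr1 ler_nat.
have := hk n (leqnn n).
have nh : n%:R * h = b - a by rewrite mulrCA mulfV ?gt_eqF// mulr1.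
rewrite nh addrCA subrr addr0 => /le_trans; apply.
have -> : (A * h + C * h ^+ 2) * n%:R = A * (n%:R * h) + C * (n%:R * h) * h by ring.
by rewrite nh addrC lerD2r.
Qed.

End elementary_bounds.

(** * Complex-valued integrals *)

Section complex_integral.
Context {R : realType} {dd} {T : measurableType dd}.
Variable mu : {measure set T -> \bar R}.
Implicit Types (D : set T) (f g : T -> R[i]) (b : T -> R).

Definition cmeasurable D f :=
  measurable_fun D (@complex.Re R \o f) /\ measurable_fun D (@complex.Im R \o f).

Lemma cmeasurable_cst D (c : R[i]) : cmeasurable D (fun=> c).
Proof. by split; exact: measurable_cst. Qed.

Lemma cmeasurable_real D b : measurable_fun D b -> cmeasurable D (fun x => (b x)%:C).
Proof. by move=> mb; split=> //; exact: measurable_cst. Qed.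

Lemma cmeasurableM D f g :
  cmeasurable D f -> cmeasurable D g -> cmeasurable D (fun x => f x * g x).
Proof.
move=> [fr fi] [gr gi]; split.
- apply: (eq_measurable_fun (fun x => complex.Re (f x) * complex.Re (g x) - complex.Im (f x) * complex.Im (g x))).
    by move=> x _ /=; rewrite ReM.
  by apply: measurable_funB; exact: measurable_funM.
- apply: (eq_measurable_fun (fun x => complex.Re (f x) * complex.Im (g x) + complex.Im (f x) * complex.Re (g x))).
    by move=> x _ /=; rewrite ImM.
  by apply: measurable_funD; exact: measurable_funM.
Qed.

Lemma cmeasurableD D f g :
  cmeasurable D f -> cmeasurable D g -> cmeasurable D (fun x => f x + g x).
Proof.
move=> [fr fi] [gr gi]; split.
- apply: (eq_measurable_fun (fun x => complex.Re (f x) + complex.Re (g x))).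
    by move=> x _ /=; rewrite ReD.
  exact: measurable_funD.
- apply: (eq_measurable_fun (fun x => complex.Im (f x) + complex.Im (g x))).
    by move=> x _ /=; rewrite ImD.
  exact: measurable_funD.
Qed.

Lemma cmeasurable_cexp D f : cmeasurable D f -> cmeasurable D (fun x => cexp (f x)).
Proof.
move=> [fr fi]; split.
- apply: (eq_measurable_fun (fun x => expR (complex.Re (f x)) * cos (complex.Im (f x)))) => //.
  apply: measurable_funM; first exact: (measurableT_comp (@measurable_expR R)).
  by apply: (measurableT_comp _ fi); apply: continuous_measurable_fun; exact: continuous_cos.
- apply: (eq_measurable_fun (fun x => expR (complex.Re (f x)) * sin (complex.Im (f x)))) => //.
  apply: measurable_funM; first exact: (measurableT_comp (@measurable_expR R)).
  by apply: (measurableT_comp _ fi); apply: continuous_measurable_fun; exact: continuous_sin.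
Qed.

Lemma cmeasurable_normc D f : cmeasurable D f -> measurable_fun D (fun x => normc (f x)).
Proof.
move=> [fr fi].
apply: (eq_measurable_fun (fun x => Num.sqrt (complex.Re (f x) ^+ 2 + complex.Im (f x) ^+ 2))).
  by move=> x _; case: (f x).
have ms : measurable_fun setT (Num.sqrt : R -> R).
  by apply: continuous_measurable_fun; exact: sqrt_continuous.
apply: (measurableT_comp ms).
by apply: measurable_funD; exact: measurable_funX.
Qed.

Definition cintegrable D f :=
  mu.-integrable D (EFin \o (@complex.Re R \o f)) /\ mu.-integrable D (EFin \o (@complex.Im R \o f)).

Lemma cintegrable_le D f b : measurable D -> cmeasurable D f ->
  mu.-integrable D (EFin \o b) -> (forall x, D x -> normc (f x) <= b x) ->
  cintegrable D f.
Proof.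
move=> mD [fr fi] ib fb; split; (apply: (le_integrable mD _ _ ib);
  first exact/measurable_EFinP) => x Dx; rewrite /= lee_fin.
- by rewrite (le_trans (normRe_le _))// (le_trans (fb x Dx))// ler_norm.
- by rewrite (le_trans (normIm_le _))// (le_trans (fb x Dx))// ler_norm.
Qed.

(** Real and imaginary parts are estimated separately, whence the factor 2; it only affects
    constants. *)
Lemma normc_cintegral_le D f b : measurable D -> cmeasurable D f ->
  mu.-integrable D (EFin \o b) -> (forall x, D x -> normc (f x) <= b x) ->
  normc (cintegral mu D f) <= 2 * \int[mu]_(x in D) b x.
Proof.
move=> mD mf ib fb; have [ir ii] := cintegrable_le mD mf ib fb.
apply: le_trans (normc_le_reim _) _; rewrite mulrC mulr_natr mulr2n; apply: lerD.
- apply: le_trans (le_normr_Rintegral mD ir) _.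
  apply: le_Rintegral => //.
    exact: (integrable_abse ir).
  by move=> x Dx; rewrite (le_trans (normRe_le _)) ?fb.
- apply: le_trans (le_normr_Rintegral mD ii) _.
  apply: le_Rintegral => //.
    exact: (integrable_abse ii).
  by move=> x Dx; rewrite (le_trans (normIm_le _)) ?fb.
Qed.

Lemma eq_cintegral D f g : {in D, f =1 g} -> cintegral mu D f = cintegral mu D g.
Proof. by move=> fg; rewrite /cintegral; congr (_ +i* _); apply: eq_Rintegral => x xD; rewrite fg. Qed.

Lemma Re_cintegral D f :
  complex.Re (cintegral mu D f) = \int[mu]_(x in D) complex.Re (f x).
Proof. by []. Qed.

Lemma Im_cintegral D f :
  complex.Im (cintegral mu D f) = \int[mu]_(x in D) complex.Im (f x).
Proof. by []. Qed.

Lemma cintegrableB D f g : measurable D -> cintegrable D f -> cintegrable D g ->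
  cintegrable D (fun x => f x - g x).
Proof.
move=> mD [fr fi] [gr gi]; split.
- rewrite (_ : _ \o _ = (EFin \o (@complex.Re R \o f)) \- (EFin \o (@complex.Re R \o g)))%E.
    exact: integrableB.
  by apply/funext => x /=; rewrite ReD ReN EFinB.
- rewrite (_ : _ \o _ = (EFin \o (@complex.Im R \o f)) \- (EFin \o (@complex.Im R \o g)))%E.
    exact: integrableB.
  by apply/funext => x /=; rewrite ImD ImN EFinB.
Qed.

Lemma cintegralB D f g : measurable D -> cintegrable D f -> cintegrable D g ->
  cintegral mu D (fun x => f x - g x) = cintegral mu D f - cintegral mu D g.
Proof.
move=> mD [fr fi] [gr gi]; apply: eq_reim; rewrite !reimE /=.
- rewrite -RintegralB//; apply: eq_Rintegral => x _; by rewrite !reimE.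
- rewrite -RintegralB//; apply: eq_Rintegral => x _; by rewrite !reimE.
Qed.

Lemma cintegrableZ D (c : R[i]) f : measurable D -> cintegrable D f ->
  cintegrable D (fun x => c * f x).
Proof.
move=> mD [fr fi]; split.
- rewrite (_ : _ \o _ = (fun x => (complex.Re c)%:E * (EFin \o (@complex.Re R \o f)) x - (complex.Im c)%:E * (EFin \o (@complex.Im R \o f)) x)%E).
    by apply: integrableB => //; exact: integrableZl.
  by apply/funext => x /=; rewrite ReM EFinB !EFinM.
- rewrite (_ : _ \o _ = (fun x => (complex.Re c)%:E * (EFin \o (@complex.Im R \o f)) x + (complex.Im c)%:E * (EFin \o (@complex.Re R \o f)) x)%E).
    by apply: integrableD => //; exact: integrableZl.
  by apply/funext => x /=; rewrite ImM EFinD !EFinM.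
Qed.

Lemma integrable_mulrl D (k : R) b : measurable D -> mu.-integrable D (EFin \o b) ->
  mu.-integrable D (EFin \o (fun x => k * b x)).
Proof.
move=> mD ib.
rewrite (_ : _ \o _ = fun x => (k%:E * (EFin \o b) x)%E) //.
exact: integrableZl.
Qed.

Lemma cintegralZ D (c : R[i]) f : measurable D -> cintegrable D f ->
  cintegral mu D (fun x => c * f x) = c * cintegral mu D f.
Proof.
move=> mD [fr fi]; apply: eq_reim; rewrite !reimE /=.
- rewrite -!RintegralZl// -RintegralB//.
  + by apply: eq_Rintegral => x _; rewrite !reimE.
  + exact: integrable_mulrl.
  + exact: integrable_mulrl.
- rewrite -!RintegralZl// -RintegralD//.
  + by apply: eq_Rintegral => x _; rewrite !reimE.
  + exact: integrable_mulrl.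
  + exact: integrable_mulrl.
Qed.

End complex_integral.

(** * Quantitative holomorphy and its stability *)

Section holomorphic.
Context {R : realType}.
Implicit Types (F G : R[i] -> R[i]) (K : set R[i]).

(* Complex differentiability in a quantitative form that passes to integrals with a parameter:
   one bound serves for the function, its derivative and the quadratic remainder on all of K. *)
Definition hol F K := exists (F' : R[i] -> R[i]) (M delta : R),
  [/\ 0 <= M, 0 < delta <= 1 & forall s, K s ->
    [/\ normc (F s) <= M, normc (F' s) <= M & forall h, normc h <= delta -> K (s + h) ->
      normc (F (s + h) - F s - h * F' s) <= M * normc h ^+ 2]].

Lemma holS F K K' : K' `<=` K -> hol F K -> hol F K'.
Proof.
move=> KK [F' [M [de [M0 de0 H]]]]; exists F', M, de; split=> // s Ks.
have [h1 h2 h3] := H s (KK s Ks).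
by split=> // h hd Ksh; apply: h3 => //; exact: KK.
Qed.

Lemma hol_ext F G K : (forall s, K s -> F s = G s) -> hol F K -> hol G K.
Proof.
move=> FG [F' [M [de [M0 de0 H]]]]; exists F', M, de; split=> // s Ks.
have [h1 h2 h3] := H s Ks.
by split=> //; rewrite -?FG// => h hd Ksh; rewrite -!FG//; exact: h3.
Qed.

Lemma hol_lipschitz F K : hol F K -> exists L de : R, [/\ 0 <= L, 0 < de <= 1 &
  forall s h, K s -> K (s + h) -> normc h <= de -> normc (F (s + h) - F s) <= L * normc h].
Proof.
move=> [F' [M [de [M0 /andP[de0 de1] H]]]]; exists (2 * M), de; split=> //.
- by rewrite mulr_ge0.
- by rewrite de0.
move=> s h Ks Ksh hd; have [h1 h2 h3] := H s Ks.
have -> : F (s + h) - F s = (F (s + h) - F s - h * F' s) + h * F' s by ring.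
apply: le_trans (le_normcD _ _) _; rewrite normcM.
have nh := normc_ge0 h.
have -> : 2 * M * normc h = M * normc h + normc h * M by ring.
apply: lerD; last by rewrite ler_wpM2l.
rewrite (le_trans (h3 h hd Ksh))// ler_wpM2l// expr2 ler_piMr//.
exact: le_trans de1.
Qed.

Lemma hol_mul F G K : hol F K -> hol G K -> hol (fun s => F s * G s) K.
Proof.
move=> [F' [M [d1 [M0 /andP[d10 d11] HF]]]] hG.
have [L [d3 [L0 /andP[d30 d31] HL]]] := hol_lipschitz hG.
have [G' [N [d2 [N0 /andP[d20 d21] HG]]]] := hG.
exists (fun s => F' s * G s + F s * G' s), (2 * M * N + M * L), (Num.min (Num.min d1 d2) d3).
have MN : 0 <= M * N by rewrite mulr_ge0.
have ML : 0 <= M * L by rewrite mulr_ge0.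
split.
- lra.
- by rewrite !lt_min d10 d20 d30/= !ge_min d11.
move=> s Ks; have [f1 f2 f3] := HF s Ks; have [g1 g2 g3] := HG s Ks.
have nF := normc_ge0 (F s); have nF' := normc_ge0 (F' s).
have nG := normc_ge0 (G s); have nG' := normc_ge0 (G' s).
split.
- rewrite normcM; have : normc (F s) * normc (G s) <= M * N by rewrite ler_pM.
  lra.
- apply: le_trans (le_normcD _ _) _; rewrite !normcM.
  have : normc (F s) * normc (G' s) <= M * N by rewrite ler_pM.
  have : normc (F' s) * normc (G s) <= M * N by rewrite ler_pM.
  lra.
move=> h; rewrite !le_min => /andP[/andP[hd1 hd2] hd3] Ksh.
have -> : F (s + h) * G (s + h) - F s * G s - h * (F' s * G s + F s * G' s) =
  (F (s + h) - F s - h * F' s) * G (s + h) + h * (F' s * (G (s + h) - G s))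
   + F s * (G (s + h) - G s - h * G' s) by ring.
have [g1' _ _] := HG (s + h) Ksh.
have {}f3 := f3 h hd1 Ksh; have {}g3 := g3 h hd2 Ksh; have hl := HL s h Ks Ksh hd3.
apply: le_trans (le_normcD _ _) _.
apply: le_trans (lerD (le_normcD _ _) (lexx _)) _; rewrite !normcM.
have nh := normc_ge0 h.
have e1 : normc (F (s + h) - F s - h * F' s) * normc (G (s + h)) <= M * normc h ^+ 2 * N.
  by rewrite ler_pM ?normc_ge0.
have e2 : normc h * (normc (F' s) * normc (G (s + h) - G s)) <= normc h * (M * (L * normc h)).
  by rewrite ler_wpM2l// ler_pM ?normc_ge0.
have e3 : normc (F s) * normc (G (s + h) - G s - h * G' s) <= M * (N * normc h ^+ 2).
  by rewrite ler_pM ?normc_ge0.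
by apply: le_trans (lerD (lerD e1 e2) e3) _; rewrite le_eqVlt; apply/orP; left; apply/eqP; ring.
Qed.

Lemma hol_inv F K (m : R) : 0 < m -> (forall s, K s -> m <= normc (F s)) ->
  hol F K -> hol (fun s => (F s)^-1) K.
Proof.
move=> m0 Fm hF.
have [L [d3 [L0 /andP[d30 d31] HL]]] := hol_lipschitz hF.
have [F' [M [d1 [M0 /andP[d10 d11] HF]]]] := hF.
have hm : 0 < m^-1 by rewrite invr_gt0.
have hM1 : 0 <= M * m^-1 ^+ 2 by rewrite mulr_ge0// sqr_ge0.
have hM2 : 0 <= M * L * m^-1 ^+ 3 by rewrite !mulr_ge0// ltW.
exists (fun s => - (F' s * (F s)^-1 ^+ 2)), (m^-1 + M * m^-1 ^+ 2 + M * L * m^-1 ^+ 3), (Num.min d1 d3).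
split.
- by rewrite !addr_ge0// ltW.
- by rewrite !lt_min d10 d30/= !ge_min d11.
have FV s : K s -> normc (F s)^-1 <= m^-1.
  by move=> Ks; rewrite normcV lef_pV2 ?posrE ?Fm// (lt_le_trans m0) ?Fm.
have Fn0 s : K s -> F s != 0 by move=> Ks; rewrite -normc_gt0 (lt_le_trans m0) ?Fm.
move=> s Ks; have [f1 f2 f3] := HF s Ks.
have hs := FV s Ks; have nV := normc_ge0 (F s)^-1.
split.
- by apply: le_trans hs _; rewrite -addrA lerDl addr_ge0.
- rewrite normcN normcM normcX (@le_trans _ _ (M * m^-1 ^+ 2))//.
    by rewrite ler_pM ?normc_ge0 ?exprn_ge0// lerXn2r ?nnegrE// ltW.
  by rewrite -addrA addrCA lerDl addr_ge0// ltW.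
move=> h; rewrite !le_min => /andP[hd1 hd3] Ksh.
have {}f3 := f3 h hd1 Ksh; have hl := HL s h Ks Ksh hd3.
have -> : (F (s + h))^-1 - (F s)^-1 - h * - (F' s * (F s)^-1 ^+ 2) =
  h * (F' s * ((F (s + h) - F s) * ((F s)^-1 * (F s)^-1 * (F (s + h))^-1)))
  - (F (s + h) - F s - h * F' s) * ((F s)^-1 * (F (s + h))^-1).
  by have a := Fn0 _ Ks; have b := Fn0 _ Ksh; field; apply/andP.
have hs' := FV _ Ksh; have nV' := normc_ge0 (F (s + h))^-1; have nh := normc_ge0 h.
apply: le_trans (le_normcD _ _) _; rewrite normcN !normcM.
have e0 : normc (F s)^-1 * normc (F s)^-1 * normc (F (s + h))^-1 <= m^-1 ^+ 3.
  by rewrite [_ ^+ 3]exprSr expr2 !ler_pM// mulr_ge0.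
have e1 : normc h * (normc (F' s) * (normc (F (s + h) - F s) * (normc (F s)^-1 * normc (F s)^-1 * normc (F (s + h))^-1)))
   <= normc h * (M * ((L * normc h) * m^-1 ^+ 3)).
  rewrite ler_wpM2l// ler_pM ?normc_ge0//; first by rewrite !mulr_ge0 ?normc_ge0.
  by rewrite ler_pM ?normc_ge0// !mulr_ge0.
have e2 : normc (F (s + h) - F s - h * F' s) * (normc (F s)^-1 * normc (F (s + h))^-1)
   <= M * normc h ^+ 2 * (m^-1 * m^-1).
  by rewrite ler_pM ?normc_ge0 ?mulr_ge0 ?normc_ge0// ler_pM.
apply: le_trans (lerD e1 e2) _.
have : 0 <= m^-1 * normc h ^+ 2 by rewrite mulr_ge0 ?exprn_ge0// ltW.
lra.
Qed.

(** A slope of modulus at most 1 keeps the step below [delta] and the bound [M] unchanged. The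
    arguments of the five Gamma factors have slopes 1, - beta / 2, - 1, beta / 2 and - alpha. *)
Lemma hol_comp_affine F (p q : R) K K' : `|q| <= 1 ->
  (forall s, K' s -> K (p%:C + q%:C * s)) -> hol F K -> hol (fun s => F (p%:C + q%:C * s)) K'.
Proof.
move=> q1 KK [F' [M [de [M0 de0 H]]]]; exists (fun s => q%:C * F' (p%:C + q%:C * s)), M, de.
split=> // s Ks; have [h1 h2 h3] := H _ (KK _ Ks).
split=> //.
  by rewrite normcM normc_real -[M]mul1r ler_pM// normc_ge0.
move=> h hd Ksh; have qh : normc (q%:C * h) <= normc h.
  by rewrite normcM normc_real ler_piMl// normc_ge0.
have := h3 (q%:C * h) (le_trans qh hd).
have -> : p%:C + q%:C * s + q%:C * h = p%:C + q%:C * (s + h) by ring.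
move=> /(_ (KK _ Ksh)).
have <- : h * (q%:C * F' (p%:C + q%:C * s)) = q%:C * h * F' (p%:C + q%:C * s) by ring.
move=> /le_trans; apply.
by rewrite ler_wpM2l// lerXn2r ?nnegrE ?normc_ge0.
Qed.

Lemma hol_cexp (B : R) (L : R) : hol (fun s => cexp (s * L%:C)) [set s | `|complex.Re s| <= B].
Proof.
have B0 s : [set s : R[i] | `|complex.Re s| <= B] s -> 0 <= B by move=> /(le_trans _); apply.
pose M := expR (B * `|L|) * (1 + `|L| + 6 * L ^+ 2 * expR `|L|).
have sL : 0 <= L ^+ 2 by exact: sqr_ge0.
have e1 : 0 <= expR `|L| by exact: expR_ge0.
have e0 : 0 <= expR (B * `|L|) by exact: expR_ge0.
have nL : 0 <= `|L| by [].
have pr : 0 <= L ^+ 2 * expR `|L| by exact: mulr_ge0.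
exists (fun s => L%:C * cexp (s * L%:C)), M, 1; split.
- by rewrite mulr_ge0// addr_ge0 ?addr_ge0// -mulrA mulr_ge0.
- by rewrite lexx ltr01.
move=> s Ks; have Bp := B0 s Ks.
have ns : normc (cexp (s * L%:C)) <= expR (B * `|L|).
  rewrite normc_cexp ler_expR ReM /= mulr0 subr0.
  rewrite (le_trans (ler_norm _))// normrM ler_wpM2r//; exact: Ks.
have nn := normc_ge0 (cexp (s * L%:C)).
split.
- by apply: (le_trans ns); rewrite /M ler_peMr//; lra.
- rewrite normcM normc_real mulrC /M ler_pM//; lra.
move=> h h1 Ksh.
rewrite mulrDl cexpD.
have -> : cexp (s * L%:C) * cexp (h * L%:C) - cexp (s * L%:C) - h * (L%:C * cexp (s * L%:C))
 = cexp (s * L%:C) * (cexp (h * L%:C) - 1 - h * L%:C) by ring.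
rewrite normcM /M -mulrA ler_pM ?normc_ge0//.
apply: le_trans (cexp_sub1x_le _) _.
rewrite normcM normc_real exprMn real_normK ?num_real//.
have -> : 6 * (normc h ^+ 2 * L ^+ 2) * expR `|complex.Re (h * L%:C)| =
  (6 * L ^+ 2 * expR `|complex.Re (h * L%:C)|) * normc h ^+ 2 by ring.
rewrite ler_wpM2r ?exprn_ge0 ?normc_ge0//.
have : L ^+ 2 * expR `|complex.Re (h * L%:C)| <= L ^+ 2 * expR `|L|.
  rewrite ler_wpM2l// ler_expR ReM /= mulr0 subr0 normrM ler_piMl//.
  exact: le_trans (normRe_le _) h1.
lra.
Qed.

(** Differentiation under the integral sign: as the remainder estimate is quantitative, integrating
    it against the majorant [b] takes the place of a dominated convergence argument. *)
Lemma hol_cintegral {dd} {T : measurableType dd} (mu : {measure set T -> \bar R})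
    (D : set T) (f f' : T -> R[i] -> R[i]) (b : T -> R) (delta : R) K :
  measurable D -> 0 < delta <= 1 -> mu.-integrable D (EFin \o b) ->
  (forall s, K s -> cmeasurable D (f ^~ s)) ->
  (forall s, K s -> cmeasurable D (f' ^~ s)) ->
  (forall x s, D x -> K s -> [/\ normc (f x s) <= b x, normc (f' x s) <= b x &
    forall h, normc h <= delta -> K (s + h) ->
      normc (f x (s + h) - f x s - h * f' x s) <= b x * normc h ^+ 2]) ->
  hol (fun s => cintegral mu D (f ^~ s)) K.
Proof.
move=> mD de ib mf mf' H.
(* Nonnegativity of [b] on D is read off at a point of K, so an empty K is treated apart. *)
have [[s0 Ks0]|nK] := pselect (exists s, K s); last first.
  exists (fun=> 0), 0, 1; split; rewrite ?lexx ?ltr01// => s Ks.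
  by exfalso; apply: nK; exists s.
have b0 x : D x -> 0 <= b x by move=> Dx; have [+ _ _] := H x s0 Dx Ks0; apply: le_trans; exact: normc_ge0.
exists (fun s => cintegral mu D (f' ^~ s)), (2 * \int[mu]_(x in D) b x), delta.
split=> //; first by rewrite mulr_ge0// Rintegral_ge0.
move=> s Ks; split.
- by apply: normc_cintegral_le => //; [exact: mf|move=> x Dx; case: (H x s Dx Ks)].
- by apply: normc_cintegral_le => //; [exact: mf'|move=> x Dx; case: (H x s Dx Ks)].
move=> h hd Ksh.
have i1 : cintegrable mu D (f ^~ s).
  by apply: (cintegrable_le _ _ ib) => //; [exact: mf|move=> x Dx; case: (H x s Dx Ks)].
have i2 : cintegrable mu D (f ^~ (s + h)).
  by apply: (cintegrable_le _ _ ib) => //; [exact: mf|move=> x Dx; case: (H x _ Dx Ksh)].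
have i3 : cintegrable mu D (f' ^~ s).
  by apply: (cintegrable_le _ _ ib) => //; [exact: mf'|move=> x Dx; case: (H x s Dx Ks)].
have i4 := cintegrableZ h mD i3.
rewrite -cintegralZ// -cintegralB// -cintegralB//; last exact: cintegrableB.
have ib2 := integrable_mulrl (normc h ^+ 2) mD ib.
rewrite -mulrA [_ * normc h ^+ 2]mulrC -RintegralZl//.
apply: normc_cintegral_le => //.
  apply: cmeasurableD; last first.
    rewrite (_ : (fun _ => _) = fun x => (-h) * f' x s); last by apply/funext => x; rewrite mulNr.
    by apply: cmeasurableM; [exact: cmeasurable_cst|exact: mf'].
  apply: cmeasurableD; first exact: mf.
  rewrite (_ : (fun _ => _) = fun x => (-1) * f x s); last by apply/funext => x; rewrite mulN1r.
  by apply: cmeasurableM; [exact: cmeasurable_cst|exact: mf].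
move=> x Dx; have [_ _ /(_ h hd Ksh)] := H x s Dx Ks; rewrite [b x * _]mulrC; exact.
Qed.

End holomorphic.

(** * Improper integrals on the half-line *)

Section improper_integral.
Context {R : realType}.
Local Notation mu := (@lebesgue_measure R).

Lemma nondecreasing_set_cvg_Rintegral {dd} {T : measurableType dd}
    (m : {measure set T -> \bar R}) (I : nat -> set T) (f : T -> R) :
  nondecreasing_seq I -> (forall n, measurable (I n)) ->
  m.-integrable (\bigcup_n I n) (EFin \o f) ->
  \int[m]_(x in I n) f x @[n --> \oo] --> \int[m]_(x in \bigcup_n I n) f x.
Proof.
move=> ndI mI ifn; have /integrableP[mf foo] := ifn.
have mU : measurable (\bigcup_n I n) by exact: bigcup_measurable.
have subI n : I n `<=` \bigcup_n I n by exact: bigcup_sup.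
have cvp : (\int[m]_(x in I n) ((EFin \o f)^\+ x) @[n --> \oo] --> \int[m]_(x in \bigcup_n I n) ((EFin \o f)^\+ x))%E.
  apply: ge0_nondecreasing_set_cvg_integral => //.
  by move=> n; exact: measurable_funS mU (@subI n) (measurable_funepos mf).
have cvn : (\int[m]_(x in I n) ((EFin \o f)^\- x) @[n --> \oo] --> \int[m]_(x in \bigcup_n I n) ((EFin \o f)^\- x))%E.
  apply: ge0_nondecreasing_set_cvg_integral => //.
  by move=> n; exact: measurable_funS mU (@subI n) (measurable_funeneg mf).
have fp : (\int[m]_(x in \bigcup_n I n) ((EFin \o f)^\+ x))%E \is a fin_num.
  by apply: integrable_fin_num => //; exact: integrable_funepos.
have fn : (\int[m]_(x in \bigcup_n I n) ((EFin \o f)^\- x))%E \is a fin_num.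
  by apply: integrable_fin_num => //; exact: integrable_funeneg.
apply: fine_cvg; rewrite fineK; last exact: integrable_fin_num.
rewrite [X in _ --> X]integralE; under eq_cvg do rewrite integralE.
by apply: cvgeB => //; rewrite fin_num_adde_defr.
Qed.

Variables u v : nat -> R.
Hypothesis uv : forall n, u n < v n.
Hypothesis u_noninc : forall m n, (m <= n)%N -> u n <= u m.
Hypothesis v_nondec : forall m n, (m <= n)%N -> v m <= v n.

Let I n : set (measurableTypeR R) := `[u n, v n]%classic.
Local Notation D := (\bigcup_n I n).

Let nd_I : nondecreasing_seq I.
Proof.
move=> m n mn; apply/subsetPset => x; rewrite /I /= !in_itv/= => /andP[h1 h2].
by rewrite (le_trans (u_noninc mn) h1) (le_trans h2 (v_nondec mn)).
Qed.

Let mI n : measurable (I n). Proof. exact: measurable_itv. Qed.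

Let inD n x : u n <= x <= v n -> D x.
Proof. by move=> h; exists n. Qed.

Variables F f : R -> R.
Hypothesis dF : forall x : R, D x -> is_derive x (1 : R) F (f x).
Hypothesis cf : forall x : R, D x -> {for x, continuous f}.

Let integral_I n : (\int[mu]_(x in I n) (f x)%:E = (F (v n) - F (u n))%:E)%E.
Proof.
have cF x : D x -> {for x, continuous F}.
  by move=> Dx; apply/differentiable_continuous/derivable1_diffP; apply: ex_derive; exact: dF.
rewrite (@continuous_FTC2 _ f F) ?EFinB//.
- apply: continuous_in_subspaceT => x; rewrite inE /= in_itv /= => /inD; exact: cf.
- split.
  + move=> x /subset_itv_oo_cc; rewrite in_itv /= => /inD Dx; apply: ex_derive; exact: dF.
  + by apply: cvg_at_right_filter; apply: cF; apply: (@inD n); rewrite lexx ltW.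
  + by apply: cvg_at_left_filter; apply: cF; apply: (@inD n); rewrite lexx andbT ltW.
- move=> x /subset_itv_oo_cc; rewrite in_itv /= => /inD Dx; rewrite derive1E.
  exact: (@derive_val _ _ _ _ _ _ _ (dF Dx)).
Qed.

Let mf n : measurable_fun (I n) f.
Proof.
have wf : {within `[u n, v n], continuous f}.
  by apply: continuous_in_subspaceT => x; rewrite inE /= in_itv /= => /inD; exact: cf.
by apply: subspace_continuous_measurable_fun => //; exact: measurable_itv.
Qed.

(** By monotone convergence: the integral over each compact interval is F (v n) - F (u n), at most 2
    B. Integrability of a concrete function thus reduces to a bounded primitive. *)
Lemma ge0_FTC_bigcup_integrable (B : R) :
  (forall x, D x -> 0 <= f x) -> (forall x, D x -> `|F x| <= B) ->
  mu.-integrable D (EFin \o f).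
Proof.
move=> f0 FB.
have mD : measurable_fun D f by apply/measurable_fun_bigcup.
apply/integrableP; split; first exact/measurable_EFinP.
apply: (@le_lt_trans _ _ (\int[mu]_(x in D) (f x)%:E)%E).
  rewrite le_eqVlt; apply/orP; left; apply/eqP/eq_integral => x; rewrite inE => Dx.
  by rewrite /= ger0_norm// f0.
apply: (@le_lt_trans _ _ (2 * B)%:E); last exact: ltry.
have cv : (\int[mu]_(x in I n) (f x)%:E @[n --> \oo] --> \int[mu]_(x in D) (f x)%:E)%E.
  apply: ge0_nondecreasing_set_cvg_integral => //.
  - by move=> n; exact/measurable_EFinP.
  - by move=> n x Inx; rewrite lee_fin f0//; exists n.
rewrite -(cvg_lim _ cv)//; apply: lime_le; first by apply/cvg_ex; eexists; exact: cv.
apply: nearW => n; rewrite integral_I lee_fin.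
have Du : D (u n) by apply: (@inD n); rewrite lexx ltW.
have Dv : D (v n) by apply: (@inD n); rewrite lexx andbT ltW.
by have := FB _ Du; have := FB _ Dv; rewrite !ler_norml => /andP[h1 h2] /andP[h3 h4]; lra.
Qed.

(** The form of integration by parts behind the functional equation of Gamma: the integral of a
    derivative vanishes when both boundary terms do. *)
Lemma FTC_bigcup_eq0 : mu.-integrable D (EFin \o f) ->
  F (v n) @[n --> \oo] --> (0 : R) -> F (u n) @[n --> \oo] --> (0 : R) ->
  \int[mu]_(x in D) f x = 0.
Proof.
move=> ifn F1 F2; have cv := nondecreasing_set_cvg_Rintegral nd_I mI ifn.
have cv0 : \int[mu]_(x in I n) f x @[n --> \oo] --> (0 : R).
  rewrite (_ : (fun n => _) = fun n => F (v n) - F (u n)); last first.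
    by apply/funext => n; rewrite /Rintegral integral_I.
  by rewrite -[X in _ --> X](subrr 0); exact: cvgB.
exact: cvg_unique cv cv0.
Qed.

End improper_integral.

Section improper_integral_instances.
Context {R : realType}.
Local Notation mu := (@lebesgue_measure R).
Implicit Types (F f : R -> R).

(** Exponential endpoints make ln explicit in the boundary terms; the shift by 1 keeps the interval
    nondegenerate at n = 0. *)
Let u n : R := expR (- n%:R - 1).
Let v n : R := expR (n%:R + 1).

Let uv n : u n < v n.
Proof. by rewrite ltr_expR; have := ler0n R n; lra. Qed.

Let u_noninc m n : (m <= n)%N -> u n <= u m.
Proof. by move=> mn; rewrite ler_expR; move: mn; rewrite -(ler_nat R); lra. Qed.

Let v_nondec m n : (m <= n)%N -> v m <= v n.
Proof. by move=> mn; rewrite ler_expR; move: mn; rewrite -(ler_nat R); lra. Qed.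

Let bigcup_uv : \bigcup_n (`[u n, v n]%classic : set (measurableTypeR R)) = `]0, +oo[%classic.
Proof.
apply/seteqP; split=> [x [n _]|x]; rewrite /= !in_itv/= ?andbT.
  by move=> /andP[+ _]; apply: lt_le_trans; exact: expR_gt0.
move=> x0; exists (Num.trunc `|ln x|) => //=; rewrite in_itv/=.
have := ltW (truncnS_gt `|ln x|); rewrite -natr1; move: (Num.trunc _) => n.
by rewrite ler_norml -[x in X in _ -> X]lnK ?posrE// !ler_expR opprD.
Qed.

Lemma ge0_FTC0y_integrable F f (B : R) :
  (forall x : R, 0 < x -> is_derive x (1 : R) F (f x)) ->
  (forall x : R, 0 < x -> {for x, continuous f}) ->
  (forall x, 0 < x -> 0 <= f x) -> (forall x, 0 < x -> `|F x| <= B) ->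
  mu.-integrable `]0, +oo[ (EFin \o f).
Proof.
move=> dF cf f0 FB.
have pos (x : R) : `]0, +oo[%classic x -> 0 < x by rewrite /= in_itv/= andbT.
rewrite -bigcup_uv; apply: (@ge0_FTC_bigcup_integrable _ u v uv u_noninc v_nondec F f _ _ B);
  rewrite bigcup_uv => x /pos; [exact: dF|exact: cf|exact: f0|exact: FB].
Qed.

Lemma FTC0y_eq0 F f : (forall x : R, 0 < x -> is_derive x (1 : R) F (f x)) ->
  (forall x : R, 0 < x -> {for x, continuous f}) ->
  mu.-integrable `]0, +oo[ (EFin \o f) ->
  F (expR n%:R) @[n --> \oo] --> (0 : R) -> F (expR (- n%:R)) @[n --> \oo] --> (0 : R) ->
  \int[mu]_(x in `]0, +oo[) f x = 0.
Proof.
move=> dF cf ifn F1 F2.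
have pos (x : R) : `]0, +oo[%classic x -> 0 < x by rewrite /= in_itv/= andbT.
rewrite -bigcup_uv; apply: (@FTC_bigcup_eq0 _ u v uv u_noninc v_nondec F f).
- by rewrite bigcup_uv => x /pos; exact: dF.
- by rewrite bigcup_uv => x /pos; exact: cf.
- by rewrite bigcup_uv.
- rewrite (_ : (fun n => _) = fun n => F (expR n.+1%:R)).
    by rewrite (cvg_shiftS (fun n => F (expR n%:R))).
  by apply/funext => n; rewrite -natr1.
- rewrite (_ : (fun n => _) = fun n => F (expR (- n.+1%:R))).
    by rewrite (cvg_shiftS (fun n => F (expR (- n%:R)))).
  by apply/funext => n; rewrite -natr1 opprD.
Qed.

Lemma integrable_oneDsqrV : mu.-integrable setT (EFin \o (fun x : R => (1 + x ^+ 2)^-1)).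
Proof.
have UT : \bigcup_n (`[- n%:R - 1, n%:R + 1]%classic : set (measurableTypeR R)) = setT.
  apply/seteqP; split=> // x _; exists (Num.trunc `|x|) => //=; rewrite in_itv/=.
  by have := ltW (truncnS_gt `|x|); rewrite -natr1 ler_norml opprD.
rewrite -UT; apply: (@ge0_FTC_bigcup_integrable _ (fun n => - n%:R - 1) (fun n => n%:R + 1) _ _ _ (@atan R) _ _ _ (pi / 2)); rewrite ?UT.
- by move=> n; have := ler0n R n; lra.
- by move=> m n; rewrite -(ler_nat R); lra.
- by move=> m n; rewrite -(ler_nat R); lra.
- move=> x _; apply: cvgV; first by rewrite gt_eqF// ltr_wpDr ?sqr_ge0.
  by apply: cvgD; [exact: cvg_cst|exact: exprn_continuous].
- by move=> x _; rewrite invr_ge0 addr_ge0 ?sqr_ge0.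
- by move=> x _; rewrite ler_norml !ltW// ?atan_gtNpi2 ?atan_ltpi2.
Qed.

End improper_integral_instances.

(** * The Gamma function *)

Section gamma.
Context {R : realType}.
Local Notation mu := (@lebesgue_measure R).
Local Notation pos := (`]0%R, +oo[%classic : set (measurableTypeR R)).
Implicit Types (p q x y : R) (s : R[i]).

(** The witness is the maximum of k ln (1 + y) - e y over y > -1, attained at 1 + y = k / e. The
    lemma serves to absorb polynomial factors into exponentials. *)
Lemma ln_le_affine k e : 0 < k -> 0 < e ->
  exists K, forall y, 0 <= y -> k * ln (1 + y) <= e * y + K.
Proof.
move=> k0 e0; exists (e - k + k * ln (k / e)) => y y0.
have ke : 0 < k / e by rewrite divr_gt0.
have y1 : 0 < 1 + y by lra.
have y2 : 0 < (1 + y) / (k / e) by rewrite divr_gt0.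
have -> : ln (1 + y) = ln ((1 + y) / (k / e)) + ln (k / e).
  by rewrite -lnM ?posrE// divfK// gt_eqF.
have h : ln ((1 + y) / (k / e)) <= (1 + y) / (k / e) - 1.
  by rewrite -[X in ln X](subrKC 1) le_ln1Dx//; lra.
have -> : e * y + (e - k + k * ln (k / e)) = k * ((1 + y) / (k / e) - 1 + ln (k / e)).
  by field; rewrite !gt_eqF.
by rewrite ler_wpM2l ?(ltW k0)// lerD2r.
Qed.

Lemma measurable_pos : measurable pos.
Proof. exact: measurable_itv. Qed.

Definition gamma_kernel p x := expR ((p - 1) * ln x - x).

Definition real_gamma p := \int[mu]_(x in pos) gamma_kernel p x.

Definition cgamma_kernel s x : R[i] := cexp ((s - 1) * (ln x)%:C - x%:C).

Lemma Re_cgamma_kernel s x : complex.Re (cgamma_kernel s x) =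
  gamma_kernel (complex.Re s) x * cos (complex.Im s * ln x).
Proof. by rewrite /cgamma_kernel /cexp /= !reimE /= !(mulr0, subr0, addr0, add0r, oppr0). Qed.

Lemma Im_cgamma_kernel s x : complex.Im (cgamma_kernel s x) =
  gamma_kernel (complex.Re s) x * sin (complex.Im s * ln x).
Proof. by rewrite /cgamma_kernel /cexp /= !reimE /= !(mulr0, subr0, addr0, add0r, oppr0). Qed.

Lemma normc_cgamma_kernel s x : normc (cgamma_kernel s x) = gamma_kernel (complex.Re s) x.
Proof. by rewrite normc_cexp !reimE /= !(mulr0, subr0). Qed.

Lemma cGammaE s : cGamma s = cintegral mu pos (cgamma_kernel s).
Proof.
apply: eq_cintegral => x _; rewrite /cgamma_kernel /cpow cexpD; congr (_ * _).
by rewrite -rmorphN cexp_real.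
Qed.

Lemma gamma_kernel_gt0 p x : 0 < gamma_kernel p x. Proof. exact: expR_gt0. Qed.

Lemma gamma_kernelS p x : 0 < x -> gamma_kernel (p + 1) x = x * gamma_kernel p x.
Proof.
move=> x0; rewrite /gamma_kernel.
have -> : (p + 1 - 1) * ln x - x = ln x + ((p - 1) * ln x - x) by ring.
by rewrite expRD lnK.
Qed.

Lemma measurable_gamma_kernel p : measurable_fun pos (gamma_kernel p).
Proof.
apply: (measurableT_comp (@measurable_expR R)); apply: measurable_funB => //.
by apply: measurable_funM => //; apply: measurable_funTS; exact: measurable_ln.
Qed.

Lemma cmeasurable_cgamma_kernel s : cmeasurable pos (cgamma_kernel s).
Proof.
apply: cmeasurable_cexp; apply: cmeasurableD.
  apply: cmeasurableM; first exact: cmeasurable_cst.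
  by apply: cmeasurable_real; apply: measurable_funTS; exact: measurable_ln.
rewrite (_ : (fun _ => _) = fun x => (- x)%:C); last by apply/funext => x; rewrite rmorphN.
by apply: cmeasurable_real.
Qed.

Lemma continuous_expR_comp (h : R -> R) x :
  {for x, continuous h} -> {for x, continuous (fun y => expR (h y))}.
Proof. by move=> ch; apply: continuous_comp => //; exact: continuous_expR. Qed.

Lemma continuous_lin_ln (a b x : R) : 0 < x -> {for x, continuous (fun y => a * ln y - b * y)}.
Proof.
move=> x0; apply: cvgB; apply: cvgM; try exact: cvg_cst; last exact: cvg_id.
exact: continuous_ln.
Qed.

Lemma continuous_gamma_kernel p x : 0 < x -> {for x, continuous (gamma_kernel p)}.
Proof.
move=> x0; apply: continuous_expR_comp.
have := @continuous_lin_ln (p - 1) 1 x x0.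
by under [X in {for _, continuous X}]eq_fun do rewrite mul1r.
Qed.

(** The comparison function is the derivative p y^(p - 1) (1 + y)^(- p - 1) of the bounded function
    (y / (1 + y))^p. It has the right singularity at 0, and [ln_le_affine] gives e^(- y) <= e^K (1 +
    y)^(- p - 1). *)
Lemma integrable_gamma_kernel p : 0 < p -> mu.-integrable pos (EFin \o gamma_kernel p).
Proof.
move=> p0.
pose F y := expR (p * (ln y - ln (1 + y))).
pose f y := (p * (y^-1 - (1 + y)^-1)) * F y.
have dF x : 0 < x -> is_derive x (1 : R) F (f x).
  move=> x0; have x1 : 0 < 1 + x by lra.
  have d1 := is_derive1_ln x0.
  have d2 : is_derive x (1 : R) (fun y => ln (1 + y)) (1 + x)^-1.
    have d3 : is_derive x (1:R) (fun y => 1 + y) 1.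
      by rewrite -[X in is_derive _ _ _ X]add0r; exact: is_deriveD.
    have := @is_derive1_comp _ (@ln R) (fun y => 1 + y) x _ _ (is_derive1_ln x1) d3.
    by rewrite mulr1.
  have d3 : is_derive x (1:R) (fun y => p * (ln y - ln (1 + y))) (p * (x^-1 - (1 + x)^-1)).
    exact: is_deriveZ.
  have := @is_derive1_comp _ (@expR R) (fun y => p * (ln y - ln (1 + y))) x _ _ (is_derive_expR _) d3.
  by rewrite /f mulrC.
have cf x : 0 < x -> {for x, continuous f}.
  move=> x0; apply: cvgM.
    apply: cvgM; first exact: cvg_cst.
    have x1 : 0 < 1 + x by lra.
    apply: cvgB; first by apply: (cvgV (lt0r_neq0 x0)); exact: cvg_id.
    by apply: (cvgV (lt0r_neq0 x1)); apply: cvgD; [exact: cvg_cst|exact: cvg_id].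
  by apply/differentiable_continuous/derivable1_diffP; apply: ex_derive; exact: dF.
have f0 x : 0 < x -> 0 <= f x.
  move=> x0; rewrite /f mulr_ge0 ?expR_ge0// mulr_ge0 ?(ltW p0)// subr_ge0 lef_pV2 ?posrE; lra.
have iF : mu.-integrable pos (EFin \o f).
  apply: (@ge0_FTC0y_integrable _ F f 1) => // x x0.
  rewrite ger0_norm ?expR_ge0// -expR0 ler_expR mulr_ge0_le0 ?(ltW p0)//.
  by rewrite subr_le0 ler_ln ?posrE; lra.
have [K hK] := @ln_le_affine (p + 1) 1 (ltac:(lra)) ltr01.
have mpos := measurable_pos.
have iF2 := integrable_mulrl (expR K / p) mpos iF.
refine (le_integrable mpos _ _ iF2).
  by apply/measurable_EFinP; exact: measurable_gamma_kernel.
move=> x; rewrite /= in_itv/= andbT => x0; rewrite lee_fin.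
have x1 : 0 < 1 + x by lra.
rewrite ger0_norm ?expR_ge0// ger0_norm; last by rewrite mulr_ge0 ?f0// divr_ge0 ?expR_ge0// ltW.
have -> : expR K / p * f x = expR K * (x^-1 * (1 + x)^-1) * F x.
  by rewrite /f; field; rewrite !gt_eqF.
have -> : x^-1 = expR (- ln x) by rewrite expRN lnK.
have -> : (1 + x)^-1 = expR (- ln (1 + x)) by rewrite expRN lnK.
rewrite /F /gamma_kernel -!expRD ler_expR.
by have := hK x (ltW x0); lra.
Qed.

Lemma cintegrable_cgamma_kernel s : 0 < complex.Re s -> cintegrable mu pos (cgamma_kernel s).
Proof.
move=> s0; apply: (cintegrable_le measurable_pos (cmeasurable_cgamma_kernel s) (integrable_gamma_kernel s0)).
by move=> x _; rewrite normc_cgamma_kernel.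
Qed.

Lemma cGamma_real p : cGamma p%:C = (real_gamma p)%:C.
Proof.
rewrite cGammaE; apply: eq_reim.
  rewrite Re_cintegral; apply: eq_Rintegral => x _.
  by rewrite Re_cgamma_kernel/= mul0r cos0 mulr1.
rewrite Im_cintegral; under eq_Rintegral do rewrite Im_cgamma_kernel/= mul0r sin0 mulr0.
by rewrite /Rintegral integral0.
Qed.

Lemma normc_cGamma_le s : 0 < complex.Re s -> normc (cGamma s) <= 2 * real_gamma (complex.Re s).
Proof.
move=> s0; rewrite cGammaE; apply: normc_cintegral_le => //.
- exact: cmeasurable_cgamma_kernel.
- exact: integrable_gamma_kernel.
- by move=> x _; rewrite normc_cgamma_kernel.
Qed.

(** On [1, 2] both |ln x| <= 1 and x <= 2 hold, so the integrand stays above the constant on an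
    interval of length 1. The bound is uniform for bounded p. *)
Lemma real_gamma_ge p : 0 < p -> expR (- (`|p - 1| + 2)) <= real_gamma p.
Proof.
move=> p0.
have s12 : `[1, 2]%classic `<=` pos.
  by move=> x /=; rewrite !in_itv/= andbT => /andP[]; lra.
have ip := integrable_gamma_kernel p0.
have m12 : measurable (`[1, 2]%classic : set (measurableTypeR R)) by exact: measurable_itv.
have ip12 := integrableS measurable_pos m12 s12 ip.
apply: (@le_trans _ _ (\int[mu]_(x in `[1, 2]) gamma_kernel p x)).
  have -> : expR (- (`|p - 1| + 2)) = \int[mu]_(x in `[1, 2]) cst (expR (- (`|p - 1| + 2))) x.
    rewrite Rintegral_cst// [X in fine X]lebesgue_measure_itv/= lte_fin ltr1n/=; ring.
  apply: le_Rintegral => //.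
    (* The constant is integrable on [1, 2] because a multiple of the kernel dominates it there. *)
    apply: (le_integrable m12 _ _ (integrable_mulrl (expR (`|p - 1| * ln 2 + `|p - 1| + 2) ) m12 ip12)).
      by apply: measurableT_comp.
    move=> x /=; rewrite in_itv/= => /andP[x1 x2]; rewrite lee_fin.
    rewrite [leLHS]ger0_norm ?expR_ge0// [leRHS]ger0_norm ?mulr_ge0 ?expR_ge0//.
    rewrite /gamma_kernel -expRD ler_expR.
    have : `|(p - 1) * ln x| <= `|p - 1| * ln 2.
      by rewrite normrM ler_wpM2l// ger0_norm ?ln_ge0// ler_ln ?posrE//; lra.
    rewrite ler_norml => /andP[h1 h2]; have := normr_ge0 (p - 1); lra.
  move=> x /=; rewrite in_itv/= => /andP[x1 x2]; rewrite ler_expR.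
  have : `|(p - 1) * ln x| <= `|p - 1|.
    rewrite normrM ler_piMr// ger0_norm ?ln_ge0// (@le_trans _ _ (x - 1))//; last lra.
    by rewrite -[X in ln X](subrKC 1) le_ln1Dx//; lra.
  rewrite ler_norml => /andP[h1 h2]; lra.
rewrite /Rintegral fine_le ?integrable_fin_num//.
apply: ge0_subset_integral => //.
  by case/integrableP: ip.
by move=> x _; rewrite lee_fin ltW// gamma_kernel_gt0.
Qed.

Lemma real_gamma_gt0 p : 0 < p -> 0 < real_gamma p.
Proof. by move=> p0; apply: lt_le_trans (real_gamma_ge p0); exact: expR_gt0. Qed.

Lemma cvg0_le (u v : nat -> R) : (forall n, `|u n| <= v n) ->
  v n @[n --> \oo] --> (0 : R) -> u n @[n --> \oo] --> (0 : R).
Proof.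
move=> uv v0; apply/norm_cvg0P; apply: (@squeeze_cvgr _ _ _ _ (cst 0) v) => //.
  by apply: nearW => n; rewrite normr_ge0 uv.
exact: cvg_cst.
Qed.

Lemma cvg_expRN (k a : R) : 0 < a -> k * expR (- (a * n%:R)) @[n --> \oo] --> (0 : R).
Proof.
move=> a0; rewrite -[X in _ --> X](mulr0 k); apply: cvgM; first exact: cvg_cst.
under eq_cvg do rewrite -mulNr mulrC expRM_natl.
by apply: cvg_expr; rewrite ger0_norm ?expR_ge0// -expR0 ltr_expR oppr_lt0.
Qed.

(** The integrand of s Gamma (s) - Gamma (s + 1) is the derivative of x^s e^(- x), which tends to 0
    at 0 and at infinity. Real and imaginary parts are handled in parallel, with [cos] and [sin] of
    ta * ln x as bounded factors. *)
Lemma cGammaS s : 0 < complex.Re s -> cGamma (s + 1) = s * cGamma s.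
Proof.
move=> s0; set sg := complex.Re s; set ta := complex.Im s.
have s1 : 0 < complex.Re (s + 1) by rewrite ReD /=; lra.
have i0 := cintegrable_cgamma_kernel s0; have i1 := cintegrable_cgamma_kernel s1.
have mpos := measurable_pos.
apply/esym/eqP; rewrite -subr_eq0; apply/eqP.
rewrite !cGammaE -cintegralZ// -cintegralB//; last exact: cintegrableZ.
have [ir ii] := cintegrableB mpos (cintegrableZ s mpos i0) i1.
have shift x : 0 < x -> gamma_kernel (sg + 1) x = x * gamma_kernel sg x by exact: gamma_kernelS.
have dg x : 0 < x -> is_derive x (1 : R) (gamma_kernel (sg + 1)) (sg * gamma_kernel sg x - gamma_kernel (sg + 1) x).
  move=> x0; have d1 := is_derive1_ln x0.
  have d2 : is_derive x (1:R) (fun y => (sg + 1 - 1) * ln y - y) ((sg + 1 - 1) * x^-1 - 1).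
    apply: is_deriveB; exact: is_deriveZ.
  have d3 := @is_derive1_comp _ (@expR R) (fun y => (sg + 1 - 1) * ln y - y) x _ _ (is_derive_expR _) d2.
  apply: (is_derive_eq d3); rewrite -/(gamma_kernel (sg + 1) x) shift//.
  by field; rewrite gt_eqF.
have dc (h h' : R -> R) x : 0 < x -> (forall y : R, is_derive y (1 : R) h (h' y)) ->
    is_derive x (1:R) (fun y => h (ta * ln y)) ((ta * x^-1) * h' (ta * ln x)).
  move=> x0 dh; have d1 := is_derive1_ln x0.
  have d2 : is_derive x (1:R) (fun y => ta * ln y) (ta * x^-1) by exact: is_deriveZ.
  by have := @is_derive1_comp _ h (fun y => ta * ln y) x _ _ (dh _) d2; rewrite mulrC.
have cc (h : R -> R) x : 0 < x -> continuous h -> {for x, continuous (fun y => h (ta * ln y))}.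
  move=> x0 ch; apply: continuous_comp; last exact: ch.
  by apply: cvgM; [exact: cvg_cst|exact: continuous_ln].
(* At x = e^n the inequality (sg + 1) n <= x + K bounds x^sg e^(- x) by e^K e^(- n). *)
have bd1 (h : R -> R) : (forall y, `|h y| <= 1) ->
    gamma_kernel (sg + 1) (expR n%:R) * h (ta * ln (expR n%:R)) @[n --> \oo] --> (0 : R).
  move=> h1; have sg1 : 0 < sg + 1 by move: s0; rewrite -/sg; lra.
  have [K hK] := @ln_le_affine (sg + 1) 1 sg1 ltr01.
  apply: (cvg0_le _ (cvg_expRN (expR K) ltr01)) => n.
  rewrite normrM -[leRHS]mulr1 ler_pM// ger0_norm ?expR_ge0// /gamma_kernel -expRD ler_expR expRK.
  have := hK (expR n%:R) (expR_ge0 _); rewrite !mul1r => h2.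
  have : n%:R <= ln (1 + expR n%:R) :> R.
    have e0 := expR_gt0 (n%:R : R); have e1 : 0 < 1 + expR n%:R :> R by lra.
    by rewrite -[leLHS]expRK ler_ln ?posrE//; lra.
  by rewrite -(ler_pM2l sg1) => h3; move: (le_trans h3 h2); lra.
(* At x = e^(- n) the modulus is at most e^(- sg n), and sg > 0. *)
have bd2 (h : R -> R) : (forall y, `|h y| <= 1) ->
    gamma_kernel (sg + 1) (expR (- n%:R)) * h (ta * ln (expR (- n%:R))) @[n --> \oo] --> (0 : R).
  move=> h1.
  apply: (cvg0_le _ (cvg_expRN 1 s0)) => n.
  rewrite normrM mulrC ler_pM// ger0_norm ?expR_ge0// /gamma_kernel ler_expR expRK.
  by have := expR_gt0 (- n%:R : R); rewrite -/sg; lra.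
have cos1 y : `|cos y| <= 1 :> R by rewrite ler_norml cos_geN1 cos_le1.
have sin1 y : `|sin y| <= 1 :> R by rewrite ler_norml sin_geN1 sin_le1.
apply: eq_reim; rewrite ?Re_cintegral ?Im_cintegral.
- rewrite -[RHS]/(0 : R).
  apply: (@FTC0y_eq0 _ (fun x => gamma_kernel (sg + 1) x * cos (ta * ln x)) (fun x => complex.Re (s * cgamma_kernel s x - cgamma_kernel (s + 1) x))); last 3 first.
  + exact: ir.
  + exact: bd1.
  + exact: bd2.
  + move=> x x0; rewrite !reimE !Re_cgamma_kernel !Im_cgamma_kernel !reimE /= addr0 -/sg -/ta.
    have d := is_deriveM (dg x x0) (dc _ _ x x0 (@is_derive_cos R)).
    apply: (is_derive_eq d).
    by rewrite /GRing.scale /= shift//; field; rewrite gt_eqF.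
  + move=> x x0.
    have e y : complex.Re (s * cgamma_kernel s y - cgamma_kernel (s + 1) y) =
      sg * (gamma_kernel sg y * cos (ta * ln y)) - ta * (gamma_kernel sg y * sin (ta * ln y)) - gamma_kernel (sg + 1) y * cos (ta * ln y).
      by rewrite !reimE !Re_cgamma_kernel !Im_cgamma_kernel !reimE /= addr0 -/sg -/ta.
    rewrite (funext e).
    apply: cvgB; first apply: cvgB.
    * apply: cvgM; [exact: cvg_cst|apply: cvgM; [exact: continuous_gamma_kernel|apply: cc => //; exact: continuous_cos]].
    * apply: cvgM; [exact: cvg_cst|apply: cvgM; [exact: continuous_gamma_kernel|apply: cc => //; exact: continuous_sin]].
    * apply: cvgM; [exact: continuous_gamma_kernel|apply: cc => //; exact: continuous_cos].
- rewrite -[RHS]/(0 : R).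
  apply: (@FTC0y_eq0 _ (fun x => gamma_kernel (sg + 1) x * sin (ta * ln x)) (fun x => complex.Im (s * cgamma_kernel s x - cgamma_kernel (s + 1) x))); last 3 first.
  + exact: ii.
  + exact: bd1.
  + exact: bd2.
  + move=> x x0; rewrite !reimE !Re_cgamma_kernel !Im_cgamma_kernel !reimE /= addr0 -/sg -/ta.
    have d := is_deriveM (dg x x0) (dc _ _ x x0 (@is_derive_sin R)).
    apply: (is_derive_eq d).
    by rewrite /GRing.scale /= shift//; field; rewrite gt_eqF.
  + move=> x x0.
    have e y : complex.Im (s * cgamma_kernel s y - cgamma_kernel (s + 1) y) =
      sg * (gamma_kernel sg y * sin (ta * ln y)) + ta * (gamma_kernel sg y * cos (ta * ln y)) - gamma_kernel (sg + 1) y * sin (ta * ln y).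
      by rewrite !reimE !Re_cgamma_kernel !Im_cgamma_kernel !reimE /= addr0 -/sg -/ta.
    rewrite (funext e).
    apply: cvgB; first apply: cvgD.
    * apply: cvgM; [exact: cvg_cst|apply: cvgM; [exact: continuous_gamma_kernel|apply: cc => //; exact: continuous_sin]].
    * apply: cvgM; [exact: cvg_cst|apply: cvgM; [exact: continuous_gamma_kernel|apply: cc => //; exact: continuous_cos]].
    * apply: cvgM; [exact: continuous_gamma_kernel|apply: cc => //; exact: continuous_sin].
Qed.

Lemma real_gammaS p : 0 < p -> real_gamma (p + 1) = p * real_gamma p.
Proof.
move=> p0; have := @cGammaS p%:C p0.
rewrite -(rmorphD (real_complex R) p 1) !cGamma_real -rmorphM.
by move=> /(congr1 (@complex.Re R)).
Qed.

End gamma.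

(** * Holomorphy of Gamma on vertical strips *)

Section gamma_holomorphic.
Context {R : realType}.
Local Notation mu := (@lebesgue_measure R).
Local Notation pos := (`]0%R, +oo[%classic : set (measurableTypeR R)).
Implicit Types (p q x y : R) (s : R[i]).

(** The factor e^(d |ln x|) is x^d for x >= 1 and x^(- d) for x <= 1, so the two extreme exponents
    dominate uniformly for a in [p, q]. It pays for the powers of ln x that differentiation in s
    produces. *)
Lemma gamma_kernel_expR_le p q d a x : p <= a <= q -> 0 <= d ->
  gamma_kernel a x * expR (d * `|ln x|) <= gamma_kernel (p - d) x + gamma_kernel (q + d) x.
Proof.
move=> /andP[pa aq] d0; rewrite /gamma_kernel -expRD.
have [x0|x0] := leP 0 (ln x).
- rewrite ger0_norm// (@le_trans _ _ (expR ((q + d - 1) * ln x - x)))//; last first.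
    by rewrite lerDr expR_ge0.
  by rewrite ler_expR; nra.
- rewrite ltr0_norm// (@le_trans _ _ (expR ((p - d - 1) * ln x - x)))//; last first.
    by rewrite lerDl expR_ge0.
  by rewrite ler_expR; nra.
Qed.

Lemma real_gamma_le p q a : 0 < p -> p <= a <= q -> real_gamma a <= real_gamma p + real_gamma q.
Proof.
move=> p0 /andP[pa aq]; rewrite /real_gamma.
have ia : mu.-integrable pos (EFin \o gamma_kernel a) by apply: integrable_gamma_kernel; lra.
have ip : mu.-integrable pos (EFin \o gamma_kernel p) by apply: integrable_gamma_kernel; lra.
have iq : mu.-integrable pos (EFin \o gamma_kernel q) by apply: integrable_gamma_kernel; lra.
rewrite -RintegralD//; apply: le_Rintegral => //.
  exact: (integrableD measurable_pos ip iq).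
move=> x _; have := @gamma_kernel_expR_le p q 0 a x; rewrite mul0r expR0 mulr1 subr0 addr0.
by apply=> //; rewrite pa.
Qed.

Lemma hol_cGamma p q : 0 < p -> hol (@cGamma R) [set s | p <= complex.Re s <= q].
Proof.
move=> p0.
have [qp|pq] := ltP q p.
  exists (fun=> 0), 0, 1; split; rewrite ?lexx ?ltr01// => s /= /andP[h1 h2]; exfalso; lra.
(* The margin used is 2 d: one d covers the increment h, the other absorbs powers of ln x. With d <=
   p / 4 the exponent p - 2 d stays positive. *)
pose d := Num.min (p / 4) 1.
have d0 : 0 < d by rewrite lt_min ltr01 andbT divr_gt0.
have d1 : d <= 1 by rewrite ge_min lexx orbT.
have dp : d <= p / 4 by rewrite ge_min lexx.
apply: (hol_ext (F := fun s => cintegral mu pos (cgamma_kernel s))).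
  by move=> s _; rewrite cGammaE.
(* The three terms bound the kernel, its derivative in s and the quadratic remainder; 24 is the 6 of
   [cexp_sub1x_le] times the 4 of [e3]. *)
pose K := 1 + d^-1 + 24 * d^-1 ^+ 2.
pose W x := gamma_kernel (p - 2 * d) x + gamma_kernel (q + 2 * d) x.
have iW : mu.-integrable pos (EFin \o W).
  have ip : mu.-integrable pos (EFin \o gamma_kernel (p - 2 * d)) by apply: integrable_gamma_kernel; lra.
  have iq : mu.-integrable pos (EFin \o gamma_kernel (q + 2 * d)) by apply: integrable_gamma_kernel; lra.
  exact: (integrableD measurable_pos ip iq).
have di : 0 < d^-1 by rewrite invr_gt0.
have di2 : 0 <= d^-1 ^+ 2 by exact: sqr_ge0.
apply: (@hol_cintegral _ _ _ mu pos (fun x s => cgamma_kernel s x)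
   (fun x s => (ln x)%:C * cgamma_kernel s x) (fun x => K * W x) d).
- exact: measurable_pos.
- by rewrite d0.
- exact: integrable_mulrl measurable_pos iW.
- by move=> s _; exact: cmeasurable_cgamma_kernel.
- move=> s _; apply: cmeasurableM; last exact: cmeasurable_cgamma_kernel.
  by apply: cmeasurable_real; apply: measurable_funTS; exact: measurable_ln.
move=> x s _ Ks; cbv beta; set y := ln x.
have := @gamma_kernel_expR_le p q (2 * d) (complex.Re s) x Ks (ltac:(lra)).
rewrite -/(W x) -/y => hW.
have g0 := gamma_kernel_gt0 (complex.Re s) x.
have W0 : 0 <= W x by rewrite addr_ge0// ltW// gamma_kernel_gt0.
set t := d * `|y|; have t0 : 0 <= t by rewrite mulr_ge0// ltW.
have e1 : 1 <= expR (2 * d * `|y|) by rewrite -expR0 ler_expR !mulr_ge0// ltW.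
have e2 : `|y| <= d^-1 * expR (2 * d * `|y|).
  rewrite mulrC ler_pdivlMr// mulrC -/t.
  have -> : 2 * d * `|y| = 2 * t by rewrite /t mulrA.
  have := expR_ge1Dx (2 * t); lra.
have e3 : y ^+ 2 * expR t <= 4 * d^-1 ^+ 2 * expR (2 * d * `|y|).
  have -> : 2 * d * `|y| = t + t by rewrite /t; ring.
  rewrite expRD mulrA ler_wpM2r ?expR_ge0//.
  have h : t / 2 <= expR (t / 2) by have := expR_ge1Dx (t / 2); lra.
  have hh : t ^+ 2 <= 4 * expR t.
    have -> : expR t = expR (t / 2) ^+ 2 by rewrite -expRM_natl; congr expR; field.
    have : (t / 2) ^+ 2 <= expR (t / 2) ^+ 2 by rewrite lerXn2r ?nnegrE ?expR_ge0// divr_ge0.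
    by rewrite expr_div_n; lra.
  have -> : y ^+ 2 = d^-1 ^+ 2 * t ^+ 2.
    by rewrite -[y ^+ 2]ger0_norm ?sqr_ge0// normrX /t exprMn mulrA -exprMn mulVf ?gt_eqF// expr1n mul1r.
  have -> : 4 * d^-1 ^+ 2 * expR t = d^-1 ^+ 2 * (4 * expR t) by ring.
  by rewrite ler_wpM2l.
have b1 : gamma_kernel (complex.Re s) x <= W x by apply: le_trans hW; rewrite ler_peMr// ltW.
have dW : 0 <= d^-1 * W x by rewrite mulr_ge0// ltW.
have ddW : 0 <= d^-1 ^+ 2 * W x by rewrite mulr_ge0.
have KW : K * W x = W x + d^-1 * W x + 24 * (d^-1 ^+ 2 * W x) by rewrite /K; ring.
split.
- by rewrite normc_cgamma_kernel KW; lra.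
- rewrite normcM normc_real normc_cgamma_kernel -/y.
  have : `|y| * gamma_kernel (complex.Re s) x <= d^-1 * W x.
    apply: (@le_trans _ _ (d^-1 * expR (2 * d * `|y|) * gamma_kernel (complex.Re s) x)).
      by rewrite ler_wpM2r// ltW.
    by rewrite -mulrA ler_wpM2l ?(ltW di)// mulrC.
  by rewrite KW; lra.
move=> h hd Ksh.
have -> : cgamma_kernel (s + h) x = cgamma_kernel s x * cexp (h * y%:C).
  by rewrite /cgamma_kernel -cexpD -/y; congr cexp; ring.
have -> : cgamma_kernel s x * cexp (h * y%:C) - cgamma_kernel s x - h * (y%:C * cgamma_kernel s x)
  = cgamma_kernel s x * (cexp (h * y%:C) - 1 - h * y%:C) by ring.
rewrite normcM normc_cgamma_kernel.
have r1 : normc (cexp (h * y%:C) - 1 - h * y%:C) <= normc h ^+ 2 * (6 * (y ^+ 2 * expR t)).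
  apply: le_trans (cexp_sub1x_le _) _.
  rewrite normcM normc_real exprMn real_normK ?num_real//.
  have -> : normc h ^+ 2 * (6 * (y ^+ 2 * expR t)) = 6 * (normc h ^+ 2 * y ^+ 2) * expR t by ring.
  apply: ler_wpM2l; first by rewrite mulr_ge0// mulr_ge0 ?sqr_ge0// exprn_ge0 ?normc_ge0.
  rewrite ler_expR ReM /= mulr0 subr0 normrM ler_wpM2r//.
  exact: le_trans (normRe_le _) hd.
rewrite mulrC [leRHS]mulrC.
apply: (@le_trans _ _ (normc h ^+ 2 * (6 * (4 * d^-1 ^+ 2 * expR (2 * d * `|y|))) * gamma_kernel (complex.Re s) x)).
  rewrite ler_wpM2r ?(ltW g0)//; apply: (le_trans r1).
  by rewrite ler_wpM2l ?sqr_ge0//; lra.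
rewrite -mulrA ler_wpM2l ?sqr_ge0// KW.
have : d^-1 ^+ 2 * (expR (2 * d * `|y|) * gamma_kernel (complex.Re s) x) <= d^-1 ^+ 2 * W x.
  by rewrite ler_wpM2l// mulrC.
by lra.
Qed.

End gamma_holomorphic.

(** * Exponential bounds for Gamma and its reciprocal on vertical lines *)

Section gamma_asymptotics.
Context {R : realType}.
Local Notation mu := (@lebesgue_measure R).
Local Notation pos := (`]0%R, +oo[%classic : set (measurableTypeR R)).
Implicit Types (a p q x y t ta M : R) (s : R[i]).

(** For y = ln (x / M) the right side is 4 (x / M - 2 + M / x), whose integral against the Gamma
    kernel is explicit by the functional equation. *)
Lemma sqr_le_expRD y : y ^+ 2 <= 4 * (expR y - 2 + expR (- y)).
Proof.
wlog y0 : y / 0 <= y.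
  move=> H; have [/H//|y0] := leP 0 y.
  by have := H (- y); rewrite oppr_ge0 (ltW y0) opprK sqrrN => /(_ isT); lra.
set v := y / 2; have v0 : 0 <= v by rewrite divr_ge0.
have e1 : 1 + v <= expR v by exact: expR_ge1Dx.
have e2 : expR (- v) <= 1.
  by rewrite -expR0 ler_expR oppr_le0.
have -> : expR y - 2 + expR (- y) = (expR v - expR (- v)) ^+ 2.
  have -> : expR y = expR v ^+ 2 by rewrite -expRM_natl /v; congr expR; field.
  have -> : expR (- y) = expR (- v) ^+ 2 by rewrite -expRM_natl /v; congr expR; field.
  have : expR v * expR (- v) = 1 by rewrite -expRD subrr expR0.
  by rewrite sqrrB => ->; ring.
have : v ^+ 2 <= (expR v - expR (- v)) ^+ 2 by rewrite lerXn2r ?nnegrE//; lra.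
by rewrite /v expr_div_n; lra.
Qed.

(* The density of Gamma(M) concentrates near x = M, where x^(i ta) is close to M^(i ta). *)
Lemma normc_cGamma_ge M ta : 1 < M ->
  real_gamma M * (1 - 4 * ta ^+ 2 / (M - 1)) <= normc (cGamma (M +i* ta)).
Proof.
move=> M1; have M0 : 0 < M by lra. have M10 : 0 < M - 1 by lra.
have i1 : mu.-integrable pos (EFin \o gamma_kernel M) by exact: integrable_gamma_kernel.
have i2 : mu.-integrable pos (EFin \o gamma_kernel (M + 1)) by apply: integrable_gamma_kernel; lra.
have i3 : mu.-integrable pos (EFin \o gamma_kernel (M - 1)) by exact: integrable_gamma_kernel.
(* This is M^(- i ta): the rotation makes the real part of the integrand the kernel times cos (ta ln
   (x / M)). *)
set w : R[i] := cexp (- ('i%C * (ta * ln M)%:C)).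
have wn : normc w = 1.
  by rewrite normc_cexp !reimE /= !(mulr0, mul0r, mul1r, subr0, oppr0) expR0.
have -> : normc (cGamma (M +i* ta)) = normc (w * cGamma (M +i* ta)) by rewrite normcM wn mul1r.
apply: le_trans (normRe_le _); apply: le_trans (ler_norm _).
have ic := @cintegrable_cgamma_kernel R (M +i* ta) M0.
rewrite cGammaE -cintegralZ ?Re_cintegral//.
have [iw _] := cintegrableZ w measurable_pos ic.
pose h x := gamma_kernel M x - 4 * ta ^+ 2 * (M^-1 * gamma_kernel (M + 1) x - 2 * gamma_kernel M x + M * gamma_kernel (M - 1) x).
have j2 := integrable_mulrl M^-1 measurable_pos i2.
have j1 := integrable_mulrl 2 measurable_pos i1.
have j3 := integrable_mulrl M measurable_pos i3.
have j21 : mu.-integrable pos (EFin \o (fun x => M^-1 * gamma_kernel (M + 1) x - 2 * gamma_kernel M x)).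
  exact: (integrableB measurable_pos j2 j1).
have j : mu.-integrable pos (EFin \o (fun x => M^-1 * gamma_kernel (M + 1) x - 2 * gamma_kernel M x + M * gamma_kernel (M - 1) x)).
  exact: (integrableD measurable_pos j21 j3).
have j4 := integrable_mulrl (4 * ta ^+ 2) measurable_pos j.
have ih : mu.-integrable pos (EFin \o h) by exact: (integrableB measurable_pos i1 j4).
have -> : real_gamma M * (1 - 4 * ta ^+ 2 / (M - 1)) = \int[mu]_(x in pos) h x.
  rewrite (RintegralB measurable_pos i1 j4) (RintegralZl _ measurable_pos j).
  rewrite (RintegralD measurable_pos j21 j3) (RintegralB measurable_pos j2 j1).
  rewrite !RintegralZl//.
  rewrite -!/(real_gamma _) real_gammaS//.
  have -> : real_gamma (M - 1) = real_gamma M / (M - 1).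
    by have := real_gammaS M10; rewrite subrK => ->; rewrite mulrC mulKf// gt_eqF.
  by field; rewrite !gt_eqF//; lra.
apply: le_Rintegral => //.
move=> x px; have x0 : 0 < x by move: px; rewrite /= in_itv/= andbT.
have gS := gamma_kernelS M x0.
have gP := gamma_kernelS (M - 1) x0; rewrite subrK in gP.
set y := ln x - ln M.
have -> : complex.Re (w * cgamma_kernel (M +i* ta) x) = gamma_kernel M x * cos (ta * y).
  have Re_cexp z : complex.Re (cexp z) = expR (complex.Re z) * cos (complex.Im z) :> R by [].
  rewrite /w /cgamma_kernel -cexpD Re_cexp !reimE /= !(mulr0, mul0r, mul1r, subr0, oppr0, addr0, add0r, mulr1).
  rewrite /gamma_kernel; congr (_ * _).
  by congr cos; rewrite /y; ring.
have xM : expR y = x / M by rewrite /y expRB !lnK.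
have Mx : expR (- y) = M / x by rewrite expRN xM invf_div.
have -> : h x = gamma_kernel M x * (1 - 4 * ta ^+ 2 * (expR y - 2 + expR (- y))).
  by rewrite /h gS gP xM Mx; field; rewrite !gt_eqF.
rewrite ler_wpM2l ?(ltW (gamma_kernel_gt0 _ _))//.
apply: le_trans (cos_ge_sqr _); rewrite lerB// exprMn.
have -> : 4 * ta ^+ 2 * (expR y - 2 + expR (- y)) = ta ^+ 2 * (4 * (expR y - 2 + expR (- y))) by ring.
by rewrite ler_wpM2l ?sqr_ge0// sqr_le_expRD.
Qed.

Lemma cGamma_addn s n : 0 < complex.Re s ->
  cGamma (s + n%:R) = (\prod_(i < n) (s + i%:R)) * cGamma s.
Proof.
move=> s0; elim: n => [|n IH]; first by rewrite big_ord0 addr0 mul1r.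
rewrite -[n.+1%:R]natr1 addrA cGammaS; last first.
  rewrite ReD (_ : complex.Re n%:R = n%:R) ?ltr_pwDl//.
  by rewrite -[n%:R](rmorph_nat (real_complex R)).
by rewrite IH big_ord_recr/=; ring.
Qed.

Lemma real_gamma_addn p n : 0 < p ->
  real_gamma (p + n%:R) = (\prod_(i < n) (p + i%:R)) * real_gamma p.
Proof.
move=> p0; elim: n => [|n IH]; first by rewrite big_ord0 addr0 mul1r.
rewrite -[n.+1%:R]natr1 addrA real_gammaS; last by rewrite ltr_pwDl.
by rewrite IH big_ord_recr/=; ring.
Qed.

(* The functional equation gives
     |Gamma (p + i ta)| / Gamma p =
       exp (- sum_(j < n) L ta (p + j) / 2) |Gamma (p + n + i ta)| / Gamma (p + n);
   [Phi ta] is a primitive of [L ta], and its arctangent produces the rate pi / 2. *)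
Let L ta x := ln (1 + (ta / x) ^+ 2).
Let Phi ta x := x * L ta x + 2 * ta * atan (x / ta).

Let L_ge0 ta x : 0 <= L ta x.
Proof. by rewrite ln_ge0// lerDl sqr_ge0. Qed.

Let L_le ta x y : 0 < x -> x <= y -> L ta y <= L ta x.
Proof.
move=> x0 xy; have y0 : 0 < y by exact: lt_le_trans xy.
rewrite /L ler_ln ?posrE ?ltr_wpDr ?sqr_ge0//.
rewrite lerD2l !expr_div_n ler_wpM2l ?sqr_ge0// lef_pV2 ?posrE ?exprn_gt0//.
by rewrite lerXn2r ?nnegrE// ltW.
Qed.

Let is_derive_Phi ta x : 0 < ta -> 0 < x -> is_derive x (1 : R) (Phi ta) (L ta x).
Proof.
move=> t0 x0.
have d0 : is_derive x (1:R) (fun y : R => y^-1) (- x ^- 2).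
  have := @is_deriveV R (fun y : R => y) x 1 1 (lt0r_neq0 x0) (is_derive_id _ _).
  by rewrite /GRing.scale /= mulr1.
have d1 : is_derive x (1:R) (fun y => ta / y) (ta * - x ^- 2) by exact: is_deriveZ.
have d2 : is_derive x (1:R) (fun y => 1 + (ta / y) ^+ 2) (2 * (ta / x) * (ta * - x ^- 2)).
  have d3 := is_deriveX 2 d1.
  have d4 := is_deriveD (is_derive_cst (1 : R) x (1 : R)) d3.
  apply: (is_derive_eq d4); rewrite /GRing.scale /= add0r expr1; ring.
have p1 : 0 < 1 + (ta / x) ^+ 2 by rewrite ltr_wpDr ?sqr_ge0.
have d3 := @is_derive1_comp _ (@ln R) (fun y => 1 + (ta / y) ^+ 2) x _ _ (is_derive1_ln p1) d2.
have d4 := is_deriveM (is_derive_id x (1 : R)) d3.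
have d5 : is_derive x (1:R) (fun y : R => y / ta) ta^-1.
  have := is_deriveZ ta^-1 (is_derive_id x (1:R)).
  rewrite /GRing.scale /= mulr1; congr is_derive.
  by apply/funext => y /=; rewrite mulrC.
have d6 := @is_derive1_comp _ (@atan R) (fun y => y / ta) x _ _ (is_derive1_atan _) d5.
have d7 := is_deriveZ (2 * ta) d6.
have d8 := is_deriveD d4 d7.
apply: (is_derive_eq d8).
rewrite /GRing.scale /= mulr1 -/(L ta x).
have n2 : ta ^+ 2 + x ^+ 2 != 0 by rewrite gt_eqF// ltr_wpDr ?sqr_ge0 ?exprn_gt0.
by field; rewrite n2 !gt_eqF.
Qed.

(** Mean value theorem for the primitive of a decreasing function; summed over unit steps it is the
    integral test for the sum in the exponent. *)
Let Phi_step ta x : 0 < ta -> 0 < x -> L ta (x + 1) <= Phi ta (x + 1) - Phi ta x <= L ta x.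
Proof.
move=> t0 x0.
have [||y] := @MVT R (Phi ta) (L ta) x (x + 1) (ltac:(lra)).
- by move=> y; rewrite in_itv/= => /andP[xy _]; apply: is_derive_Phi => //; lra.
- apply: derivable_within_continuous => y; rewrite in_itv/= => /andP[xy _].
  by apply: ex_derive; apply: is_derive_Phi => //; lra.
rewrite in_itv/= => /andP[xy yx] ->; rewrite addrAC subrr add0r mulr1.
by rewrite !L_le//; lra.
Qed.

Let sum_ge ta p n : 0 < ta -> 0 < p ->
  Phi ta (p + n%:R) - Phi ta p <= \sum_(i < n) L ta (p + i%:R).
Proof.
move=> t0 p0; elim: n => [|n IH]; first by rewrite big_ord0 addr0 subrr.
rewrite big_ord_recr/= -[n.+1%:R]natr1 addrA.
have /andP[_] := Phi_step t0 (ltr_wpDr (ler0n R n) p0); lra.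
Qed.

Let sum_le ta p n : 0 < ta -> 0 < p ->
  \sum_(i < n) L ta (p + i%:R) + L ta (p + n%:R) <= L ta p + (Phi ta (p + n%:R) - Phi ta p).
Proof.
move=> t0 p0; elim: n => [|n IH]; first by rewrite big_ord0 addr0 subrr addr0 add0r.
rewrite big_ord_recr/= -[n.+1%:R]natr1 addrA.
have /andP[+ _] := Phi_step t0 (ltr_wpDr (ler0n R n) p0); lra.
Qed.

Let prod_normc p ta n : 0 < p ->
  normc (\prod_(i < n) ((p +i* ta) + i%:R)) =
  \prod_(i < n) (p + i%:R) * expR (2^-1 * \sum_(i < n) L ta (p + i%:R)).
Proof.
move=> p0; rewrite mulr_sumr expR_sum -big_split /= normc_prod.
apply: eq_bigr => i _; have pi0 : 0 < p + i%:R by rewrite ltr_wpDr.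
have -> : (p +i* ta) + i%:R = (p + i%:R) +i* ta.
  by rewrite -[i%:R in LHS](rmorph_nat (real_complex R)); apply: eq_reim; rewrite /= ?addr0.
apply/eqP; rewrite -(@eqrXn2 _ 2)// ?normc_ge0 ?mulr_ge0 ?expR_ge0 ?(ltW pi0)//.
rewrite sqr_normc/= exprMn -expRM_natl mulrA mulfV ?mul1r ?pnatr_eq0// lnK; last first.
  by rewrite posrE ltr_wpDr ?sqr_ge0.
by apply/eqP; field; rewrite gt_eqF.
Qed.

Let normc_cGamma_prod p ta n : 0 < p ->
  normc (cGamma (p +i* ta)) * expR (2^-1 * \sum_(i < n) L ta (p + i%:R)) * real_gamma (p + n%:R)
  = real_gamma p * normc (cGamma ((p + n%:R) +i* ta)).
Proof.
move=> p0.
have -> : (p + n%:R) +i* ta = (p +i* ta) + n%:R.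
  by rewrite -[n%:R in RHS](rmorph_nat (real_complex R)); apply: eq_reim; rewrite /= ?addr0.
by rewrite cGamma_addn// normcM prod_normc// real_gamma_addn//; ring.
Qed.

(** For large n the modulus at p + n + i ta lies between half and twice Gamma (p + n), and the
    product formula brings this comparison back to p. As n grows, Phi ta (p + n) approaches pi ta,
    which yields the rate pi / 2; the other terms come from Phi ta p, the endpoint of the integral
    test and the errors allowed at p + n. *)
Let normc_cGamma_bounds p ta : 0 < p -> 0 < ta ->
  normc (cGamma (p +i* ta)) <= 2 * real_gamma p * expR (2^-1 * (p * L ta p + 2 * p + 1 - pi * ta)) /\
  real_gamma p <= 2 * expR (2^-1 * (L ta p + 1 + pi * ta)) * normc (cGamma (p +i* ta)).
Proof.
move=> p0 t0; have g0 := real_gamma_gt0 p0.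
have ti : 0 < (2 * ta)^-1 by rewrite invr_gt0 mulr_gt0.
have [M [_ HM]] : exists M : R, M \is Num.real /\ forall x, M < x -> pi / 2 - (2 * ta)^-1 <= atan x.
  have /cvgrPdist_le/(_ _ ti) := @cvgy_atan R.
  move=> [M [Mr H]]; exists M; split=> // x /H /=; rewrite ler_norml => /andP[_]; lra.
(* The term with [M] brings the arctangent close enough to pi / 2; 8 ta^2 + 1 makes 4 ta^2 / (p + n
   - 1) at most 1 / 2 in [normc_cGamma_ge], and also p + n > 1. *)
pose n := (Num.trunc (`|M * ta| + 8 * ta ^+ 2 + 1)).+1.
have hn : `|M * ta| + 8 * ta ^+ 2 + 1 < n%:R by exact: truncnS_gt.
have t2 : 0 <= ta ^+ 2 by exact: sqr_ge0.
have nM := normr_ge0 (M * ta); have nM' := ler_norm (M * ta).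
have pn0 : 0 < p + n%:R by rewrite ltr_wpDr.
have gn0 := real_gamma_gt0 pn0.
have id := normc_cGamma_prod ta n p0.
have ng := normc_ge0 (cGamma (p +i* ta)).
have hat : pi * ta - 1 <= 2 * ta * atan ((p + n%:R) / ta).
  have := HM ((p + n%:R) / ta); rewrite ltr_pdivlMr//.
  have -> : pi * ta - 1 = 2 * ta * (pi / 2 - (2 * ta)^-1) by field; rewrite gt_eqF.
  by move=> H; rewrite ler_wpM2l ?mulr_ge0 ?(ltW t0)// H//; lra.
have hat2 : atan ((p + n%:R) / ta) <= pi / 2 by exact/ltW/atan_ltpi2.
have hL : (p + n%:R) * L ta (p + n%:R) <= 1.
  have : L ta (p + n%:R) <= (ta / (p + n%:R)) ^+ 2.
    by rewrite /L le_ln1Dx// (@lt_le_trans _ _ 0) ?sqr_ge0.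
  move/(ler_wpM2l (ltW pn0)) => /le_trans; apply.
  have -> : (p + n%:R) * (ta / (p + n%:R)) ^+ 2 = ta ^+ 2 / (p + n%:R).
    by field; rewrite gt_eqF.
  by rewrite ler_pdivrMr// mul1r; lra.
have atp : 2 * ta * atan (p / ta) <= 2 * p.
  have : atan (p / ta) <= p / ta.
    have pt0 : 0 < p / ta by rewrite divr_gt0.
    have [|y] := @MVT R (@atan R) (fun y => (1 + y ^+ 2)^-1) 0 (p / ta) pt0.
      by apply: derivable_within_continuous => y _; exact: derivable_atan.
    rewrite atan0 subr0 => _ ->; rewrite subr0 ler_piMl ?(ltW pt0)//.
    by rewrite invf_le1 ?lerDl ?sqr_ge0// ltr_wpDr ?sqr_ge0.
  have t20 : 0 <= 2 * ta by rewrite mulr_ge0// ltW.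
  move=> /(ler_wpM2l t20).
  by have -> : 2 * ta * (p / ta) = 2 * p by field; rewrite gt_eqF.
split.
- have up := @normc_cGamma_le R ((p + n%:R) +i* ta) pn0; rewrite /= in up.
  have sg := sum_ge n t0 p0.
  have : normc (cGamma (p +i* ta)) * expR (2^-1 * (Phi ta (p + n%:R) - Phi ta p)) <= 2 * real_gamma p.
    rewrite -(ler_pM2r gn0) [leRHS]mulrAC [2 * _ * _]mulrC.
    apply: le_trans (ler_wpM2l (ltW g0) up); rewrite -id ler_wpM2r ?(ltW gn0)// ler_wpM2l//.
    by rewrite ler_expR; lra.
  rewrite -ler_pdivlMr ?expR_gt0// -expRN => /le_trans; apply.
  rewrite ler_wpM2l ?mulr_ge0 ?(ltW g0)// ler_expR /Phi.
  have := L_ge0 ta (p + n%:R) => /(mulr_ge0 (ltW pn0)); lra.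
- have n1 : 1 < p + n%:R by lra.
  have lo := normc_cGamma_ge ta n1.
  have sl := sum_le n t0 p0.
  have h8 : 2^-1 <= 1 - 4 * ta ^+ 2 / (p + n%:R - 1).
    have n1' : 0 < p + n%:R - 1 by rewrite subr_gt0.
    have : 4 * ta ^+ 2 / (p + n%:R - 1) <= 2^-1.
      by rewrite ler_pdivrMr//; lra.
    by lra.
  have lo2 : real_gamma (p + n%:R) * 2^-1 <= normc (cGamma ((p + n%:R) +i* ta)).
    by apply: le_trans lo; rewrite ler_wpM2l// ltW.
  have := ler_wpM2l (ltW g0) lo2; rewrite -id.
  rewrite mulrCA [leRHS]mulrC ler_pM2l// => h.
  have {h} : real_gamma p <= 2 * (normc (cGamma (p +i* ta)) * expR (2^-1 * \sum_(i < n) L ta (p + i%:R))) by lra.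
  move=> /le_trans; apply; rewrite -mulrA ler_wpM2l// mulrC ler_wpM2r// ler_expR.
  have Pp : 0 <= Phi ta p.
    rewrite addr_ge0// mulr_ge0 ?(ltW p0)// ?mulr_ge0 ?(ltW t0)//.
    by rewrite -atan0 le_atan// divr_ge0// ltW.
  have Ln := L_ge0 ta (p + n%:R).
  have : Phi ta (p + n%:R) <= 1 + pi * ta.
    rewrite /Phi lerD//.
    have -> : pi * ta = 2 * ta * (pi / 2) by field.
    by rewrite ler_wpM2l// mulr_ge0// ltW.
  by lra.
Qed.

Lemma cGamma_conj s : 0 < complex.Re s -> normc (cGamma s^*%C) = normc (cGamma s).
Proof.
move=> s0.
suff -> : cGamma s^*%C = (cGamma s)^*%C by case: (cGamma s) => u v /=; rewrite sqrrN.
rewrite !cGammaE; apply: eq_reim.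
  rewrite Re_cintegral [RHS](_ : _ = complex.Re (cintegral mu pos (cgamma_kernel s))); last by [].
  rewrite Re_cintegral; apply: eq_Rintegral => x _; rewrite !Re_cgamma_kernel.
  by case: s s0 => u v _ /=; rewrite mulNr cosN.
rewrite Im_cintegral [RHS](_ : _ = - complex.Im (cintegral mu pos (cgamma_kernel s))); last by [].
have [_ ii] := cintegrable_cgamma_kernel s0.
rewrite Im_cintegral -mulN1r -RintegralZl//.
apply: eq_Rintegral => x _; rewrite !Im_cgamma_kernel.
by case: s s0 ii => u v _ _ /=; rewrite mulNr sinN mulrN mulN1r.
Qed.

(** The bounds at a fixed abscissa a contain factors growing polynomially in the ordinate, such as
    (1 + (ta / a)^2)^(a / 2). Giving up e in the exponential rate absorbs them, with one constant
    for the whole strip. *)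
Lemma cGamma_bounds p q e : 0 < p -> p <= q -> 0 < e -> exists2 C : R, 0 < C &
  forall s, p <= complex.Re s <= q -> [/\ cGamma s != 0,
    normc (cGamma s) <= C * expR (- (pi / 2 - e) * `|complex.Im s|) &
    normc (cGamma s)^-1 <= C * expR ((pi / 2 + e) * `|complex.Im s|)].
Proof.
move=> p0 pq e0; have q0 : 0 < q by lra.
have ep0 : 0 < e * p by rewrite mulr_gt0.
(* Slope e * p in the variable ta / p is slope e in ta. [K1] serves the upper bound, where the
   logarithm carries a factor a <= q, and [K2] the lower one. *)
have [K1 HK1] := ln_le_affine q0 ep0.
have [K2 HK2] := ln_le_affine ltr01 ep0.
pose C1 := 2 * (real_gamma p + real_gamma q) * expR (`|K1| + q + 1).
pose C2 := 2 * expR (`|K2| + 1) * expR (q + 3).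
have C10 : 0 < C1 by rewrite !mulr_gt0 ?expR_gt0 ?addr_gt0 ?real_gamma_gt0.
have C20 : 0 < C2 by rewrite !mulr_gt0 ?expR_gt0.
have pi0 := pi_gt0 R.
suff H : forall a ta : R, p <= a <= q -> 0 <= ta ->
   normc (cGamma (a +i* ta)) <= C1 * expR (- (pi / 2 - e) * ta) /\
   1 <= C2 * expR ((pi / 2 + e) * ta) * normc (cGamma (a +i* ta)).
  exists (C1 + C2); first exact: addr_gt0.
  move=> s Ks; have s0 : 0 < complex.Re s by case/andP: Ks => ? ?; lra.
  have {H} [H1 H2] : normc (cGamma s) <= C1 * expR (- (pi / 2 - e) * `|complex.Im s|) /\
     1 <= C2 * expR ((pi / 2 + e) * `|complex.Im s|) * normc (cGamma s).
    have := H (complex.Re s) `|complex.Im s| Ks (normr_ge0 _).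
    suff -> : normc (cGamma (complex.Re s +i* `|complex.Im s|)) = normc (cGamma s) by [].
    case: s s0 {Ks} => u v /= u0; case: (leP 0 v) => v0; first by rewrite ger0_norm.
    by rewrite ltr0_norm//; exact: (@cGamma_conj (u +i* v) u0).
  have nz : cGamma s != 0.
    apply/eqP => h; move: H2; rewrite h normc0 mulr0; lra.
  split=> //.
  - by apply: (le_trans H1); rewrite ler_wpM2r ?expR_ge0// lerDl ltW.
  - rewrite normcV -[_^-1]mul1r ler_pdivrMr ?normc_gt0//.
    by apply: (le_trans H2); rewrite ler_wpM2r ?normc_ge0// ler_wpM2r ?expR_ge0// lerDr ltW.
move=> a ta /andP[pa aq] ta0; have a0 : 0 < a by lra.
have ga0 := real_gamma_gt0 a0.
have gle : real_gamma a <= real_gamma p + real_gamma q by apply: real_gamma_le => //; rewrite pa.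
have gge : 1 <= expR (q + 3) * real_gamma a.
  have := real_gamma_ge a0; rewrite expRN => h.
  have : 1 <= expR (`|a - 1| + 2) * real_gamma a.
    have := ler_wpM2l (expR_ge0 (`|a - 1| + 2)) h.
    by rewrite mulfV// gt_eqF// expR_gt0.
  move=> /le_trans; apply; rewrite ler_wpM2r ?(ltW ga0)// ler_expR.
  have : `|a - 1| <= q + 1 by rewrite ler_norml; apply/andP; split; lra.
  lra.
have nK1 := normr_ge0 K1; have nK2 := normr_ge0 K2.
have lK1 := ler_norm K1; have lK2 := ler_norm K2.
(* The estimates through [Phi] divide by ta, so the real axis is treated directly. *)
have [->|tn0] := eqVneq ta 0.
  rewrite !mulr0 expR0 !mulr1 cGamma_real normc_real gtr0_norm//; split.
  - apply: (le_trans gle); rewrite /C1 mulrAC ler_peMl//.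
      exact: le_trans (ltW ga0) gle.
    have : 1 <= expR (`|K1| + q + 1) by rewrite -[leLHS]expR0 ler_expR; lra.
    lra.
  - apply: (le_trans gge); rewrite /C2 ler_wpM2r ?(ltW ga0)// ler_peMl ?expR_ge0//.
    have : 1 <= expR (`|K2| + 1) by rewrite -[leLHS]expR0 ler_expR; lra.
    lra.
have {tn0} t0 : 0 < ta by rewrite lt_neqAle eq_sym tn0.
have [up lo] := normc_cGamma_bounds a0 t0.
have Lle : 2^-1 * L ta a <= ln (1 + ta / p).
  have tp0 : 0 <= ta / p by rewrite divr_ge0// ltW.
  have : L ta a <= ln ((1 + ta / p) ^+ 2).
    apply: (le_trans (L_le ta p0 pa)); rewrite /L ler_ln ?posrE.
    - by rewrite sqrrD; lra.
    - by rewrite ltr_wpDr ?sqr_ge0.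
    - by rewrite exprn_gt0//; lra.
  by rewrite lnXn; lra.
have tp0 : 0 <= ta / p by rewrite divr_ge0// ltW.
have ept : e * p * (ta / p) = e * ta by field; rewrite gt_eqF.
have h1 := HK1 _ tp0; have h2 := HK2 _ tp0; rewrite ept in h1 h2.
split.
- apply: (le_trans up); rewrite /C1 -[leRHS]mulrA -expRD ler_pM ?expR_ge0//.
  + by rewrite mulr_ge0// ltW.
  + by rewrite ler_wpM2l.
  + rewrite ler_expR.
    have : a * (2^-1 * L ta a) <= q * ln (1 + ta / p).
      by rewrite ler_pM ?mulr_ge0 ?L_ge0 ?(ltW a0).
    lra.
- apply: (le_trans gge).
  have := ler_wpM2l (expR_ge0 (q + 3)) lo => /le_trans; apply.
  rewrite mulrA ler_wpM2r ?normc_ge0// /C2.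
  have -> (u v w : R) : 2 * u * v * w = v * (2 * (u * w)) by ring.
  by rewrite ler_wpM2l ?expR_ge0// ler_wpM2l// -expRD ler_expR; lra.
Qed.

End gamma_asymptotics.

(** * Moving a vertical contour *)

Section lebesgue_translation.
Context {R : realType}.
Local Notation mu := (@lebesgue_measure R).

Lemma lebesgue_measure_shift (h : R) (A : set (measurableTypeR R)) : measurable A ->
  pushforward mu (fun x : measurableTypeR R => (x + h : measurableTypeR R)) A = mu A.
Proof.
move=> mA; apply/esym/lebesgue_measure_unique => //=.
  exact: measurable_funD.
move=> mh _ [[a b]] _ <-.
rewrite /pushforward (_ : _ @^-1` _ = `]a - h, b - h]%classic).
  rewrite !lebesgue_measure_itv/= !lte_fin ltrD2r.
  by case: ifP => // _; rewrite -!EFinB; congr EFin; ring.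
by apply/seteqP; split=> x; rewrite /= !in_itv/= lerBrDr ltrBlDr.
Qed.

Lemma ge0_integral_shift (h : R) (D : set (measurableTypeR R)) (f : measurableTypeR R -> \bar R) :
  measurable D -> measurable_fun D f -> (forall x, D x -> (0 <= f x)%E) ->
  (\int[mu]_(x in D) f x = \int[mu]_(x in [set x : measurableTypeR R | D (x + h)%R]) f (x + h)%R)%E.
Proof.
move=> mD mf f0.
have mh : measurable_fun setT (fun x : measurableTypeR R => (x + h : measurableTypeR R)).
  exact: measurable_funD.
rewrite -(ge0_integral_pushforward mh mu mD mf) => [|y]; last by rewrite inE; exact: f0.
by apply: eq_measure_integral => A mA _; exact/esym/lebesgue_measure_shift.
Qed.

Lemma Rintegral_shift (h : R) (D : set (measurableTypeR R)) (f : R -> R) :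
  measurable D -> measurable_fun D f ->
  \int[mu]_(x in D) f x = \int[mu]_(x in [set x : measurableTypeR R | D (x + h)]) f (x + h).
Proof.
move=> mD mf; have mE : measurable_fun D (EFin \o f) by exact/measurable_EFinP.
rewrite /Rintegral integralE [in RHS]integralE.
rewrite (ge0_integral_shift h mD (measurable_funepos mE))//.
rewrite (ge0_integral_shift h mD (measurable_funeneg mE))//.
by congr (fine (_ - _)); apply: eq_integral => x _; rewrite ?funeposE ?funenegE.
Qed.

Lemma integrable_itv (u v M : R) (f : R -> R) :
  measurable_fun (`[u, v]%classic : set (measurableTypeR R)) f ->
  (forall x, u <= x <= v -> `|f x| <= M) ->
  mu.-integrable `[u, v] (EFin \o f).
Proof.
move=> mf fM.
have mI : measurable (`[u, v]%classic : set (measurableTypeR R)) by exact: measurable_itv.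
apply: measurable_bounded_integrable => //.
  by rewrite [X in (X < _)%E]lebesgue_measure_itv/=; case: ifP => _; rewrite ?ltry// -EFinB ltry.
exists M; split; first exact: num_real.
by move=> N MN x /=; rewrite in_itv/= => /fM /le_trans; apply; exact: ltW.
Qed.

Lemma Rintegral_itv_le (a b : itv_bound R) (u v M : R) (f : R -> R) : u <= v ->
  [set` Interval a b] `<=` `[u, v]%classic ->
  measurable_fun (`[u, v]%classic : set (measurableTypeR R)) f ->
  (forall x, u <= x <= v -> `|f x| <= M) ->
  `|\int[mu]_(x in [set` Interval a b]) f x| <= M * (v - u).
Proof.
move=> uv sub mf fM.
have mI : measurable (`[u, v]%classic : set (measurableTypeR R)) by exact: measurable_itv.
have mS : measurable ([set` Interval a b] : set (measurableTypeR R)) by exact: measurable_itv.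
have iv := integrable_itv mf fM.
have is_ := integrableS mI mS sub iv.
have M0 : 0 <= M by apply: le_trans (fM u _); rewrite ?lexx.
have ic : mu.-integrable `[u, v] (EFin \o cst M).
  by apply: (@integrable_itv _ _ M) => // x _; rewrite /= ger0_norm.
apply: (le_trans (le_normr_Rintegral mS is_)).
apply: (@le_trans _ _ (\int[mu]_(x in `[u, v]) cst M x)); last first.
  rewrite Rintegral_cst// [X in fine X]lebesgue_measure_itv/= lte_fin.
  by case: ltP => //= h; rewrite mulr0 mulr_ge0// subr_ge0.
apply: (@le_trans _ _ (\int[mu]_(x in [set` Interval a b]) cst M x)).
  apply: le_Rintegral => //; first exact: (integrable_abse is_).
    exact: integrableS mI mS sub ic.
  by move=> x /sub /=; rewrite in_itv/= => /fM.
rewrite /Rintegral fine_le ?integrable_fin_num//; first exact: integrableS mI mS sub ic.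
by apply: ge0_subset_integral => //; exact: measurable_int ic.
Qed.

(** The common part of the two windows cancels, leaving two end pieces of length h: only the bound
    [B] near the ends enters the estimate, [M] merely ensures integrability. *)
Lemma Rintegral_window_shift (T h B M : R) (f : R -> R) : 0 < T -> 0 < h ->
  measurable_fun setT f -> (forall x, - T <= x <= T + h -> `|f x| <= M) ->
  (forall x, - T <= x <= - T + h \/ T <= x <= T + h -> `|f x| <= B) ->
  `|\int[mu]_(x in `[- T, T]) f (x + h) - \int[mu]_(x in `[- T, T]) f x| <= 2 * B * h.
Proof.
move=> T0 h0 mf fM fB.
have mfS (E : set (measurableTypeR R)) : measurable_fun E f by exact: measurable_funTS.
have mI : measurable (`[- T + h, T + h]%classic : set (measurableTypeR R)) by exact: measurable_itv.
have -> : \int[mu]_(x in `[- T, T]) f (x + h) = \int[mu]_(x in `[- T + h, T + h]) f x.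
  rewrite (Rintegral_shift h mI (mfS _)); congr Rintegral.
  by apply/seteqP; split=> x; rewrite /= !in_itv/= !lerD2r.
have iv := integrable_itv (mfS _) fM.
have e1 : \int[mu]_(x in `[- T, T + h]) f x - \int[mu]_(x in `[- T, T]) f x = \int[mu]_(x in `]T, T + h]) f x.
  by apply: Rintegral_itvB => //; rewrite bnd_simp; lra.
have e2 : \int[mu]_(x in `[- T, T + h]) f x - \int[mu]_(x in `[- T, - T + h]) f x = \int[mu]_(x in `[- T + h, T + h]) f x.
  have i3 : mu.-integrable `]- T + h, T + h] (EFin \o f).
    apply: (integrableS _ _ _ iv) => //.
    by move=> x; rewrite /= !in_itv/= => /andP[h1 h2]; apply/andP; split => //; lra.
  rewrite -(Rintegral_itv_obnd_cbnd i3).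
  by apply: Rintegral_itvB => //; rewrite bnd_simp; lra.
have -> : \int[mu]_(x in `[- T + h, T + h]) f x - \int[mu]_(x in `[- T, T]) f x =
   \int[mu]_(x in `]T, T + h]) f x - \int[mu]_(x in `[- T, - T + h]) f x.
  by rewrite -e1 -e2; ring.
apply: (le_trans (ler_normB _ _)).
have b1 : `|\int[mu]_(x in `]T, T + h]) f x| <= B * (T + h - T).
  apply: Rintegral_itv_le; [lra| |exact: mfS|by move=> x hx; apply: fB; right].
  exact: subset_itv_oc_cc.
have b2 : `|\int[mu]_(x in `[- T, - T + h]) f x| <= B * (- T + h - - T).
  apply: Rintegral_itv_le; [lra| |exact: mfS|by move=> x hx; apply: fB; left].
  by [].
apply: (le_trans (lerD b1 b2)); rewrite le_eqVlt; apply/orP; left; apply/eqP; ring.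
Qed.

End lebesgue_translation.

(** * Cauchy's theorem on a vertical strip *)

Section contour_shift.
Context {R : realType}.
Local Notation mu := (@lebesgue_measure R).

Lemma lipschitz_continuous_at (g : R -> R) (x L de : R) : 0 < de -> 0 <= L ->
  (forall h, `|h| <= de -> `|g (x + h) - g x| <= L * `|h|) -> {for x, continuous g}.
Proof.
move=> de0 L0 H; apply/cvgrPdist_le => e e0.
have L1 : 0 < L + 1 by lra.
have r0 : 0 < Num.min de (e / (L + 1)) by rewrite lt_min de0 divr_gt0.
near=> y.
have yx : `|y - x| <= Num.min de (e / (L + 1)).
  rewrite distrC; near: y; apply: cvgr_dist_le => //; exact: cvg_id.
rewrite distrC -[y](subrKC x); move: yx; rewrite le_min => /andP[h1 h2].
apply: (le_trans (H _ h1)).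
move: h2; rewrite ler_pdivlMr// => /(le_trans _); apply.
by rewrite mulrC ler_wpM2l//; lra.
Unshelve. all: by end_near. Qed.

Lemma hol_vertical_measurable (F : R[i] -> R[i]) (a : R) (K : R -> set R[i]) :
  (forall T ta : R, `|ta| <= T -> K T (a +i* ta)) ->
  (forall T, hol F (K T)) -> cmeasurable setT (fun ta : measurableTypeR R => F (a +i* ta)).
Proof.
move=> aK hF.
have key x : exists L de : R, [/\ 0 <= L, 0 < de &
    forall h, `|h| <= de -> normc (F (a +i* (x + h)) - F (a +i* x)) <= L * `|h|].
  have [L [de [L0 /andP[d0 d1] H]]] := hol_lipschitz (hF (`|x| + 1)).
  exists L, de; split=> // h hd.
  have nh : normc (0 +i* h : R[i]) = `|h| by rewrite /= expr0n/= add0r sqrtr_sqr.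
  have -> : a +i* (x + h) = (a +i* x) + (0 +i* h) by apply: eq_reim => /=; rewrite ?addr0.
  rewrite -nh; apply: H; rewrite ?nh//.
    by apply: aK; rewrite lerDl.
  have -> : (a +i* x) + (0 +i* h) = a +i* (x + h) by apply: eq_reim => /=; rewrite ?addr0.
  by apply: aK; apply: (le_trans (ler_normD _ _)); rewrite lerD2l (le_trans hd).
split; apply: continuous_measurable_fun => x;
    have [L [de [L0 d0 H]]] := key x; apply: (lipschitz_continuous_at d0 L0) => h /H;
    apply: le_trans.
- by rewrite /= -ReN -ReD; exact: normRe_le.
- by rewrite /= -ImN -ImD; exact: normIm_le.
Qed.

(** Since h F' (s) is also - i times the increment of F in the direction i h, moving a truncated
    vertical integral to the right by h amounts, up to O (h^2), to translating it upwards by h. That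
    costs only the values of F near the two ends. [quasi_MVT] sums these costs from a to b, and the
    decay of F removes them as T tends to infinity. *)
Lemma contour_shift (F : R[i] -> R[i]) (a b C : R) : a <= b ->
  (forall T, hol F [set s | a <= complex.Re s <= b /\ `|complex.Im s| <= T]) ->
  (forall s, a <= complex.Re s <= b -> normc (F s) <= C * (1 + complex.Im s ^+ 2)^-1) ->
  cintegral mu setT (fun ta : R => F (a +i* ta)) = cintegral mu setT (fun ta : R => F (b +i* ta)).
Proof.
move=> ab hF FC.
have C0 : 0 <= C.
  have := FC (a +i* 0); rewrite /= expr0n/= addr0 invr1 mulr1 => h.
  by apply: le_trans (h _); rewrite ?normc_ge0 ?lexx.
have mF c : a <= c <= b -> cmeasurable setT (fun ta : measurableTypeR R => F (c +i* ta)).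
  by move=> acb; apply: (hol_vertical_measurable _ hF) => T ta; split.
have oneD x : 0 < 1 + x ^+ 2 :> R by rewrite ltr_wpDr ?sqr_ge0.
have FC1 s : a <= complex.Re s <= b -> normc (F s) <= C.
  move=> /FC /le_trans; apply; rewrite -[leRHS]mulr1 ler_wpM2l// invf_le1// lerDl sqr_ge0//.
pose I (T : R) : set (measurableTypeR R) := `[- T, T]%classic.
have mI T : measurable (I T) by exact: measurable_itv.
have mFI c T : a <= c <= b -> cmeasurable (I T) (fun ta : R => F (c +i* ta)).
  by move=> /mF[m1 m2]; split; exact: measurable_funTS.
have icst T (M : R) : mu.-integrable (I T) (EFin \o cst M).
  by apply: (@integrable_itv _ _ _ `|M|) => // x _.
have iF c T : a <= c <= b -> cintegrable mu (I T) (fun ta : R => F (c +i* ta)).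
  move=> acb; apply: (cintegrable_le (mI T) (mFI c T acb) (icst T C)) => x _.
  exact: FC1.
pose G T c := cintegral mu (I T) (fun ta : R => F (c +i* ta)).
(* [B] bounds F at heights at least T - 1, because a translation by h <= 1 meets the ends only
   there. The factor 4 is 2 for the two ends times 2 for real and imaginary parts. *)
have GT T : 1 <= T -> normc (G T b - G T a) <= 4 * (C * (1 + (T - 1) ^+ 2)^-1) * (b - a).
  move=> T1; set B := C * (1 + (T - 1) ^+ 2)^-1.
  (* Height T + 1 leaves room for the translated points. *)
  have [F' [M [de [M0 /andP[de0 de1] H]]]] := hF (T + 1).
  apply: (@quasi_MVT _ (G T) (4 * B) (2 * (2 * M * (T - - T))) de) => //.
    by rewrite !mulr_ge0//; lra.
  move=> y h ay /andP[h0 hde] yhb.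
  have h1 : h <= 1 by exact: le_trans de1.
  have yab : a <= y <= b by lra.
  have yhab : a <= y + h <= b by lra.
  have mshift c : a <= c <= b -> cmeasurable setT (fun ta : measurableTypeR R => F (c +i* (ta + h))).
    move=> /mF[m1 m2]; have mh : measurable_fun setT (fun x : measurableTypeR R => (x + h : measurableTypeR R)).
      exact: measurable_funD.
    by split; [exact: (measurableT_comp m1 mh)|exact: (measurableT_comp m2 mh)].
  have ishift : cintegrable mu (I T) (fun ta : R => F (y +i* (ta + h))).
    have [m1 m2] := mshift y yab.
    apply: (cintegrable_le (mI T) _ (icst T C)); first by split; exact: measurable_funTS.
    by move=> x _; exact: FC1.
  have i1 := cintegrableB (mI T) (iF _ T yhab) (iF _ T yab).
  have i2 := cintegrableB (mI T) ishift (iF _ T yab).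
  have i3 := cintegrableZ (- 'i%C) (mI T) i2.
  have i4 := cintegrableB (mI T) i1 i3.
  have -> : G T (y + h) - G T y =
     cintegral mu (I T) (fun ta => F ((y + h) +i* ta) - F (y +i* ta) - (- 'i%C) * (F (y +i* (ta + h)) - F (y +i* ta)))
     + (- 'i%C) * (cintegral mu (I T) (fun ta => F (y +i* (ta + h))) - G T y).
    rewrite (cintegralB (mI T) i1 i3) (cintegralB (mI T) (iF _ T yhab) (iF _ T yab)).
    by rewrite (cintegralZ _ (mI T) i2) (cintegralB (mI T) ishift (iF _ T yab)) /G; ring.
  apply: (le_trans (le_normcD _ _)); rewrite addrC; apply: lerD.
    rewrite normcM normcN normci mul1r; apply: (le_trans (normc_le_reim _)).
    have Bb x : - T <= x <= - T + h \/ T <= x <= T + h -> normc (F (y +i* x)) <= B.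
      move=> hx; apply: (le_trans (FC _ _)) => //; rewrite ler_wpM2l// lef_pV2 ?posrE// lerD2l /=.
      by case: hx => hx; nra.
    rewrite ReD ReN ImD ImN !Re_cintegral !Im_cintegral.
    have [m1 m2] := mF y yab; have T0 : 0 < T by lra.
    have w1 : `|\int[mu]_(x in I T) complex.Re (F (y +i* (x + h))) - \int[mu]_(x in I T) complex.Re (F (y +i* x))| <= 2 * B * h.
      apply: (@Rintegral_window_shift _ T h B C (fun x => complex.Re (F (y +i* x)))) => // x hx.
        by apply: (le_trans (normRe_le _)); exact: FC1.
      by apply: (le_trans (normRe_le _)); exact: Bb.
    have w2 : `|\int[mu]_(x in I T) complex.Im (F (y +i* (x + h))) - \int[mu]_(x in I T) complex.Im (F (y +i* x))| <= 2 * B * h.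
      apply: (@Rintegral_window_shift _ T h B C (fun x => complex.Im (F (y +i* x)))) => // x hx.
        by apply: (le_trans (normIm_le _)); exact: FC1.
      by apply: (le_trans (normIm_le _)); exact: Bb.
    by apply: (le_trans (lerD w1 w2)); lra.
  have mE : cmeasurable (I T) (fun ta => F ((y + h) +i* ta) - F (y +i* ta) - (- 'i%C) * (F (y +i* (ta + h)) - F (y +i* ta))).
    by have [/measurable_int/measurable_EFinP ? /measurable_int/measurable_EFinP ?] := i4.
  apply: (le_trans (normc_cintegral_le (mI T) mE (icst T (2 * M * h ^+ 2)) _)).
    move=> x; rewrite /I /= in_itv/= -ler_norml => xT.
    have Ks : a <= complex.Re (y +i* x) <= b /\ `|complex.Im (y +i* x)| <= T + 1 by split=> //=; lra.
    have [_ _ HH] := H _ Ks.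
    have nh : normc (h%:C : R[i]) = h by rewrite normc_real gtr0_norm.
    have nih : normc ('i%C * h%:C : R[i]) = h by rewrite normcM normci mul1r.
    have e1 : (y +i* x) + h%:C = (y + h) +i* x by apply: eq_reim => /=; rewrite ?addr0.
    have e2 : (y +i* x) + 'i%C * h%:C = y +i* (x + h).
      by apply: eq_reim; rewrite !reimE /=; ring.
    have r1 := HH h%:C; rewrite nh e1 in r1.
    have r2 := HH ('i%C * h%:C); rewrite nih e2 in r2.
    have {}r1 := r1 hde (ltac:(by split=> //=; lra)).
    have {}r2 : normc (F (y +i* (x + h)) - F (y +i* x) - 'i%C * h%:C * F' (y +i* x)) <= M * h ^+ 2.
      apply: r2 => //; split=> //=; apply: (le_trans (ler_normD _ _)).
      by rewrite (gtr0_norm h0) lerD.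
    have -> : F ((y + h) +i* x) - F (y +i* x) - (- 'i%C) * (F (y +i* (x + h)) - F (y +i* x)) =
      (F ((y + h) +i* x) - F (y +i* x) - h%:C * F' (y +i* x))
      + 'i%C * (F (y +i* (x + h)) - F (y +i* x) - 'i%C * h%:C * F' (y +i* x)).
      have ii : 'i%C * 'i%C = -1 :> R[i] by rewrite -expr2 sqr_i.
      set P := F _; set Q := F _; set S := F _; set W := F' _.
      rewrite [RHS](_ : _ = P - Q - h%:C * W + 'i%C * (S - Q) - ('i%C * 'i%C) * h%:C * W); last by ring.
      by rewrite ii; ring.
    apply: (le_trans (le_normcD _ _)); rewrite normcM normci mul1r /cst.
    by apply: (le_trans (lerD r1 r2)); lra.
  rewrite Rintegral_cst// [X in fine X]lebesgue_measure_itv/= lte_fin.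
  rewrite (_ : - T < T); last lra.
  by rewrite /= le_eqVlt; apply/orP; left; apply/eqP; ring.
have ndI : nondecreasing_seq (fun n : nat => I n.+1%:R).
  move=> m n mn; apply/subsetPset => x; rewrite /I /= !in_itv/= -!ler_norml => h.
  by apply: (le_trans h); rewrite ler_nat ltnS.
have UI : \bigcup_n I n.+1%:R = setT.
  apply/seteqP; split=> // x _; exists (Num.trunc `|x|) => //=; rewrite /I /= in_itv/= -ler_norml.
  exact: ltW (truncnS_gt _).
have iT c : a <= c <= b -> cintegrable mu setT (fun ta : R => F (c +i* ta)).
  move=> acb; apply: (cintegrable_le measurableT (mF c acb) (integrable_mulrl C measurableT (@integrable_oneDsqrV R))).
  by move=> x _; exact: FC.
have aab : a <= a <= b by rewrite lexx.
have bab : a <= b <= b by rewrite lexx andbT.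
(* For T = n + 1 the bound [GT] is a multiple of 1 / (1 + n^2) <= 2 / (n + 1), so the harmonic
   sequence is a majorant. *)
have lim0 (u : nat -> R) : (forall n, `|u n| <= normc (G n.+1%:R b - G n.+1%:R a)) -> u n @[n --> \oo] --> (0 : R).
  move=> Hu; apply: (@cvg0_le _ _ (fun n => (8 * C * (b - a)) * harmonic n)); last first.
    rewrite -[X in _ --> X](mulr0 (8 * C * (b - a))); apply: cvgM; first exact: cvg_cst.
    exact: cvg_harmonic.
  move=> n; apply: (le_trans (Hu n)); apply: (le_trans (GT _ _)); first by rewrite ler1n.
  have -> : n.+1%:R - 1 = n%:R :> R by rewrite -natr1 addrK.
  have -> : 8 * C * (b - a) * harmonic n = 4 * (C * (2 * harmonic n)) * (b - a) by ring.
  rewrite ler_wpM2r ?subr_ge0// ler_wpM2l// ler_wpM2l// /harmonic/=.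
  rewrite -[2]invrK -invfM lef_pV2 ?posrE ?mulr_gt0 ?invr_gt0//.
  rewrite -[n.+1%:R]natr1; have := ler0n R n; set N := n%:R => N0.
  have hq : 0 <= (N - 4^-1) ^+ 2 by exact: sqr_ge0.
  by nra.
apply: eq_reim; rewrite ?Re_cintegral ?Im_cintegral; apply/eqP; rewrite eq_sym -subr_eq0; apply/eqP.
- have [ia _] := iT a aab; have [ib _] := iT b bab.
  rewrite -UI in ia ib.
  have ca := nondecreasing_set_cvg_Rintegral ndI (fun n => mI _) ia.
  have cb := nondecreasing_set_cvg_Rintegral ndI (fun n => mI _) ib.
  have c0 := cvgB cb ca; rewrite UI in c0.
  have z : (fun n => \int[mu]_(x in I n.+1%:R) complex.Re (F (b +i* x)) - \int[mu]_(x in I n.+1%:R) complex.Re (F (a +i* x))) @ \oo --> (0 : R).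
    by apply: lim0 => n; apply: le_trans (normRe_le _); rewrite ReD ReN.
  exact: (cvg_unique _ (c0 _) z).
- have [_ ia] := iT a aab; have [_ ib] := iT b bab.
  rewrite -UI in ia ib.
  have ca := nondecreasing_set_cvg_Rintegral ndI (fun n => mI _) ia.
  have cb := nondecreasing_set_cvg_Rintegral ndI (fun n => mI _) ib.
  have c0 := cvgB cb ca; rewrite UI in c0.
  have z : (fun n => \int[mu]_(x in I n.+1%:R) complex.Im (F (b +i* x)) - \int[mu]_(x in I n.+1%:R) complex.Im (F (a +i* x))) @ \oo --> (0 : R).
    by apply: lim0 => n; apply: le_trans (normIm_le _); rewrite ImD ImN.
  exact: (cvg_unique _ (c0 _) z).
Qed.

End contour_shift.

(** * Mellin-Barnes integrals *)

Section mellin_barnes_integrand.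
Context {R : realType}.
Local Notation mu := (@lebesgue_measure R).
Implicit Types (p q a b e k L x y : R) (s : R[i]).

Let le_of_eq x y : x = y -> x <= y. Proof. by move=> ->. Qed.

Definition box a b (T : R) := [set s : R[i] | a <= complex.Re s <= b /\ `|complex.Im s| <= T].

Lemma cGamma_affine p q a b e : `|q| <= 1 -> a <= b -> 0 < p + q * a -> 0 < p + q * b -> 0 < e ->
  exists C : R, [/\ 0 < C, forall s, a <= complex.Re s <= b -> [/\ cGamma (p%:C + q%:C * s) != 0,
    normc (cGamma (p%:C + q%:C * s)) <= C * expR (- (pi / 2 - e) * `|q| * `|complex.Im s|) &
    normc (cGamma (p%:C + q%:C * s))^-1 <= C * expR ((pi / 2 + e) * `|q| * `|complex.Im s|)],
    forall T, hol (fun s => cGamma (p%:C + q%:C * s)) (box a b T) &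
    forall T, hol (fun s => (cGamma (p%:C + q%:C * s))^-1) (box a b T)].
Proof.
move=> q1 ab pa pb e0.
pose l := Num.min (p + q * a) (p + q * b); pose u := Num.max (p + q * a) (p + q * b).
have l0 : 0 < l by rewrite lt_min pa.
have lu : l <= u by rewrite le_max ge_min lexx.
have [C C0 HC] := cGamma_bounds l0 lu e0.
have ReE s : complex.Re (p%:C + q%:C * s) = p + q * complex.Re s.
  by rewrite !reimE /= mul0r subr0.
have ImE s : complex.Im (p%:C + q%:C * s) = q * complex.Im s.
  by rewrite !reimE /= mul0r addr0 add0r.
have rng s : a <= complex.Re s <= b -> l <= complex.Re (p%:C + q%:C * s) <= u.
  move=> /andP[h1 h2]; rewrite ReE ge_min le_max !lerD2l.
  have [q0|/ltW q0] := leP 0 q.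
    by rewrite (ler_wpM2l q0 h1) (ler_wpM2l q0 h2) orbT.
  by rewrite (ler_wnM2l q0 h1) (ler_wnM2l q0 h2) orbT.
have bd s : a <= complex.Re s <= b -> [/\ cGamma (p%:C + q%:C * s) != 0,
    normc (cGamma (p%:C + q%:C * s)) <= C * expR (- (pi / 2 - e) * `|q| * `|complex.Im s|) &
    normc (cGamma (p%:C + q%:C * s))^-1 <= C * expR ((pi / 2 + e) * `|q| * `|complex.Im s|)].
  by move=> /rng /HC; rewrite ImE normrM !mulrA.
have hG T : hol (fun s => cGamma (p%:C + q%:C * s)) (box a b T).
  apply: (hol_comp_affine q1 _ (hol_cGamma u l0)) => s [] /rng; exact.
exists C; split=> // T.
pose m := C * expR ((pi / 2 + e) * `|q| * T).
have m0 : 0 < m by rewrite mulr_gt0 ?expR_gt0.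
have mi : 0 < m^-1 by rewrite invr_gt0.
apply: (hol_inv mi) => // s [] /bd[nz _ h] sT.
have nz' : 0 < normc (cGamma (p%:C + q%:C * s))^-1 by rewrite normc_gt0 invr_eq0.
rewrite -[leRHS]invrK -normcV lef_pV2 ?posrE//.
apply: (le_trans h); rewrite ler_wpM2l ?(ltW C0)// ler_expR ler_wpM2l// mulr_ge0//.
by have := pi_gt0 R; lra.
Qed.

(** The square is deliberate: one factor absorbs the growth 1 + x^2 of the remainders in L, the
    other remains for integrability. *)
Lemma expR_decay_oneDsqr (k : R) : 0 < k ->
  exists2 C : R, 0 < C & forall x, expR (- k * `|x|) <= C * (1 + x ^+ 2)^-1 ^+ 2.
Proof.
move=> k0; have [K HK] := @ln_le_affine R 4 k (ltac:(by [])) k0.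
exists (expR K); first exact: expR_gt0.
move=> x; have x1 : 0 < 1 + x ^+ 2 by rewrite ltr_wpDr ?sqr_ge0.
have y1 : 0 < 1 + `|x| by rewrite ltr_pwDl.
have h : (1 + x ^+ 2) ^+ 2 <= expR (k * `|x| + K).
  apply: (@le_trans _ _ ((1 + `|x|) ^+ 4)).
    have h0 : 1 + x ^+ 2 <= (1 + `|x|) ^+ 2.
      by rewrite -(real_normK (num_real x)); have := normr_ge0 x; nra.
    rewrite (_ : 4%N = (2 * 2)%N)// exprM; apply: lerXn2r h0; rewrite nnegrE.
      exact: ltW.
    exact: sqr_ge0.
  rewrite -[leLHS]lnK ?posrE ?exprn_gt0// ler_expR lnXn// -mulr_natl.
  exact: HK.
have := ler_wpM2l (expR_ge0 (- k * `|x|)) h.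
rewrite -expRD mulNr addrA addNr add0r => h2.
by rewrite exprVn ler_pdivlMr ?exprn_gt0.
Qed.

(* With D = d / 2 and k = 1 this is the integrand of [Zkernel] without its power of z; taking k = 2
   replaces Gamma (1 - s), and its pole at s = 1, by Gamma (2 - s). *)
Definition mb_gamma (alpha beta D k : R) s : R[i] :=
  cGamma s * cGamma (D%:C - (beta / 2)%:C * s) * cGamma (k%:C - s) /
    (cGamma ((beta / 2)%:C * s) * cGamma (1 - alpha%:C * s)).

(* For such abscissae a all five Gamma factors of [mb_gamma] are taken at points with
   positive real part. *)
Definition mb_admissible (alpha beta D k a : R) :=
  [&& 0 < a, a < k, (beta / 2) * a < D & alpha * a < 1].

Variables alpha beta D : R.
Hypothesis alpha01 : 0 < alpha < 1.
Hypothesis beta02 : 0 < beta <= 2.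

Local Notation mbg := (mb_gamma alpha beta D).
Local Notation admissible := (mb_admissible alpha beta D).

(** Balance of exponential rates: Gamma (s) and Gamma (k - s) decay at rate pi / 2 each, the
    reciprocals grow at rates at most pi beta / 4 <= pi / 2 and pi alpha / 2, and Gamma (D - beta s
    / 2) is only used as bounded. The net decay is pi (1 - alpha) / 2, up to the loss [e] per
    factor. *)
Lemma mb_gamma_strip k a b : 0 < a -> a <= b -> b < k -> (beta / 2) * b < D -> alpha * b < 1 ->
  (forall T, hol (mbg k) (box a b T)) /\
  exists2 C : R, 0 < C & forall s, a <= complex.Re s <= b ->
    normc (mbg k s) <= C * (1 + complex.Im s ^+ 2)^-1 ^+ 2.
Proof.
move=> a0 ab bk bD ba; have [/andP[al0 al1] /andP[be0 be2]] := (alpha01, beta02).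
have pi0 := pi_gt0 R.
(* Four factors lose at most [e] each, in total half of the available rate. *)
pose e := pi * (1 - alpha) / 16.
have al1' : 0 < 1 - alpha by lra.
have e0 : 0 < e by rewrite divr_gt0// mulr_gt0.
have e1 : e <= pi / 16 by rewrite /e ler_wpM2r// ?invr_ge0// ler_piMr ?(ltW pi0)//; lra.
have be20 : 0 <= beta / 2 by lra.
have pe0 : 0 <= pi / 2 - e by lra.
have pe1 : 0 <= pi / 2 + e by lra.
have q1 : (pi / 2 + e) * (beta / 2) <= pi / 2 + e by rewrite ler_piMr//; lra.
have q2 : e * alpha <= e by rewrite ler_piMr ?(ltW e0)//; lra.
have ee : 4 * e = pi * (1 - alpha) / 4 by rewrite /e; field.
have qf : - (pi / 2 - e) + - (pi / 2 - e) + (pi / 2 + e) * (beta / 2) + (pi / 2 + e) * alpha <= - (pi * (1 - alpha) / 4).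
  by rewrite [X in _ + X <= _]mulrDl; lra.
have bD' : 0 < D + - (beta / 2) * a.
  have : beta / 2 * a <= beta / 2 * b by rewrite ler_wpM2l//; lra.
  lra.
have ba' : 0 < 1 + - alpha * a.
  have : alpha * a <= alpha * b by rewrite ler_wpM2l//; lra.
  lra.
have [C1 [C10 H1 h1 _]] := @cGamma_affine 0 1 a b e (ltac:(by rewrite normr1)) ab (ltac:(lra)) (ltac:(lra)) e0.
have [C2 [C20 H2 h2 _]] := @cGamma_affine D (- (beta / 2)) a b e (ltac:(by rewrite normrN ger0_norm; lra)) ab bD' (ltac:(lra)) e0.
have [C3 [C30 H3 h3 _]] := @cGamma_affine k (-1) a b e (ltac:(by rewrite normrN normr1)) ab (ltac:(lra)) (ltac:(lra)) e0.
have ab4 : 0 < 0 + beta / 2 * a by rewrite add0r mulr_gt0//; lra.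
have ab5 : 0 < 0 + beta / 2 * b by rewrite add0r mulr_gt0//; lra.
have [C4 [C40 H4 _ h4]] := @cGamma_affine 0 (beta / 2) a b e (ltac:(by rewrite ger0_norm; lra)) ab ab4 ab5 e0.
have [C5 [C50 H5 _ h5]] := @cGamma_affine 1 (- alpha) a b e (ltac:(by rewrite normrN ger0_norm; lra)) ab ba' (ltac:(lra)) e0.
have E s : mbg k s = cGamma (0%:C + 1%:C * s) * cGamma (D%:C + (- (beta / 2))%:C * s) *
    cGamma (k%:C + (-1)%:C * s) * (cGamma (0%:C + (beta / 2)%:C * s))^-1 * (cGamma (1%:C + (- alpha)%:C * s))^-1.
  rewrite /mb_gamma !rmorphN rmorph0 rmorph1 !add0r mul1r !mulNr mul1r invfM; ring.
split.
  move=> T; apply: (hol_ext (F := fun s => cGamma (0%:C + 1%:C * s) * cGamma (D%:C + (- (beta / 2))%:C * s) *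
    cGamma (k%:C + (-1)%:C * s) * (cGamma (0%:C + (beta / 2)%:C * s))^-1 * (cGamma (1%:C + (- alpha)%:C * s))^-1)).
    by move=> s _; rewrite E.
  exact: (hol_mul (hol_mul (hol_mul (hol_mul (h1 T) (h2 T)) (h3 T)) (h4 T)) (h5 T)).
have k0 : 0 < pi * (1 - alpha) / 4 by rewrite divr_gt0// mulr_gt0.
have [K K0 HK] := expR_decay_oneDsqr k0.
have CC : 0 < C1 * C2 * C3 * C4 * C5 by rewrite !mulr_gt0.
exists (C1 * C2 * C3 * C4 * C5 * K); first exact: mulr_gt0.
move=> s sab; rewrite -mulrA; apply: le_trans (ler_wpM2l (ltW CC) (HK (complex.Im s))).
have [_ g1 _] := H1 s sab; have [_ g2 _] := H2 s sab; have [_ g3 _] := H3 s sab.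
have [_ _ g4] := H4 s sab; have [_ _ g5] := H5 s sab.
rewrite E !normcM.
set t := `|complex.Im s| in g1 g2 g3 g4 g5 *; have t0 : 0 <= t by exact: normr_ge0.
rewrite normr1 mulr1 in g1; rewrite normrN normr1 mulr1 in g3.
rewrite (ger0_norm be20) in g4; rewrite normrN (ger0_norm (ltW al0)) in g5.
have g2' : normc (cGamma (D%:C + (- (beta / 2))%:C * s)) <= C2.
  apply: (le_trans g2); rewrite ler_piMr ?(ltW C20)// -[leRHS]expR0 ler_expR.
  by rewrite !mulNr oppr_le0 mulr_ge0// mulr_ge0.
have n0 (w : R[i]) := normc_ge0 w.
apply: (@le_trans _ _ ((C1 * expR (- (pi / 2 - e) * t)) * C2 * (C3 * expR (- (pi / 2 - e) * t)) *
   (C4 * expR ((pi / 2 + e) * (beta / 2) * t)) * (C5 * expR ((pi / 2 + e) * alpha * t)))).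
  have f2 := ler_pM (n0 _) (n0 _) g1 g2'.
  have f3 := ler_pM (mulr_ge0 (n0 _) (n0 _)) (n0 _) f2 g3.
  have f4 := ler_pM (mulr_ge0 (mulr_ge0 (n0 _) (n0 _)) (n0 _)) (n0 _) f3 g4.
  exact: ler_pM (mulr_ge0 (mulr_ge0 (mulr_ge0 (n0 _) (n0 _)) (n0 _)) (n0 _)) (n0 _) f4 g5.
rewrite [leLHS](_ : _ = C1 * C2 * C3 * C4 * C5 * (expR (- (pi / 2 - e) * t) * expR (- (pi / 2 - e) * t) * expR ((pi / 2 + e) * (beta / 2) * t) * expR ((pi / 2 + e) * alpha * t))); last by ring.
by rewrite ler_wpM2l ?(ltW CC)// -!expRD ler_expR -!mulrDl ler_wpM2r.
Qed.

(** [L] stands for ln z, so the exponential is z^(- s). The constant 1 / (2 pi) is left out and the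
    i of ds has been cancelled. *)
Definition mb_integral k c L := cintegral mu setT (fun ta : R =>
  mbg k (c +i* ta) * cexp ((c +i* ta) * (- L)%:C)).

Let strip1 k a : admissible k a ->
  cmeasurable setT (fun ta : measurableTypeR R => mbg k (a +i* ta)) /\
  exists2 C : R, 0 < C & forall ta : R, normc (mbg k (a +i* ta)) <= C * (1 + ta ^+ 2)^-1 ^+ 2.
Proof.
move=> /and4P[a0 ak aD aa].
have [h [C C0 HC]] := mb_gamma_strip a0 (lexx a) ak aD aa.
split; last by exists C => // ta; apply: (HC (a +i* ta)); rewrite /= lexx.
by apply: (hol_vertical_measurable _ h) => T ta ?; split=> //=; rewrite lexx.
Qed.

Let meas_ta a : cmeasurable setT (fun ta : measurableTypeR R => a +i* (ta : R)).
Proof. by split; [exact: measurable_cst|exact: measurable_id]. Qed.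

Let oneDV_le1 x : (1 + x ^+ 2)^-1 <= 1.
Proof. by rewrite invf_le1 ?lerDl ?sqr_ge0// ltr_wpDr ?sqr_ge0. Qed.

Let oneDV_ge0 x : 0 <= (1 + x ^+ 2)^-1.
Proof. by rewrite invr_ge0 addr_ge0 ?sqr_ge0. Qed.

Let oneDV_sqr_le x : (1 + x ^+ 2)^-1 ^+ 2 <= (1 + x ^+ 2)^-1.
Proof. by rewrite expr2 ler_piMr ?oneDV_ge0 ?oneDV_le1. Qed.

Let iV := @integrable_oneDsqrV R.

Let normc_cexp_line a x L : normc (cexp ((a +i* x) * (- L)%:C)) = expR (- (a * L)).
Proof. by rewrite normc_cexp ReM /= mulr0 subr0 mulrN. Qed.

Let cmeasurable_mb k a L : admissible k a ->
  cmeasurable setT (fun ta : measurableTypeR R => mbg k (a +i* ta) * cexp ((a +i* (ta : R)) * (- L)%:C)).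
Proof.
move=> adm; have [m1 _] := strip1 adm; apply: cmeasurableM => //.
by apply: cmeasurable_cexp; apply: cmeasurableM; [exact: meas_ta|exact: cmeasurable_cst].
Qed.

Lemma cintegrable_mb k a L : admissible k a ->
  cintegrable mu setT (fun ta : R => mbg k (a +i* ta) * cexp ((a +i* ta) * (- L)%:C)).
Proof.
move=> adm; have [_ [C C0 HC]] := strip1 adm.
apply: (cintegrable_le measurableT (cmeasurable_mb L adm) (integrable_mulrl (C * expR (- (a * L))) measurableT iV)).
move=> x _; rewrite normcM normc_cexp_line mulrAC ler_wpM2r ?expR_ge0//.
by apply: (le_trans (HC x)); rewrite ler_wpM2l ?(ltW C0).
Qed.

Lemma mb_integral_bound k a : admissible k a ->
  exists2 C : R, 0 < C & forall L, normc (mb_integral k a L) <= C * expR (- (a * L)).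
Proof.
move=> adm; have [_ [C C0 HC]] := strip1 adm.
pose J := \int[mu]_x (1 + x ^+ 2)^-1.
have J0 : 0 <= J by rewrite Rintegral_ge0.
exists (2 * C * (J + 1)); first by rewrite mulr_gt0 ?mulr_gt0//; lra.
move=> L.
have := @normc_cintegral_le _ _ _ mu setT _ _ measurableT (cmeasurable_mb L adm) (integrable_mulrl (C * expR (- (a * L))) measurableT iV).
move=> /(_ _)/le_trans; apply.
  move=> x _; rewrite normcM normc_cexp_line mulrAC ler_wpM2r ?expR_ge0//.
  by apply: (le_trans (HC x)); rewrite ler_wpM2l ?(ltW C0).
rewrite RintegralZl// -/J.
have -> : 2 * (C * expR (- (a * L)) * J) = (2 * C * expR (- (a * L))) * J by ring.
have -> : 2 * C * (J + 1) * expR (- (a * L)) = (2 * C * expR (- (a * L))) * (J + 1) by ring.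
by rewrite ler_wpM2l ?mulr_ge0 ?expR_ge0 ?(ltW C0)// lerDl.
Qed.

Lemma mb_integral_shift k a b L : admissible k a -> admissible k b ->
  mb_integral k a L = mb_integral k b L.
Proof.
wlog ab : a b / a <= b.
  move=> H ha hb; have [/H|/ltW/H] := leP a b; first exact.
  by move=> H2; rewrite H2.
move=> /and4P[a0 ak aD aa] /and4P[b0 bk bD ba].
have [h [C C0 HC]] := mb_gamma_strip a0 ab bk bD ba.
apply: (@contour_shift _ (fun s => mbg k s * cexp (s * (- L)%:C)) a b (C * expR (b * `|L|))) => //.
  move=> T; apply: hol_mul; first exact: h.
  apply: (holS _ (hol_cexp b (- L))) => s /= [/andP[h1 h2] _].
  by rewrite ger0_norm//; lra.
move=> s sab; rewrite normcM normc_cexp ReM /= mulr0 subr0.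
rewrite mulrAC ler_pM ?normc_ge0 ?expR_ge0//.
  by apply: (le_trans (HC s sab)); rewrite ler_wpM2l ?(ltW C0).
have /andP[h1 h2] := sab.
rewrite ler_expR (le_trans (ler_norm _))// normrM normrN ler_wpM2r//.
by rewrite ger0_norm//; lra.
Qed.

Let sqr_normc_line a x : 0 <= a <= 1 -> normc (a +i* x) ^+ 2 <= 1 + x ^+ 2.
Proof. by move=> /andP[a0 a1]; rewrite sqr_normc /= lerD2r expr_le1. Qed.

(** Supplies continuity in [L], through which [Zkernel] is seen to be measurable in x. *)
Lemma mb_integral_lipschitz k a L : admissible k a -> a <= 1 -> exists2 K : R, 0 <= K &
  forall h, `|h| <= 1 -> normc (mb_integral k a (L + h) - mb_integral k a L) <= K * `|h|.
Proof.
move=> adm a1; have [m1 [C C0 HC]] := strip1 adm; have /and4P[a0 _ _ _] := adm.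
pose J := \int[mu]_x (1 + x ^+ 2)^-1.
have J0 : 0 <= J by rewrite Rintegral_ge0.
have im L' := cintegrable_mb L' adm.
pose A := C * expR (- (a * L)) * (2 + 6 * expR 1).
have A0 : 0 <= A by rewrite !mulr_ge0 ?expR_ge0 ?addr_ge0 ?mulr_ge0 ?expR_ge0 ?(ltW C0).
exists (2 * (A * J)); first by rewrite mulr_ge0// mulr_ge0.
move=> h h1.
rewrite /mb_integral -cintegralB//.
have iB := cintegrableB measurableT (im (L + h)) (im L).
have mB : cmeasurable setT (fun ta : measurableTypeR R => mbg k (a +i* ta) * cexp ((a +i* (ta : R)) * (- (L + h))%:C) - mbg k (a +i* ta) * cexp ((a +i* (ta : R)) * (- L)%:C)).
  by have [/measurable_int/measurable_EFinP ? /measurable_int/measurable_EFinP ?] := iB.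
have := @normc_cintegral_le _ _ _ mu setT _ _ measurableT mB (integrable_mulrl (A * `|h|) measurableT iV).
move=> /(_ _)/le_trans; apply; last by rewrite RintegralZl// -/J; apply: le_of_eq; ring.
move=> x _; set s := a +i* x.
have -> : mbg k s * cexp (s * (- (L + h))%:C) - mbg k s * cexp (s * (- L)%:C) =
  mbg k s * cexp (s * (- L)%:C) * (cexp (s * (- h)%:C) - 1).
  by rewrite opprD rmorphD mulrDr cexpD; ring.
rewrite 2!normcM normc_cexp_line.
have a01 : 0 <= a <= 1 by rewrite (ltW a0).
have ns : normc s ^+ 2 <= 1 + x ^+ 2 := sqr_normc_line x a01.
have sn := normc_ge0 s.
have s1 : normc s <= 1 + x ^+ 2.
  have [h3|h3] := leP (normc s) 1; first by rewrite (le_trans h3)// lerDl sqr_ge0.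
  by apply: le_trans ns; rewrite expr2 ler_peMl// ltW.
have e1 : normc (cexp (s * (- h)%:C) - 1) <= (2 + 6 * expR 1) * (1 + x ^+ 2) * `|h|.
  have -> : cexp (s * (- h)%:C) - 1 = (cexp (s * (- h)%:C) - 1 - s * (- h)%:C) + s * (- h)%:C by ring.
  apply: (le_trans (le_normcD _ _)).
  have r := cexp_sub1x_le (s * (- h)%:C).
  rewrite normcM normc_real normrN ReM /= mulr0 subr0 in r *.
  have r2 : 6 * (normc s * `|h|) ^+ 2 * expR `|a * - h| <= 6 * ((1 + x ^+ 2) * `|h|) * expR 1.
    rewrite ler_pM ?mulr_ge0 ?sqr_ge0 ?expR_ge0//.
      rewrite ler_wpM2l// exprMn ler_pM ?sqr_ge0// expr2 ler_piMl//.
    by rewrite ler_expR normrM normrN (ger0_norm (ltW a0)) -[leRHS]mulr1 ler_pM// ltW.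
  have r3 : normc s * `|h| <= (1 + x ^+ 2) * `|h| by rewrite ler_wpM2r.
  have r4 : 0 <= (1 + x ^+ 2) * `|h| by rewrite mulr_ge0// addr_ge0 ?sqr_ge0.
  apply: (le_trans (lerD (le_trans r r2) r3)).
  by have := expR_ge0 (1 : R); nra.
have HCx := HC x.
apply: (@le_trans _ _ (C * (1 + x ^+ 2)^-1 ^+ 2 * expR (- (a * L)) * ((2 + 6 * expR 1) * (1 + x ^+ 2) * `|h|))).
  apply: ler_pM e1; rewrite ?normc_ge0// ?mulr_ge0 ?normc_ge0 ?expR_ge0//.
  apply: ler_wpM2r HCx; exact: expR_ge0.
have nz : 1 + x ^+ 2 != 0 by rewrite gt_eqF// ltr_wpDr ?sqr_ge0.
by apply: le_of_eq; rewrite /A; field.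
Qed.

(** The factor k - s is what differentiating exp ((k - s) L) in L brings down; multiplying by it
    raises k by one and so moves the first pole of Gamma (k - s) one unit to the right. *)
Lemma mb_gamma_succ k s : complex.Re s < k -> mbg (k + 1) s = (k%:C - s) * mbg k s.
Proof.
move=> sk; rewrite /mb_gamma.
have -> : (k + 1)%:C - s = (k%:C - s) + 1 by rewrite rmorphD rmorph1; ring.
by rewrite cGammaS ?ReD ?ReN/= ?subr_gt0//; ring.
Qed.

(* [expR L * mb_integral 1 c L] has derivative [expR L * mb_integral 2 c L] in L; the latter
   contour can be moved to the right of the pole s = 1, so it decays like [expR ((1 - c') * L)]. *)
Lemma mb_integral_pole c c' : admissible 1 c -> 1 < c' -> admissible 2 c' ->
  exists2 C : R, 0 < C & forall L, normc (mb_integral 1 c L) <= C * expR (- L).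
Proof.
move=> adm c'1 adm'; have /and4P[c0 c1 cD ca] := adm.
have adm2 : admissible 2 c by rewrite /mb_admissible c0 cD ca/= !andbT; lra.
have [_ [C C0 HC]] := strip1 adm.
have [B B0 HB] := mb_integral_bound adm.
have [B' B'0 HB'] := mb_integral_bound adm'.
pose J := \int[mu]_x (1 + x ^+ 2)^-1.
have J0 : 0 <= J by rewrite Rintegral_ge0.
pose E L := (expR L)%:C * mb_integral 1 c L.
have nE L : normc (E L) = expR L * normc (mb_integral 1 c L).
  by rewrite normcM normc_real gtr0_norm ?expR_gt0.
suff [M M0 HM] : exists2 M : R, 0 < M & forall L, normc (E L) <= M.
  exists M => // L; rewrite expRN -ler_pdivrMr ?invr_gt0 ?expR_gt0// invrK mulrC -nE.
  exact: HM.
have im k L : admissible k c -> cintegrable mu setT (fun ta : R => mbg k (c +i* ta) * cexp ((c +i* ta) * (- L)%:C)).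
  exact: cintegrable_mb.
(* The linear term is h e^L [mb_integral 2 c L]; evaluated on the line through c' it gains the
   factor exp (- (c' - 1) L). The quadratic term is estimated on the original line. *)
have step L h : 0 <= h <= 1 -> normc (E (L + h) - E L) <= B' * expR (- ((c' - 1) * L)) * h
   + 12 * C * J * expR ((1 - c) * L + 1) * h ^+ 2.
  move=> /andP[h0 h1].
  pose W L' (ta : R) := (expR L')%:C * (mbg 1 (c +i* ta) * cexp ((c +i* ta) * (- L')%:C)).
  have iW L' : cintegrable mu setT (W L') by apply: cintegrableZ => //; exact: im.
  pose V (ta : R) := (h * expR L)%:C * (mbg 2 (c +i* ta) * cexp ((c +i* ta) * (- L)%:C)).
  have iV2 : cintegrable mu setT V by apply: cintegrableZ => //; exact: im.
  have EW L' : E L' = cintegral mu setT (W L') by rewrite /E /mb_integral -cintegralZ//; exact: im.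
  have i1 := cintegrableB measurableT (iW (L + h)) (iW L).
  have i2 := cintegrableB measurableT i1 iV2.
  have -> : E (L + h) - E L = (h * expR L)%:C * mb_integral 2 c L + cintegral mu setT (fun ta => W (L + h) ta - W L ta - V ta).
    rewrite (cintegralB measurableT i1 iV2) (cintegralB measurableT (iW _) (iW _)) -!EW.
    have -> : cintegral mu setT V = (h * expR L)%:C * mb_integral 2 c L.
      by rewrite /V cintegralZ//; exact: im.
    by ring.
  apply: (le_trans (le_normcD _ _)); apply: lerD.
    rewrite (mb_integral_shift L adm2 adm') normcM normc_real ger0_norm ?mulr_ge0 ?expR_ge0//.
    rewrite mulrAC [leRHS]mulrC -[leLHS]mulrA ler_wpM2l//.
    rewrite mulrC; apply: (le_trans (ler_wpM2l (expR_ge0 L) (HB' L))).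
    by rewrite mulrCA -expRD; apply: le_of_eq; congr (_ * expR _); ring.
  have mB : cmeasurable setT (fun ta : measurableTypeR R => W (L + h) ta - W L ta - V ta).
    by have [/measurable_int/measurable_EFinP ? /measurable_int/measurable_EFinP ?] := i2.
  have := @normc_cintegral_le _ _ _ mu setT _ _ measurableT mB (integrable_mulrl (6 * C * expR ((1 - c) * L + 1) * h ^+ 2) measurableT iV).
  move=> /(_ _)/le_trans; apply; last by rewrite RintegralZl// -/J; apply: le_of_eq; ring.
  move=> x _; set s := c +i* x; set w := 1 - s.
  have WE L' : W L' x = mbg 1 s * cexp (w * L'%:C).
    rewrite [W L' x](_ : _ = (expR L')%:C * (mbg 1 s * cexp (s * (- L')%:C)))// -cexp_real mulrCA -cexpD; congr (_ * cexp _).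
    by rewrite /w rmorphN; ring.
  have VE : V x = mbg 1 s * cexp (w * L%:C) * (w * h%:C).
    rewrite [V x](_ : _ = (h * expR L)%:C * (mbg (1 + 1) s * cexp (s * (- L)%:C)))//.
    rewrite mb_gamma_succ// rmorph1 -/w.
    have -> : (h * expR L)%:C = h%:C * cexp L%:C by rewrite cexp_real rmorphM.
    have -> : w * L%:C = L%:C + s * (- L)%:C by rewrite /w rmorphN; ring.
    by rewrite cexpD; ring.
  have -> : W (L + h) x - W L x - V x = mbg 1 s * cexp (w * L%:C) * (cexp (w * h%:C) - 1 - w * h%:C).
    by rewrite !WE VE rmorphD mulrDr cexpD; ring.
  have Rw : complex.Re w = 1 - c by rewrite /w ReD ReN.
  have RwL : complex.Re (w * L%:C) = (1 - c) * L by rewrite ReM Rw /= mulr0 subr0.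
  rewrite 2!normcM normc_cexp RwL.
  have nw : normc w ^+ 2 <= 1 + x ^+ 2.
    rewrite sqr_normc Rw /w ImD ImN /= add0r sqrrN lerD2r expr_le1//; lra.
  have r := cexp_sub1x_le (w * h%:C).
  have Rwh : complex.Re (w * h%:C) = (1 - c) * h by rewrite ReM Rw /= mulr0 subr0.
  rewrite Rwh (normcM w) normc_real exprMn real_normK ?num_real// in r.
  have r2 : 6 * (normc w ^+ 2 * h ^+ 2) * expR `|(1 - c) * h| <= 6 * ((1 + x ^+ 2) * h ^+ 2) * expR 1.
    apply: ler_pM; rewrite ?expR_ge0//.
    - by rewrite mulr_ge0// mulr_ge0 ?sqr_ge0.
    - by rewrite ler_wpM2l// ler_wpM2r ?sqr_ge0.
    - have c1' : 0 <= 1 - c by lra.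
      rewrite ler_expR ger0_norm ?mulr_ge0// -[leRHS]mulr1 ler_pM//; lra.
  apply: (@le_trans _ _ (C * (1 + x ^+ 2)^-1 ^+ 2 * expR ((1 - c) * L) * (6 * ((1 + x ^+ 2) * h ^+ 2) * expR 1))).
    apply: ler_pM (le_trans r r2); rewrite ?normc_ge0// ?mulr_ge0 ?normc_ge0 ?expR_ge0//.
    apply: ler_wpM2r (HC x); exact: expR_ge0.
  have nz : 1 + x ^+ 2 != 0 by rewrite gt_eqF// ltr_wpDr ?sqr_ge0.
  by rewrite expRD; apply: le_of_eq; field.
(* The constant of the quadratic error grows with L, so [quasi_MVT] is applied on unit intervals,
   where it is bounded; only the linear term survives. *)
have unit_step (n : nat) y : 0 <= y <= 1 ->
    normc (E (n%:R + y) - E n%:R) <= B' * expR (- ((c' - 1) * n%:R)).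
  move=> /andP[y0 y1].
  apply: (@le_trans _ _ (B' * expR (- ((c' - 1) * n%:R)) * (n%:R + y - n%:R))); last first.
    by rewrite addrAC subrr add0r ler_piMr// mulr_ge0 ?expR_ge0 ?(ltW B'0).
  have n0 := ler0n R n.
  apply: (@quasi_MVT _ E _ (12 * C * J * expR ((1 - c) * (n%:R + 1) + 1)) 1) => //.
  - by rewrite lerDl.
  - by rewrite !mulr_ge0 ?expR_ge0 ?(ltW C0).
  move=> L h nL /andP[h0 h1] Lh.
  apply: (le_trans (step L h _)); first by rewrite (ltW h0).
  apply: lerD.
    rewrite ler_wpM2r ?(ltW h0)// ler_wpM2l ?(ltW B'0)// ler_expR lerN2 ler_wpM2l//; lra.
  rewrite ler_wpM2r ?sqr_ge0// ler_wpM2l ?mulr_ge0 ?(ltW C0)//.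
  rewrite ler_expR lerD2r ler_wpM2l//; lra.
pose r := expR (- (c' - 1)).
have r0 : 0 < r by exact: expR_gt0.
have r1 : r < 1 by rewrite /r -[ltRHS]expR0 ltr_expR; lra.
have rn (n : nat) : expR (- ((c' - 1) * n%:R)) = r ^+ n.
  by rewrite -expRM_natl; congr expR; ring.
have r1' : 0 < 1 - r by lra.
have E0 : normc (E 0) <= B.
  by rewrite nE expR0 mul1r; apply: (le_trans (HB 0)); rewrite mulr0 oppr0 expR0 mulr1.
(* The unit increments are summed as a geometric series of ratio [r]. *)
have En (n : nat) : normc (E n%:R) <= B + B' * (1 - r ^+ n) / (1 - r).
  elim: n => [|n IH]; first by rewrite expr0 subrr mulr0 mul0r addr0.
  have := unit_step n 1 (ltac:(by rewrite ler01 lexx)); rewrite natr1 rn => u.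
  have -> : E n.+1%:R = E n%:R + (E n.+1%:R - E n%:R) by ring.
  apply: (le_trans (le_normcD _ _)); apply: (le_trans (lerD IH u)).
  rewrite -addrA lerD2l exprS; apply: le_of_eq; field; rewrite gt_eqF//.
exists (B + B' / (1 - r) + B') => [|L].
  by rewrite !addr_gt0// divr_gt0.
have Bp : 0 <= B' / (1 - r) by rewrite divr_ge0 ?ltW.
(* For negative L the plain bound on the line through c suffices, since (1 - c) L <= 0. *)
have [L0|L0] := leP 0 L; last first.
  rewrite nE; apply: (le_trans (ler_wpM2l (expR_ge0 L) (HB L))).
  rewrite mulrCA -expRD; apply: (@le_trans _ _ (B * 1)); last lra.
  rewrite ler_wpM2l ?(ltW B0)// -[leRHS]expR0 ler_expR.
  have : (1 - c) * L <= 0 by rewrite mulr_ge0_le0//; lra.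
  lra.
pose n := Num.trunc L.
have /andP[nL Ln] : n%:R <= L < n.+1%:R by exact: truncn_itv.
rewrite -natr1 in Ln.
have := unit_step n (L - n%:R) (ltac:(by apply/andP; split; lra)).
rewrite subrKC rn => u.
have -> : E L = E n%:R + (E L - E n%:R) by ring.
apply: (le_trans (le_normcD _ _)); apply: (le_trans (lerD (En n) u)).
apply: lerD; last first.
  by rewrite ler_piMr ?(ltW B'0)// exprn_ile1// ltW.
rewrite lerD2l ler_wpM2r ?invr_ge0 ?(ltW r1')// ler_piMr ?(ltW B'0)//.
by rewrite lerBlDr lerDl exprn_ge0// ltW.
Qed.

End mellin_barnes_integrand.

(** * Radial integrals *)

Section euclid_measure.
Context {R : realType}.
Local Open Scope ereal_scope.

Lemma measurable_esub {d} : measurable_fun setT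
  (fun p : euclid R d * euclid R d => esub p.1 p.2).
Proof.
apply/measurable_fun_tnthP => i.
rewrite (_ : _ \o _ = fun p : euclid R d * euclid R d => (tnth p.1 i - tnth p.2 i)%R).
  by apply: measurable_funB; apply: (measurableT_comp (@measurable_tnth _ _ _ i)).
by apply/funext => p /=; rewrite tnth_mktuple.
Qed.

Lemma measurable_enorm {d} : measurable_fun setT (@enorm R d).
Proof.
have ms : measurable_fun setT (Num.sqrt : R -> R).
  by apply: continuous_measurable_fun; exact: sqrt_continuous.
apply: (measurableT_comp ms).
by apply: measurable_sum => i; apply: measurable_funX; exact: measurable_tnth.
Qed.

Lemma enorm_ge0 {d} (x : euclid R d) : (0 <= enorm x)%R.
Proof. exact: sqrtr_ge0. Qed.

Lemma enorm_esubC {d} (x y : euclid R d) : enorm (esub x y) = enorm (esub y x).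
Proof.
congr Num.sqrt; apply: eq_bigr => i _; rewrite !tnth_mktuple.
by rewrite -sqrrN opprB.
Qed.

Lemma ge0_integral_lebesgue_step {n} (m : {sigma_finite_measure set (euclid R n) -> \bar R})
    (f : euclid R n.+1 -> \bar R) : measurable_fun setT f -> (forall x, 0 <= f x) ->
  \int[lebesgue_step m]_x f x =
  \int[lebesgue_measure]_a \int[m]_b f [tuple of (a : measurableTypeR R) :: b].
Proof.
move=> mf f0.
have mc : measurable_fun setT (fun p : measurableTypeR R * euclid R n => [tuple of p.1 :: p.2] : euclid R n.+1).
  exact: measurable_cons.
transitivity (\int[pushforward (lebesgue_measure \x m) (fun p : measurableTypeR R * euclid R n => [tuple of p.1 :: p.2] : euclid R n.+1)]_x f x).
  exact: eq_measure_integral.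
rewrite (ge0_integral_pushforward mc)//.
rewrite preimage_setT fubini_tonelli1//.
  exact: measurableT_comp.
by move=> p; exact: f0.
Qed.

(** By induction on the dimension: Tonelli splits off the first coordinate, which is translated by
    the one-dimensional lemma, the others by the induction hypothesis. *)
Lemma ge0_integral_esub {d} (f : euclid R d -> \bar R) (y : euclid R d) :
  measurable_fun setT f -> (forall x, 0 <= f x) ->
  \int[lebesgue_measure_euclid d]_x f (esub x y) = \int[lebesgue_measure_euclid d]_x f x.
Proof.
elim: d f y => [|n IH] f y mf f0.
  by apply: eq_integral => x _; congr f; apply: eq_from_tnth => -[].
have msub (z : euclid R n.+1) : measurable_fun setT (fun x : euclid R n.+1 => esub x z).
  apply/measurable_fun_tnthP => i.
  rewrite (_ : _ \o _ = fun p : euclid R n.+1 => (tnth p i - tnth z i)%R).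
    by apply: measurable_funB => //; exact: measurable_tnth.
  by apply/funext => p /=; rewrite tnth_mktuple.
rewrite /= !ge0_integral_lebesgue_step//; last first.
  exact: measurableT_comp mf (msub y).
have mc : measurable_fun setT (fun p : measurableTypeR R * euclid R n => [tuple of p.1 :: p.2] : euclid R n.+1).
  exact: measurable_cons.
have mfc := measurableT_comp mf mc.
have esub_cons (a : R) (b : euclid R n) :
    esub [tuple of a :: b] y = [tuple of (a - thead y)%R :: esub b [tuple of behead y]].
  apply: eq_from_tnth => i; rewrite tnth_mktuple.
  case: (unliftP ord0 i) => [j ->|->]; last by rewrite /thead !tnth0.
  rewrite !tnthS tnth_mktuple; congr (_ - _)%R.
  by rewrite tnth_behead; congr tnth; apply: val_inj; rewrite /= inordK// ltnS.
under eq_integral => a _.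
  under eq_integral => b _ do rewrite esub_cons.
  rewrite (IH (fun b => f [tuple of (a - thead y)%R :: b])); last 2 first.
  - exact: (measurableT_comp mfc (measurable_pair1 (a - thead y : measurableTypeR R)%R)).
  - by [].
  over.
pose g (a : measurableTypeR R) := \int[lebesgue_measure_euclid n]_b f [tuple of a :: b].
have mg : measurable_fun setT g.
  apply: (@measurable_fun_fubini_tonelli_F _ _ _ _ _ (lebesgue_measure_euclid n) _ mfc).
  by move=> p; exact: f0.
have g0 a : 0 <= g a by apply: integral_ge0.
rewrite -/(g) (ge0_integral_shift (- thead y) measurableT mg) => [|x _]; last exact: g0.
by apply: eq_integral.
Qed.

(** The ball lies in the cube of side 2 r. Later estimates use only the scaling r^d. *)
Lemma enorm_ball_le {d} (r : R) : (0 < r)%R ->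
  lebesgue_measure_euclid d [set x : euclid R d | (enorm x <= r)%R] <= ((2 * r) ^+ d)%:E.
Proof.
move=> r0.
pose A (i : 'I_d) : set (measurableTypeR R) := `[(- r)%R, r]%classic.
have mA i : measurable (A i) by exact: measurable_itv.
have AE i : lebesgue_measure (A i) = (2 * r)%:E.
  by rewrite lebesgue_measure_itv/= lte_fin gtrN// -EFinB; congr EFin; ring.
have -> : ((2 * r) ^+ d)%:E = lebesgue_measure_euclid d [set x : euclid R d | forall i, A i (tnth x i)].
  rewrite lebesgue_measure_euclid_box// (eq_bigr (fun=> (2 * r)%:E)) => [|i _]; last exact: AE.
  by rewrite prodEFin prodr_const card_ord.
apply: le_measure; rewrite ?inE.
- rewrite -[X in measurable X]setTI (_ : [set x | _] = enorm @^-1` `]-oo, r]%classic).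
    by apply: measurable_enorm => //; exact: measurable_itv.
  by apply/seteqP; split=> x; rewrite /= in_itv.
- rewrite (_ : [set x | _] = \bigcap_(i in [set: 'I_d]) ((@tnth d _ ^~ i) @^-1` A i)); last first.
    by apply/seteqP; split=> x xA i; [move=> _|]; exact: xA.
  apply: fin_bigcap_measurable => [|i _]; first exact: finite_finset.
  by rewrite -[X in measurable X]setTI; apply: measurable_tnth.
- move=> x /= xr i; rewrite /A /= in_itv/= -ler_norml.
  apply: le_trans xr; rewrite -sqrtr_sqr ler_sqrt ?sumr_ge0// => [|j _]; last exact: sqr_ge0.
  by rewrite (bigD1 i)//= lerDl sumr_ge0// => j _; exact: sqr_ge0.
Qed.

End euclid_measure.

(** * Powers of |x| integrated over geometric shells *)

Section radial_integrals.
Context {R : realType} {d : nat}.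
Local Notation mu := (lebesgue_measure_euclid d).
Local Notation E := (euclid R d).

Lemma measurable_ball_enorm (r : R) : measurable [set x : E | enorm x <= r].
Proof.
rewrite -[X in measurable X]setTI (_ : [set x | _] = enorm @^-1` `]-oo, r]%classic).
  by apply: measurable_enorm => //; exact: measurable_itv.
by apply/seteqP; split=> x; rewrite /= in_itv.
Qed.

Lemma measurable_powR_enorm (p : R) : measurable_fun setT (fun x : E => enorm x `^ p).
Proof. exact: (measurableT_comp (@measurable_powR R p) measurable_enorm). Qed.

(* Cut S into the shells l q^k < |x| <= 2 l q^k. *)
Lemma radial_integral_le (g l q : R) (S : set E) : 0 < g -> 0 < l -> 0 < q ->
  q `^ (d%:R - g) < 1 -> measurable S ->
  (forall x, S x -> exists k : nat, l * q ^+ k < enorm x <= 2 * (l * q ^+ k)) ->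
  (\int[mu]_(x in S) (enorm x `^ (- g))%:E <=
    (4 ^+ d * l `^ (d%:R - g) / (1 - q `^ (d%:R - g)))%:E)%E.
Proof.
move=> g0 l0 q0 r1 mS shell.
set r := q `^ (d%:R - g) in r1 *.
have r0 : 0 <= r by exact: powR_ge0.
pose lk (k : nat) := l * q ^+ k.
have lk0 k : 0 < lk k by rewrite mulr_gt0// exprn_gt0.
pose B (k : nat) : set E := [set x | enorm x <= 2 * lk k].
have mB k : measurable (B k) by exact: measurable_ball_enorm.
(* On the k-th shell |x|^(- g) is at most its value at the inner radius; the shell is enlarged to
   the full ball, whose volume has the same order. *)
pose f (k : nat) (x : E) : \bar R := (lk k `^ (- g) * \1_(B k) x)%:E.
have f0 k x : (0 <= f k x)%E by rewrite lee_fin mulr_ge0 ?powR_ge0.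
have mf k : measurable_fun setT (f k).
  by apply/measurable_EFinP; apply: measurable_funM => //; exact: measurable_indic.
have mfS k : measurable_fun S (f k) by exact: measurable_funTS.
apply: (@le_trans _ _ (\int[mu]_(x in S) \sum_(k <oo) f k x)%E).
  apply: ge0_le_integral => //.
  - by move=> x _; rewrite lee_fin powR_ge0.
  - by apply/measurable_EFinP; apply: measurable_funTS; exact: measurable_powR_enorm.
  - apply: (@ge0_emeasurable_sum _ _ _ _ f xpredT) => //.
  - move=> x /shell[k /andP[h1 h2]].
    apply: (@le_trans _ _ (f k x)).
      rewrite /f indicE mem_set ?mulr1; last exact: h2.
      rewrite lee_fin !powRN lef_pV2 ?posrE ?powR_gt0//; last exact: lt_trans (lk0 k) h1.
      by apply: ge0_ler_powR; rewrite ?nnegrE ?(ltW g0) ?(ltW (lk0 k)) ?enorm_ge0// ltW.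
    apply: le_trans (nneseries_lim_ge k.+1 _) => //.
    rewrite big_nat_recr//= leeDr//.
    by apply: sume_ge0 => i _; exact: f0.
rewrite integral_nneseries//.
(* The ball of radius 2 l q^k has volume at most (4 l q^k)^d, so the k-th term is c times the k-th
   power of q^(d - g). Ratio below 1 covers both q < 1 with g < d and q > 1 with g > d. *)
pose c := 4 ^+ d * l `^ (d%:R - g).
have c0 : 0 <= c by rewrite mulr_ge0 ?exprn_ge0 ?powR_ge0.
apply: lime_le; first by apply: is_cvg_nneseries => k _ _; exact: integral_ge0.
apply: nearW => n.
apply: (@le_trans _ _ (\sum_(0 <= k < n) (c * r ^+ k)%:E)%E).
  apply: lee_sum => k _.
  have -> : (\int[mu]_(x in S) f k x = (lk k `^ (- g))%:E * \int[mu]_(x in S) (\1_(B k) x)%:E)%E.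
    transitivity (\int[mu]_(x in S) ((lk k `^ (- g))%:E * (\1_(B k) x)%:E))%E.
      by apply: eq_integral => x _; rewrite /f EFinM.
    apply: ge0_integralZl_EFin => //; last exact: powR_ge0.
    by apply/measurable_EFinP/measurable_funTS/measurable_indic.
  rewrite integral_indic//.
  apply: (@le_trans _ _ ((lk k `^ (- g))%:E * ((2 * (2 * lk k)) ^+ d)%:E)%E).
    rewrite lee_wpmul2l ?lee_fin ?powR_ge0//.
    apply: (@le_trans _ _ (mu (B k))).
      apply: le_measure; [rewrite inE; exact: measurableI|rewrite inE; exact: mB|].
      by move=> x [].
    by apply: enorm_ball_le; rewrite mulr_gt0.
  rewrite -EFinM lee_fin /c /r.
  have -> : 2 * (2 * lk k) = 4 * lk k by ring.
  rewrite exprMn -(powR_mulrn d (ltW (lk0 k))) mulrCA -powRD; last first.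
    by rewrite (gt_eqF (lk0 k)) implybT.
  rewrite [- g + _]addrC /lk powRM ?exprn_ge0 ?(ltW l0) ?(ltW q0)//.
  by rewrite -(powR_mulrn k (ltW q0)) -(powR_mulrn k (powR_ge0 _ _)) -!powRrM [k%:R * _]mulrC mulrA.
rewrite sumEFin lee_fin -mulr_sumr -/c ler_wpM2l//.
have r1' : 0 < 1 - r by lra.
rewrite -[leRHS]mul1r ler_pdivlMr// big_mkord.
have -> : (\sum_(i < n) r ^+ i) * (1 - r) = 1 - r ^+ n.
  by rewrite -[RHS]opprB subrX1; ring.
by rewrite lerBlDr lerDl exprn_ge0.
Qed.

End radial_integrals.

Section radial_regions.
Context {R : realType} {d : nat}.
Local Notation mu := (lebesgue_measure_euclid d).
Local Notation E := (euclid R d).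

Lemma lt_expr2 (x : R) : exists n, x < 2 ^+ n.
Proof.
exists (Num.trunc x).+1; apply: (lt_le_trans (truncnS_gt x)).
by rewrite -natrX ler_nat ltnW// ltn_expl.
Qed.

Lemma radial_inner (g : R) : 0 < g -> g < d%:R -> exists2 C : R, 0 < C & forall rho : R, 0 < rho ->
  (\int[mu]_(x in [set x : E | (0 < enorm x <= rho)%R]) (enorm x `^ (- g))%:E <=
    (C * rho `^ (d%:R - g))%:E)%E.
Proof.
(* Dyadic shells shrink towards the origin. Starting from l = rho / 2 makes the outermost shell rho
   / 2 < |x| <= rho. *)
move=> g0 gd; pose q : R := 2^-1; have q0 : 0 < q by rewrite invr_gt0.
have q1 : q `^ (d%:R - g) < 1.
  rewrite /powR gt_eqF// -[ltRHS]expR0 ltr_expR pmulr_rlt0 ?subr_gt0//.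
  by rewrite ln_lt0// q0 invf_lt1// ltr1n.
exists (4 ^+ d * q `^ (d%:R - g) / (1 - q `^ (d%:R - g))).
  by rewrite divr_gt0 ?subr_gt0// mulr_gt0 ?exprn_gt0 ?powR_gt0.
move=> rho rho0.
have l0 : 0 < rho * q by rewrite mulr_gt0.
have mS : measurable [set x : E | 0 < enorm x <= rho].
  rewrite (_ : [set x | _] = [set x : E | enorm x <= rho] `\` [set x : E | enorm x <= 0]).
    by apply: measurableD; exact: measurable_ball_enorm.
  apply/seteqP; split=> x /=; first by move=> /andP[h1 h2]; split=> //; apply/negP; rewrite -ltNge.
  by move=> [h1 /negP]; rewrite -ltNge h1 => ->.
have := @radial_integral_le R d g (rho * q) q _ g0 l0 q0 q1 mS.
have -> : 4 ^+ d * (rho * q) `^ (d%:R - g) / (1 - q `^ (d%:R - g)) =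
   4 ^+ d * q `^ (d%:R - g) / (1 - q `^ (d%:R - g)) * rho `^ (d%:R - g).
  by rewrite powRM ?(ltW rho0) ?(ltW q0)//; ring.
apply=> x /= /andP[x0 xr].
have ex : exists k, rho * q * q ^+ k < enorm x.
  have [n hn] := lt_expr2 (rho * q / enorm x); exists n.
  by rewrite /q exprVn ltr_pdivrMr ?exprn_gt0// [ltRHS]mulrC -ltr_pdivrMr.
(* The least k meeting the lower bound also meets the upper one: otherwise k - 1 would do, and for k
   = 0 the upper bound is rho itself. *)
exists (ex_minn ex); case: ex_minnP => k hk kmin; rewrite hk /=.
have -> : 2 * (rho * q * q ^+ k) = rho * q ^+ k by rewrite /q; field.
case: k hk kmin => [|k] hk kmin; first by rewrite expr0 mulr1.
rewrite leNgt; apply/negP => h.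
by have := kmin k; rewrite -mulrA -exprS h => /(_ isT); rewrite ltnn.
Qed.

Lemma radial_outer (g : R) : d%:R < g -> exists2 C : R, 0 < C & forall rho : R, 0 < rho ->
  (\int[mu]_(x in [set x : E | (rho < enorm x)%R]) (enorm x `^ (- g))%:E <=
    (C * rho `^ (d%:R - g))%:E)%E.
Proof.
move=> dg; have g0 : 0 < g by apply: le_lt_trans dg.
have q1 : 2 `^ (d%:R - g) < 1 :> R.
  rewrite /powR gt_eqF// -[ltRHS]expR0 ltr_expR pmulr_llt0 ?subr_lt0//.
  by rewrite ln_gt0 ?ltr1n.
exists (4 ^+ d / (1 - 2 `^ (d%:R - g))).
  by rewrite divr_gt0 ?subr_gt0// exprn_gt0.
move=> rho rho0.
have mS : measurable [set x : E | rho < enorm x].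
  rewrite (_ : [set x | _] = ~` [set x : E | enorm x <= rho]).
    by apply: measurableC; exact: measurable_ball_enorm.
  by apply/seteqP; split=> x /=; rewrite ltNge => /negP.
have := @radial_integral_le R d g rho 2 _ g0 rho0 (ltr0Sn R 1) q1 mS.
rewrite mulrAC; apply=> x /= xr.
have ex : exists k, enorm x <= 2 * (rho * 2 ^+ k).
  have [n hn] := lt_expr2 (enorm x / rho); exists n.
  move: hn; rewrite ltr_pdivrMr// => /ltW /le_trans; apply.
  by rewrite mulrC ler_peMl// ?mulr_ge0 ?exprn_ge0 ?(ltW rho0)// ler1n.
exists (ex_minn ex); case: ex_minnP => k hk kmin; rewrite hk andbT.
case: k hk kmin => [|k] hk kmin; first by rewrite expr0 mulr1.
rewrite ltNge; apply/negP => h.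
by have := kmin k; rewrite mulrCA -exprS h => /(_ isT); rewrite ltnn.
Qed.

End radial_regions.

(** * Convolution estimates *)

Section convolution.
Context {R : realType} {d : nat}.
Local Notation mu := (lebesgue_measure_euclid d).
Local Notation E := (euclid R d).
Implicit Types (K u v w : E -> R).
Local Open Scope ereal_scope.

(** With |u| and values in the extended reals, every estimate for a nonnegative K is of Tonelli type
    and requires no prior finiteness. *)
Definition conv K u (x : E) : \bar R := \int[mu]_y (K (esub x y) * `|u y|)%:E.

Lemma measurable_esubr (x : E) : measurable_fun setT (fun y : E => esub x y).
Proof. exact: (measurableT_comp measurable_esub (measurable_pair1 x)). Qed.

Lemma measurable_esubl (y : E) : measurable_fun setT (fun x : E => esub x y).
Proof. exact: (measurableT_comp measurable_esub (measurable_pair2 y)). Qed.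

Lemma measurable_conv2 K v : measurable_fun setT K -> measurable_fun setT v ->
  measurable_fun setT (fun p : E * E => (K (esub p.1 p.2) * v p.2)%:E).
Proof.
move=> mK mv; apply/measurable_EFinP; apply: measurable_funM.
  exact: (measurableT_comp mK measurable_esub).
exact: (measurableT_comp mv measurable_snd).
Qed.

Lemma conv_ge0 K u x : (forall x, (0 <= K x)%R) -> 0 <= conv K u x.
Proof. by move=> K0; apply: integral_ge0 => y _; rewrite lee_fin mulr_ge0. Qed.

Lemma measurable_conv K u : measurable_fun setT K -> measurable_fun setT u ->
  (forall x, (0 <= K x)%R) -> measurable_fun setT (conv K u).
Proof.
move=> mK mu_ K0.
have mu' : measurable_fun setT (fun y => `|u y|%R) by exact: measurableT_comp.
apply: (@measurable_fun_fubini_tonelli_F _ _ _ _ _ mu _ (measurable_conv2 mK mu')).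
by move=> p; rewrite lee_fin mulr_ge0.
Qed.

Lemma integral_conv K v : measurable_fun setT K -> measurable_fun setT v ->
  (forall x, (0 <= K x)%R) -> (forall x, (0 <= v x)%R) ->
  \int[mu]_x \int[mu]_y (K (esub x y) * v y)%:E = \int[mu]_x (K x)%:E * \int[mu]_y (v y)%:E.
Proof.
move=> mK mv K0 v0.
have m2 := measurable_conv2 mK mv.
have m20 p : 0 <= (K (esub p.1 p.2) * v p.2)%:E by rewrite lee_fin mulr_ge0.
have mKE : measurable_fun setT (EFin \o K) by exact/measurable_EFinP.
have mvE : measurable_fun setT (EFin \o v) by exact/measurable_EFinP.
rewrite (fubini_tonelli _ m2 m20) /fubini_G /=.
transitivity (\int[mu]_y (\int[mu]_x (K x)%:E * (v y)%:E)).
  apply: eq_integral => y _.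
  under eq_integral do rewrite EFinM muleC.
  rewrite ge0_integralZl_EFin//; last 2 first.
  - by move=> x _; rewrite lee_fin.
  - exact: (measurableT_comp mKE (measurable_esubl y)).
  rewrite muleC; congr (_ * _).
  by apply: (@ge0_integral_esub _ _ (EFin \o K)) => // x; rewrite /= lee_fin.
rewrite ge0_integralZl//.
- by move=> x _; rewrite lee_fin.
- by apply: integral_ge0 => x _; rewrite lee_fin.
Qed.

Lemma poweR12M (x : \bar R) : 0 <= x -> x `^ 2^-1 * x `^ 2^-1 = x.
Proof.
move: x => [r| |]//; last by rewrite poweRyr ?invr_eq0// mulyy.
by rewrite lee_fin poweR_EFin -EFinM => r0; rewrite powR12_sqrt// -expr2 sqr_sqrtr.
Qed.

(** Hölder's inequality with exponents 2 and 2 for sqrt w and v sqrt w. The choice of weight gives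
    the two Young inequalities below: w = K (x - y) leads to L^1 * L^2, w = |u| to L^2 * L^1. *)
Lemma weighted_Cauchy_Schwarz w v : measurable_fun setT w -> measurable_fun setT v ->
  (forall x, (0 <= w x)%R) -> (forall x, (0 <= v x)%R) ->
  \int[mu]_x (w x * v x)%:E * \int[mu]_x (w x * v x)%:E <=
  \int[mu]_x (w x)%:E * \int[mu]_x (w x * v x ^+ 2)%:E.
Proof.
move=> mw mv w0 v0.
have ms : measurable_fun setT (Num.sqrt : R -> R).
  by apply: continuous_measurable_fun; exact: sqrt_continuous.
have mf : measurable_fun setT (fun x => Num.sqrt (w x)) by exact: measurableT_comp ms mw.
have mg : measurable_fun setT (fun x => Num.sqrt (w x) * v x)%R by exact: measurable_funM.
have half : (2^-1 + 2^-1 = 1 :> R)%R by field.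
have := hoelder mu mf mg (ltr0Sn R 1) (ltr0Sn R 1) half.
rewrite Lnorm1 (unlock _) /=.
set I := (X in X <= _); set A := (X in _ <= X * _ -> _); set B := (X in _ <= _ * X -> _).
have -> : I = \int[mu]_x (w x * v x)%:E.
  by apply: eq_integral => x _; rewrite /= mulrA -expr2 sqr_sqrtr// ger0_norm// mulr_ge0.
have -> : A = (\int[mu]_x (w x)%:E) `^ 2^-1.
  congr (_ `^ _); apply: eq_integral => x _.
  by rewrite /= -[2%R]/(2%:R) powR_mulrn// real_normK ?num_real// sqr_sqrtr.
have -> : B = (\int[mu]_x (w x * v x ^+ 2)%:E) `^ 2^-1.
  congr (_ `^ _); apply: eq_integral => x _.
  by rewrite /= -[2%R]/(2%:R) powR_mulrn// real_normK ?num_real// exprMn sqr_sqrtr.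
set J := \int[mu]_x _; set P := \int[mu]_x _; set Q := \int[mu]_x _ => h.
have J0 : 0 <= J by apply: integral_ge0 => x _; rewrite lee_fin mulr_ge0.
have P0 : 0 <= P by apply: integral_ge0 => x _; rewrite lee_fin.
have Q0 : 0 <= Q by apply: integral_ge0 => x _; rewrite lee_fin mulr_ge0 ?sqr_ge0.
apply: (le_trans (lee_pmul J0 J0 h h)).
by rewrite muleACA !poweR12M.
Qed.

(** Young's inequality for an integrable kernel, squared. Evenness of K identifies the total weight
    in y with the integral of K. *)
Lemma conv_sqr_le12 K u : measurable_fun setT K -> measurable_fun setT u ->
  (forall x, (0 <= K x)%R) -> (forall x y, K (esub x y) = K (esub y x)) ->
  \int[mu]_x (conv K u x * conv K u x) <=
    \int[mu]_x (K x)%:E * (\int[mu]_x (K x)%:E * \int[mu]_y (u y ^+ 2)%:E).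
Proof.
move=> mK mu_ K0 Keven.
have mu' : measurable_fun setT (fun y => `|u y|%R) by exact: measurableT_comp.
have mu2 : measurable_fun setT (fun y => (u y ^+ 2)%R) by exact: measurable_funX.
have mc := measurable_conv mK mu_ K0.
have m2 := measurable_conv2 mK mu2.
have m20 p : 0 <= (K (esub p.1 p.2) * u p.2 ^+ 2)%:E by rewrite lee_fin mulr_ge0 ?sqr_ge0.
rewrite -integral_conv//; last by move=> x; exact: sqr_ge0.
have mF : measurable_fun setT (fun x => \int[mu]_y (K (esub x y) * u y ^+ 2)%:E) :=
  @measurable_fun_fubini_tonelli_F _ _ _ _ _ mu _ m2 m20.
have F0 x : setT x -> 0 <= \int[mu]_y (K (esub x y) * u y ^+ 2)%:E.
  by move=> _; apply: integral_ge0 => y _; exact: (m20 (x, y)).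
have c0 : 0 <= \int[mu]_x (K x)%:E by apply: integral_ge0 => x _; rewrite lee_fin.
rewrite -(ge0_integralZl mu measurableT mF F0 c0).
apply: ge0_le_integral => //.
- by move=> x _; rewrite mule_ge0 ?conv_ge0.
- exact: emeasurable_funM.
- by apply: measurable_funeM; exact: (@measurable_fun_fubini_tonelli_F _ _ _ _ _ mu _ m2 m20).
move=> x _.
have mKx : measurable_fun setT (fun y => K (esub x y)) by exact: measurableT_comp mK (measurable_esubr x).
have := @weighted_Cauchy_Schwarz (fun y => K (esub x y)) (fun y => `|u y|%R) mKx mu' (fun y => K0 _) (fun y => normr_ge0 _).
rewrite -/(conv K u x) => /le_trans; apply.
have -> : \int[mu]_y (K (esub x y))%:E = \int[mu]_y (K y)%:E.
  under eq_integral do rewrite Keven.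
  by apply: (@ge0_integral_esub _ _ (EFin \o K)) => [|y]; [exact/measurable_EFinP|rewrite /= lee_fin].
suff -> : \int[mu]_y (K (esub x y) * `|u y| ^+ 2)%:E = \int[mu]_y (K (esub x y) * u y ^+ 2)%:E by [].
by apply: eq_integral => y _; rewrite real_normK// num_real.
Qed.

(** Young's inequality for a square integrable kernel and integrable data, squared. The weight is
    now |u|. *)
Lemma conv_sqr_le21 K u : measurable_fun setT K -> measurable_fun setT u ->
  (forall x, (0 <= K x)%R) ->
  \int[mu]_x (conv K u x * conv K u x) <=
    \int[mu]_y `|u y|%:E * (\int[mu]_x (K x ^+ 2)%:E * \int[mu]_y `|u y|%:E).
Proof.
move=> mK mu_ K0.
have mu' : measurable_fun setT (fun y => `|u y|%R) by exact: measurableT_comp.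
have mK2 : measurable_fun setT (fun y => (K y ^+ 2)%R) by exact: measurable_funX.
have mc := measurable_conv mK mu_ K0.
have m2 := measurable_conv2 mK2 mu'.
have m20 p : 0 <= (K (esub p.1 p.2) ^+ 2 * `|u p.2|)%:E by rewrite lee_fin mulr_ge0 ?sqr_ge0.
rewrite -integral_conv//; last by move=> x; exact: sqr_ge0.
have mF : measurable_fun setT (fun x => \int[mu]_y (K (esub x y) ^+ 2 * `|u y|)%:E) :=
  @measurable_fun_fubini_tonelli_F _ _ _ _ _ mu _ m2 m20.
have F0 x : setT x -> 0 <= \int[mu]_y (K (esub x y) ^+ 2 * `|u y|)%:E.
  by move=> _; apply: integral_ge0 => y _; exact: (m20 (x, y)).
have c0 : 0 <= \int[mu]_x (`|u x|)%:E by apply: integral_ge0 => x _; rewrite lee_fin.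
rewrite -(ge0_integralZl mu measurableT mF F0 c0).
apply: ge0_le_integral => //.
- by move=> x _; rewrite mule_ge0 ?conv_ge0.
- exact: emeasurable_funM.
- by apply: measurable_funeM; exact: (@measurable_fun_fubini_tonelli_F _ _ _ _ _ mu _ m2 m20).
move=> x _.
have mKx : measurable_fun setT (fun y => K (esub x y)) by exact: measurableT_comp mK (measurable_esubr x).
have := @weighted_Cauchy_Schwarz (fun y => `|u y|%R) (fun y => K (esub x y)) mu' mKx (fun y => normr_ge0 _) (fun y => K0 _).
have -> : \int[mu]_y (`|u y| * K (esub x y))%:E = conv K u x.
  by apply: eq_integral => y _; rewrite mulrC.
suff -> : \int[mu]_y (`|u y| * K (esub x y) ^+ 2)%:E = \int[mu]_y (K (esub x y) ^+ 2 * `|u y|)%:E by [].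
by apply: eq_integral => y _; rewrite mulrC.
Qed.

Lemma conv_le K K' u x : (forall x, (0 <= K x)%R) -> (forall x, (K x <= K' x)%R) ->
  measurable_fun setT K -> measurable_fun setT K' -> measurable_fun setT u ->
  conv K u x <= conv K' u x.
Proof.
move=> K0 KK mK mK' mu_; apply: ge0_le_integral => //.
- by move=> y _; rewrite lee_fin mulr_ge0.
- apply/measurable_EFinP; apply: measurable_funM; last exact: measurableT_comp.
  exact: measurableT_comp mK (measurable_esubr x).
- apply/measurable_EFinP; apply: measurable_funM; last exact: measurableT_comp.
  exact: measurableT_comp mK' (measurable_esubr x).
- by move=> y _; rewrite lee_fin ler_wpM2r.
Qed.

Lemma convD K K' u x : (forall x, (0 <= K x)%R) -> (forall x, (0 <= K' x)%R) ->
  measurable_fun setT K -> measurable_fun setT K' -> measurable_fun setT u ->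
  conv (fun x => K x + K' x)%R u x = conv K u x + conv K' u x.
Proof.
move=> K0 KK mK mK' mu_; rewrite /conv -ge0_integralD//.
- by apply: eq_integral => y _; rewrite mulrDl EFinD.
- by move=> y _; rewrite lee_fin mulr_ge0.
- apply/measurable_EFinP; apply: measurable_funM; last exact: measurableT_comp.
  exact: measurableT_comp mK (measurable_esubr x).
- by move=> y _; rewrite lee_fin mulr_ge0.
- apply/measurable_EFinP; apply: measurable_funM; last exact: measurableT_comp.
  exact: measurableT_comp mK' (measurable_esubr x).
Qed.

End convolution.

(** * Inner and outer parts of a kernel *)

Section truncation.
Context {R : realType} {d : nat}.
Local Notation mu := (lebesgue_measure_euclid d).
Local Notation E := (euclid R d).
Implicit Types (f K u : E -> R) (rho A g : R).

Definition inside rho f (x : E) : R := if enorm x <= rho then f x else 0.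
Definition outside rho f (x : E) : R := if enorm x <= rho then 0 else f x.

Lemma inside_outside rho f x : inside rho f x + outside rho f x = f x.
Proof. by rewrite /inside /outside; case: ifP; rewrite ?addr0 ?add0r. Qed.

Lemma inside_ge0 rho f x : 0 <= f x -> 0 <= inside rho f x.
Proof. by rewrite /inside; case: ifP. Qed.

Lemma outside_ge0 rho f x : 0 <= f x -> 0 <= outside rho f x.
Proof. by rewrite /outside; case: ifP. Qed.

Lemma measurable_inside rho f : measurable_fun setT f -> measurable_fun setT (inside rho f).
Proof.
move=> mf; apply: measurable_fun_ifT => //.
by apply: measurable_fun_ler; [exact: measurable_enorm|exact: measurable_cst].
Qed.

Lemma measurable_outside rho f : measurable_fun setT f -> measurable_fun setT (outside rho f).
Proof.
move=> mf; apply: measurable_fun_ifT => //.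
by apply: measurable_fun_ler; [exact: measurable_enorm|exact: measurable_cst].
Qed.

Lemma integral_supported_le (S : set E) f (h : E -> R) A : measurable S ->
  measurable_fun setT f -> measurable_fun setT h -> 0 <= A ->
  (forall x, 0 <= f x) -> (forall x, 0 <= h x) -> (forall x, ~ S x -> f x = 0) ->
  (forall x, S x -> f x <= A * h x) ->
  (\int[mu]_x (f x)%:E <= A%:E * \int[mu]_(x in S) (h x)%:E)%E.
Proof.
move=> mS mf mh A0 f0 h0 fS fh.
have -> : (\int[mu]_x (f x)%:E = \int[mu]_(x in S) (f x)%:E)%E.
  rewrite [RHS]integral_mkcond; apply: eq_integral => x _; rewrite patchE.
  by case: ifPn => // /negP; rewrite inE => /fS ->.
have mhE : measurable_fun S (EFin \o h) by apply/measurable_EFinP; exact: measurable_funTS.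
have h0E x : S x -> (0 <= (EFin \o h) x)%E by rewrite /= lee_fin.
rewrite -(ge0_integralZl_EFin mu mS h0E mhE A0).
apply: ge0_le_integral => //.
- by move=> x _; rewrite lee_fin.
- by apply/measurable_EFinP; exact: measurable_funTS.
- exact: measurable_funeM.
Qed.

Lemma integral_inside_le g : 0 < g -> g < d%:R -> exists2 C : R, 0 < C &
  forall f A rho, 0 < rho -> 0 <= A -> measurable_fun setT f -> (forall x, 0 <= f x) ->
  (forall x, enorm x = 0 -> f x = 0) ->
  (forall x, 0 < enorm x <= rho -> f x <= A * enorm x `^ (- g)) ->
  (\int[mu]_x (inside rho f x)%:E <= (A * (C * rho `^ (d%:R - g)))%:E)%E.
Proof.
move=> g0 gd; have [C C0 HC] := @radial_inner R d g g0 gd; exists C => // f A rho rho0 A0 mf f0 fz fA.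
apply: (@le_trans _ _ (A%:E * \int[mu]_(x in [set x : E | (0 < enorm x <= rho)%R]) (enorm x `^ (- g))%:E)%E).
  apply: integral_supported_le => //.
  - rewrite (_ : [set x | _] = [set x : E | enorm x <= rho] `\` [set x : E | enorm x <= 0]).
      by apply: measurableD; exact: measurable_ball_enorm.
    apply/seteqP; split=> x /=; first by move=> /andP[h1 h2]; split=> //; apply/negP; rewrite -ltNge.
    by move=> [h1 /negP]; rewrite -ltNge h1 => ->.
  - exact: measurable_inside.
  - exact: measurable_powR_enorm.
  - by move=> x; exact: inside_ge0.
  - by move=> x; exact: powR_ge0.
  - move=> x /= /negP; rewrite /inside; case: ifP => // h; rewrite andbT -leNgt => h2.
    by apply: fz; apply/eqP; rewrite eq_le h2 enorm_ge0.
  - by move=> x /= /[dup] /andP[_ h] /fA; rewrite /inside h.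
by rewrite EFinM lee_wpmul2l ?lee_fin// HC.
Qed.

Lemma integral_outside_le g : d%:R < g -> exists2 C : R, 0 < C &
  forall f A rho, 0 < rho -> 0 <= A -> measurable_fun setT f -> (forall x, 0 <= f x) ->
  (forall x, rho < enorm x -> f x <= A * enorm x `^ (- g)) ->
  (\int[mu]_x (outside rho f x)%:E <= (A * (C * rho `^ (d%:R - g)))%:E)%E.
Proof.
move=> gd; have [C C0 HC] := @radial_outer R d g gd; exists C => // f A rho rho0 A0 mf f0 fA.
apply: (@le_trans _ _ (A%:E * \int[mu]_(x in [set x : E | (rho < enorm x)%R]) (enorm x `^ (- g))%:E)%E).
  apply: integral_supported_le => //.
  - rewrite (_ : [set x | _] = ~` [set x : E | enorm x <= rho]).
      by apply: measurableC; exact: measurable_ball_enorm.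
    by apply/seteqP; split=> x /=; rewrite ltNge => /negP.
  - exact: measurable_outside.
  - exact: measurable_powR_enorm.
  - by move=> x; exact: outside_ge0.
  - by move=> x; exact: powR_ge0.
  - by move=> x /= /negP; rewrite /outside -leNgt => ->.
  - by move=> x /= h; rewrite /outside [enorm x <= rho]leNgt h; exact: fA.
by rewrite EFinM lee_wpmul2l ?lee_fin// HC.
Qed.

End truncation.

(** * Convolution with a complex kernel *)

Section convolution_operator.
Context {R : realType} {d : nat}.
Local Notation mu := (lebesgue_measure_euclid d).
Local Notation E := (euclid R d).

(** Integrability is not assumed: an infinite integral is sent to 0 by [fine], and the bound is then
    trivial. The pointwise estimate of the solution thus holds at every x. *)
Lemma normr_Rintegral_le (f : E -> R) : measurable_fun setT f ->
  ((`|\int[mu]_x f x|)%:E <= \int[mu]_x (`|f x|)%:E)%E.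
Proof.
move=> mf; have mE : measurable_fun setT (EFin \o f) by exact/measurable_EFinP.
apply: (@le_trans _ _ `|\int[mu]_x (f x)%:E|%E); last exact: le_abse_integral.
by rewrite /Rintegral; case: (integral _ _ _) => [r| |] //=; rewrite ?normr0 leey.
Qed.

Lemma measurable_fine_integral (f : E * E -> R) : measurable_fun setT f ->
  measurable_fun setT (fun x : E => \int[mu]_y f (x, y)).
Proof.
move=> mf; have mE : measurable_fun setT (EFin \o f) by exact/measurable_EFinP.
have mp := measurable_funepos mE; have mn := measurable_funeneg mE.
have mfine : measurable_fun setT (fine : \bar R -> R) by exact: fine_measurable.
apply: (measurableT_comp mfine).
rewrite (_ : (fun x : E => _) = (fun x => \int[mu]_y (EFin \o f)^\+ (x, y) - \int[mu]_y (EFin \o f)^\- (x, y))%E).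
  apply: emeasurable_funB.
    exact: (measurable_fun_fubini_tonelli_F _ mp (fun x => funepos_ge0 _ x)).
  exact: (measurable_fun_fubini_tonelli_F _ mn (fun x => funeneg_ge0 _ x)).
apply/funext => x; rewrite integralE; congr (_ - _)%E; apply: eq_integral => y _.
  by rewrite !funeposE.
by rewrite !funenegE.
Qed.

Variables (Z : E -> R[i]) (u : E -> R).
Hypothesis mZ : cmeasurable setT Z.
Hypothesis mu_ : measurable_fun setT u.

Let op x := cintegral mu setT (fun y => Z (esub x y) * (u y)%:C).

Lemma normc_convolution_le x : ((normc (op x))%:E <= 2%:E * conv (fun x => normc (Z x)) u x)%E.
Proof.
have [m1 m2] := mZ.
have mR : measurable_fun setT (fun y => complex.Re (Z (esub x y)) * u y).
  by apply: measurable_funM => //; exact: (measurableT_comp m1 (measurable_esubr x)).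
have mI : measurable_fun setT (fun y => complex.Im (Z (esub x y)) * u y).
  by apply: measurable_funM => //; exact: (measurableT_comp m2 (measurable_esubr x)).
have RE y : complex.Re (Z (esub x y) * (u y)%:C) = complex.Re (Z (esub x y)) * u y.
  by rewrite ReM /= mulr0 subr0.
have IE y : complex.Im (Z (esub x y) * (u y)%:C) = complex.Im (Z (esub x y)) * u y.
  by rewrite ImM /= mulr0 add0r.
have mn := measurableT_comp (cmeasurable_normc mZ) (measurable_esubr x).
have mc : measurable_fun setT (fun y => (normc (Z (esub x y)) * `|u y|)%:E).
  by apply/measurable_EFinP; apply: measurable_funM => //; exact: measurableT_comp.
have c0 := @conv_ge0 R d (fun x => normc (Z x)) u x (fun x => normc_ge0 _).
apply: (@le_trans _ _ (`|complex.Re (op x)| + `|complex.Im (op x)|)%:E).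
  by rewrite lee_fin normc_le_reim.
rewrite EFinD (_ : 2 = 1 + 1)%R// EFinD ge0_muleDl ?lee_fin// mul1e.
rewrite /op Re_cintegral Im_cintegral.
under eq_Rintegral do rewrite RE.
under [X in (_ + (`|X|)%:E)%E]eq_Rintegral do rewrite IE.
apply: leeD.
- apply: (le_trans (normr_Rintegral_le mR)); apply: ge0_le_integral => //.
  + by apply/measurable_EFinP; exact: measurableT_comp.
  + by move=> y _; rewrite lee_fin normrM ler_wpM2r// normRe_le.
- apply: (le_trans (normr_Rintegral_le mI)); apply: ge0_le_integral => //.
  + by apply/measurable_EFinP; exact: measurableT_comp.
  + by move=> y _; rewrite lee_fin normrM ler_wpM2r// normIm_le.
Qed.

Lemma cmeasurable_convolution : cmeasurable setT op.
Proof.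
have [m1 m2] := mZ.
have mu2 : measurable_fun setT (fun p : E * E => u p.2) by exact: measurableT_comp.
split.
- rewrite (_ : _ \o _ = fun x => \int[mu]_y (complex.Re (Z (esub x y)) * u y)).
    apply: (@measurable_fine_integral (fun p => complex.Re (Z (esub p.1 p.2)) * u p.2)).
    by apply: measurable_funM => //; exact: (measurableT_comp m1 measurable_esub).
  apply/funext => x; rewrite /op /comp Re_cintegral; apply: eq_Rintegral => y _.
  by rewrite ReM /= mulr0 subr0.
- rewrite (_ : _ \o _ = fun x => \int[mu]_y (complex.Im (Z (esub x y)) * u y)).
    apply: (@measurable_fine_integral (fun p => complex.Im (Z (esub p.1 p.2)) * u p.2)).
    by apply: measurable_funM => //; exact: (measurableT_comp m2 measurable_esub).
  apply/funext => x; rewrite /op /comp Im_cintegral; apply: eq_Rintegral => y _.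
  by rewrite ImM /= mulr0 add0r.
Qed.

End convolution_operator.

Section norms_of_dominated_functions.
Context {R : realType} {d : nat}.
Local Notation mu := (lebesgue_measure_euclid d).
Local Notation E := (euclid R d).

Lemma L2norm_le (g : E -> R[i]) (h : E -> \bar R) (M : R) :
  cmeasurable setT g -> measurable_fun setT h -> (forall x, 0 <= h x)%E ->
  (forall x, (normc (g x))%:E <= 2%:E * h x)%E -> 0 <= M ->
  (\int[mu]_x (h x * h x) <= (M ^+ 2)%:E)%E -> (L2norm mu g <= (2 * M)%:E)%E.
Proof.
move=> mg mh h0 gh M0 hM; rewrite /L2norm (unlock _).
have -> : (2 * M)%:E = ((4 * M ^+ 2)%:E `^ 2^-1)%E.
  rewrite poweR_EFin powR12_sqrt; last by rewrite mulr_ge0// sqr_ge0.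
  by rewrite (_ : 4 * M ^+ 2 = (2 * M) ^+ 2) ?sqrtr_sqr ?ger0_norm ?mulr_ge0//; ring.
apply: gt0_ler_poweR; rewrite ?in_itv/= ?leey ?andbT//.
- by apply: integral_ge0 => x _; rewrite lee_fin powR_ge0.
- by rewrite lee_fin mulr_ge0// sqr_ge0.
have mh2 : measurable_fun setT (fun x => h x * h x)%E by exact: emeasurable_funM.
apply: (@le_trans _ _ (\int[mu]_x (4%:E * (h x * h x)))%E); last first.
  rewrite ge0_integralZl_EFin// => [|x _]; last by rewrite mule_ge0.
  by rewrite EFinM lee_wpmul2l// lee_fin.
apply: ge0_le_integral => //.
- apply/measurable_EFinP => /=.
  apply: (measurableT_comp (@measurable_powR R 2)).
  by apply: measurableT_comp => //; exact: cmeasurable_normc.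
- exact: measurable_funeM.
move=> x _; rewrite /= -[2]/(2%:R) powR_mulrn// real_normK ?num_real//.
rewrite expr2 EFinM; apply: (le_trans (lee_pmul _ _ (gh x) (gh x))); rewrite ?lee_fin ?normc_ge0//.
by rewrite muleACA -EFinM (_ : 2 * 2 = 4)%R//; ring.
Qed.

Lemma Markov_le (h : E -> \bar R) (l : R) : 0 < l -> measurable_fun setT h -> (forall x, 0 <= h x)%E ->
  (l%:E * mu [set x | l%:E < h x] <= \int[mu]_x h x)%E.
Proof.
move=> l0 mh h0.
have mS : measurable [set x : E | (l%:E < h x)%E].
  rewrite -[X in measurable X]setTI; apply: emeasurable_fun_o_infty => //.
rewrite -integral_cst//; apply: (@le_trans _ _ (\int[mu]_(x in [set x | (l%:E < h x)%E]) h x)%E).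
  apply: ge0_le_integral => //; rewrite ?lee_fin ?ltW//.
  - by move=> x _; rewrite lee_fin ltW.
  - exact: measurable_funTS.
  - by move=> x /= /ltW.
by apply: ge0_subset_integral.
Qed.

End norms_of_dominated_functions.

(** * Decay of the kernel and of the solution *)

Section kernel_bounds.
Context {R : realType} {d : nat}.
Variables alpha beta c : R.
Hypothesis halpha : 0 < alpha < 1.
Hypothesis hbeta : 0 < beta <= 2.
Hypothesis hd : (1 <= d)%N.
Hypothesis hc : 0 < c < Num.min 1 (d%:R / beta).
Local Notation mu := (lebesgue_measure_euclid d).
Local Notation E := (euclid R d).
Local Notation admissible := (mb_admissible alpha beta (d%:R / 2)).
Local Notation Z := (@Zkernel R d alpha beta c).

Let z (t : R) (x : E) : R := 2 `^ beta * t `^ alpha * enorm x `^ (- beta).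

Lemma admissible_of_lt a : 0 < a -> a < 1 -> a * beta < d%:R -> admissible 1 a.
Proof.
move=> a0 a1 ab; have /andP[al0 al1] := halpha.
rewrite /mb_admissible a0 a1 /=; apply/andP; split; first lra.
by apply: lt_trans a1; rewrite gtr_pMl.
Qed.

Lemma admissible_c : admissible 1 c.
Proof.
have /andP[be0 _] := hbeta.
move: hc; rewrite lt_min => /and3P[c0 c1]; rewrite ltr_pdivlMr// => cb.
exact: admissible_of_lt.
Qed.

Lemma ZkernelE t x : Z t x = (pi `^ (- (d%:R / 2)) * (enorm x ^+ d)^-1 * (2 * pi)^-1)%:C *
  mb_integral alpha beta (d%:R / 2) 1 c (ln (z t x)).
Proof.
rewrite /Zkernel [in RHS]rmorphM -[RHS]mulrA; congr (_ * _).
have i0 : 'i%C != 0 :> R[i] by rewrite -normc_gt0 normci.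
have -> : mb_integral alpha beta (d%:R / 2) 1 c (ln (z t x)) =
  'i%C^-1 * cintegral lebesgue_measure setT (fun ta : R => 'i%C *
   (mb_gamma alpha beta (d%:R / 2) 1 (c +i* ta) * cexp ((c +i* ta) * (- ln (z t x))%:C))).
  rewrite (cintegralZ _ measurableT (cintegrable_mb halpha hbeta (ln (z t x)) admissible_c)).
  by rewrite mulrA mulVf// mul1r.
rewrite /mellin_barnes mulrA invfM -rmorphV ?unitfE ?mulf_neq0 ?pnatr_eq0 ?gt_eqF ?pi_gt0//.
congr (_ * _); apply: eq_cintegral => ta _.
rewrite /mb_gamma rmorph1 mulrC; congr (_ * (_ * cexp _)).
by rewrite rmorphN mulNr mulrN.
Qed.

(** Since d >= 1, the factor (|x|^d)^(-1) takes the default value 0 at the origin. This lets the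
    inner estimates disregard that point, where no bound by a power of |x| is available. *)
Lemma Zkernel_eq0 t x : enorm x = 0 -> Z t x = 0.
Proof. by move=> x0; rewrite ZkernelE x0 expr0n gtn_eqF// invr0 mulr0 mul0r rmorph0 mul0r. Qed.

Lemma Zkernel_even t x y : Z t (esub x y) = Z t (esub y x).
Proof. by rewrite /Zkernel enorm_esubC. Qed.

Lemma cmeasurable_Zkernel t : cmeasurable setT (Z t).
Proof.
have mln : measurable_fun setT (fun x => ln (z t x)).
  apply: (measurableT_comp (@measurable_ln R)); apply: measurable_funM; first exact: measurable_cst.
  exact: measurable_powR_enorm.
have a1 : c <= 1 by have /and4P[_ /ltW] := admissible_c.
have lip L := mb_integral_lipschitz halpha hbeta L admissible_c a1.
have mH : measurable_fun setT (fun L : R => complex.Re (mb_integral alpha beta (d%:R / 2) 1 c L)) /\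
          measurable_fun setT (fun L : R => complex.Im (mb_integral alpha beta (d%:R / 2) 1 c L)).
  split; apply: continuous_measurable_fun => L; have [K K0 HK] := lip L;
    apply: (lipschitz_continuous_at ltr01 K0) => h /HK; apply: le_trans.
  - by rewrite -ReN -ReD normRe_le.
  - by rewrite -ImN -ImD normIm_le.
rewrite (_ : Z t = fun x => (pi `^ (- (d%:R / 2)) * enorm x `^ (- d%:R) * (2 * pi)^-1)%:C *
  mb_integral alpha beta (d%:R / 2) 1 c (ln (z t x))); last first.
  by apply/funext => x; rewrite ZkernelE powR_invn// enorm_ge0.
have [m1 m2] := mH.
apply: cmeasurableM; last by split; [exact: (measurableT_comp m1 mln)|exact: (measurableT_comp m2 mln)].
apply: cmeasurable_real; apply: measurable_funM; last exact: measurable_cst.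
by apply: measurable_funM; [exact: measurable_cst|exact: measurable_powR_enorm].
Qed.

(** For L = ln z the factor exp (- a L) is z^(- a) = 2^(- beta a) t^(- alpha a) |x|^(beta a), to be
    multiplied by |x|^(- d). *)
Lemma Zkernel_le_of_mb_integral a : (exists2 C : R, 0 < C & forall L,
    normc (mb_integral alpha beta (d%:R / 2) 1 c L) <= C * expR (- (a * L))) ->
  exists2 C : R, 0 < C & forall t x, 0 < t -> 0 < enorm x ->
    normc (Z t x) <= C * t `^ (- (alpha * a)) * enorm x `^ (- (d%:R - beta * a)).
Proof.
move=> [C C0 HC]; have pi0 := pi_gt0 R.
pose P : R := pi `^ (- (d%:R / 2)) * (2 * pi)^-1.
have P0 : 0 < P by rewrite mulr_gt0 ?powR_gt0// invr_gt0 mulr_gt0.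
exists (P * C * expR (- (a * (beta * ln 2)))); first by rewrite mulr_gt0 ?expR_gt0// mulr_gt0.
move=> t x t0 x0.
have zE : ln (z t x) = beta * ln 2 + alpha * ln t - beta * ln (enorm x).
  rewrite /z lnM ?posrE ?mulr_gt0 ?powR_gt0// lnM ?posrE ?powR_gt0//.
  by rewrite !ln_powR mulNr.
have e1 : t `^ (- (alpha * a)) = expR (- (alpha * a) * ln t) by rewrite /powR gt_eqF.
have e2 : enorm x `^ (- (d%:R - beta * a)) = expR (- (d%:R - beta * a) * ln (enorm x)) by rewrite /powR gt_eqF.
have e3 : (enorm x ^+ d)^-1 = expR (- d%:R * ln (enorm x)).
  by rewrite -powR_invn ?enorm_ge0// /powR gt_eqF.
rewrite ZkernelE normcM normc_real ger0_norm; last first.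
  by rewrite !mulr_ge0 ?powR_ge0 ?invr_ge0 ?mulr_ge0 ?exprn_ge0 ?enorm_ge0 ?ltW.
apply: (@le_trans _ _ (P * (enorm x ^+ d)^-1 * (C * expR (- (a * ln (z t x)))))).
  have -> : pi `^ (- (d%:R / 2)) * (enorm x ^+ d)^-1 * (2 * pi)^-1 = P * (enorm x ^+ d)^-1 by rewrite /P; ring.
  by rewrite ler_wpM2l// mulr_ge0 ?(ltW P0)// invr_ge0 exprn_ge0 ?enorm_ge0.
rewrite e1 e2 e3 zE.
have -> : P * expR (- d%:R * ln (enorm x)) * (C * expR (- (a * (beta * ln 2 + alpha * ln t - beta * ln (enorm x))))) =
  P * C * (expR (- d%:R * ln (enorm x)) * expR (- (a * (beta * ln 2 + alpha * ln t - beta * ln (enorm x))))) by ring.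
rewrite -!(mulrA (P * C)) -!expRD.
rewrite le_eqVlt; apply/orP; left; apply/eqP; congr (_ * expR _); ring.
Qed.

Lemma Zkernel_le a : 0 < a -> a < 1 -> a * beta < d%:R ->
  exists2 C : R, 0 < C & forall t x, 0 < t -> 0 < enorm x ->
    normc (Z t x) <= C * t `^ (- (alpha * a)) * enorm x `^ (- (d%:R - beta * a)).
Proof.
move=> a0 a1 ab; apply: Zkernel_le_of_mb_integral.
have adm := admissible_of_lt a0 a1 ab.
have [C C0 HC] := mb_integral_bound halpha hbeta adm.
by exists C => // L; rewrite (mb_integral_shift halpha hbeta L admissible_c adm).
Qed.

(** Up to constants the majorant is t^(- alpha) times the Riesz kernel of (- Delta)^(- beta / 2). *)
Lemma Zkernel_le_Riesz : 2 * beta <= d%:R ->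
  exists2 C : R, 0 < C & forall t x, 0 < t -> 0 < enorm x ->
    normc (Z t x) <= C * t `^ (- alpha) * enorm x `^ (- (d%:R - beta)).
Proof.
move=> db; have /andP[al0 al1] := halpha; have /andP[be0 be2] := hbeta.
(* The abscissa c' beyond the pole must stay below 2 for Gamma (2 - s) and below 1 / alpha for Gamma
   (1 - alpha s). For c' < 2 the hypothesis 2 beta <= d also gives beta c' / 2 < d / 2. *)
pose m := Num.min 2 alpha^-1.
have m1 : 1 < m by rewrite lt_min invf_gt1// al1 ltr1n.
pose c' := (1 + m) / 2.
have c'1 : 1 < c' by rewrite /c'; lra.
have c'm : c' < m by rewrite /c'; lra.
have adm : admissible 2 c'.
  rewrite lt_min in c'm; case/andP: c'm => h1 h2.
  rewrite /mb_admissible (lt_trans ltr01 c'1) h1 /=; apply/andP; split.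
    have : beta / 2 * c' < beta / 2 * 2 by rewrite ltr_pM2l// divr_gt0.
    lra.
  by rewrite mulrC -ltr_pdivlMr// mul1r.
have := @Zkernel_le_of_mb_integral 1 _; rewrite !mulr1; apply.
have [C C0 HC] := mb_integral_pole halpha hbeta admissible_c c'1 adm.
by exists C => // L; rewrite mul1r.
Qed.

End kernel_bounds.

(** * Decay of the solution for d below, above and at 2 beta *)

Section decay.
Context {R : realType} {d : nat}.
Variables alpha beta c : R.
Hypothesis halpha : 0 < alpha < 1.
Hypothesis hbeta : 0 < beta <= 2.
Hypothesis hd : (1 <= d)%N.
Hypothesis hc : 0 < c < Num.min 1 (d%:R / beta).
Local Notation mu := (lebesgue_measure_euclid d).
Local Notation E := (euclid R d).
Variable u0 : E -> R.
Hypothesis hu0_1 : u0 \in Lfun mu 1%E.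
Hypothesis hu0_2 : u0 \in Lfun mu 2%:E.
Local Notation Z := (@Zkernel R d alpha beta c).
Local Notation sol := (mild_solution alpha beta c u0).

Let mu0 : measurable_fun setT u0.
Proof. by have /measurable_int/measurable_EFinP := (Lfun1_integrable mu u0).1 hu0_1. Qed.

Let norm1 : exists2 N : R, 0 <= N & (\int[mu]_y `|u0 y|%:E = N%:E)%E.
Proof.
have /integrableP[_ h] := (Lfun1_integrable mu u0).1 hu0_1.
have h0 : (0 <= \int[mu]_y `|u0 y|%:E)%E by apply: integral_ge0 => y _; rewrite lee_fin.
exists (fine (\int[mu]_y `|u0 y|%:E)%E); first exact: fine_ge0.
by rewrite fineK// ge0_fin_numE.
Qed.

Let norm2 : exists2 N : R, 0 <= N & (\int[mu]_y (u0 y ^+ 2)%:E = N%:E)%E.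
Proof.
have /integrableP[_ h] := Lfun2_integrable_sqr hu0_2.
have h0 : (0 <= \int[mu]_y (u0 y ^+ 2)%:E)%E by apply: integral_ge0 => y _; rewrite lee_fin sqr_ge0.
exists (fine (\int[mu]_y (u0 y ^+ 2)%:E)%E); first exact: fine_ge0.
rewrite fineK// ge0_fin_numE//; apply: le_lt_trans h.
rewrite le_eqVlt; apply/orP; left; apply/eqP; apply: eq_integral => y _.
by rewrite /= ger0_norm// sqr_ge0.
Qed.

Let K t (x : E) : R := normc (Z t x).

Let K0 t x : 0 <= K t x. Proof. exact: normc_ge0. Qed.

Let mK t : measurable_fun setT (K t).
Proof. by apply: cmeasurable_normc; exact: cmeasurable_Zkernel. Qed.

Let Kz t x : enorm x = 0 -> K t x = 0.
Proof. by move=> x0; rewrite /K Zkernel_eq0// normc0. Qed.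

Let Keven t x y : K t (esub x y) = K t (esub y x).
Proof. by rewrite /K Zkernel_even. Qed.

Let sol_le t x : ((normc (sol t x))%:E <= 2%:E * conv (K t) u0 x)%E.
Proof. by apply: normc_convolution_le => //; exact: cmeasurable_Zkernel. Qed.

Let msol t : cmeasurable setT (sol t).
Proof. by apply: cmeasurable_convolution => //; exact: cmeasurable_Zkernel. Qed.

Let L2norm_sol_le t M : 0 <= M ->
  (\int[mu]_x (conv (K t) u0 x * conv (K t) u0 x) <= (M ^+ 2)%:E)%E ->
  (L2norm mu (sol t) <= (2 * M)%:E)%E.
Proof.
move=> M0; apply: (L2norm_le (msol t) (measurable_conv (@mK t) mu0 (@K0 t))) => //.
by move=> x; exact: conv_ge0.
Qed.

Lemma L2_decay_low_dim : d%:R < 2 * beta -> exists2 C : R, 0 < C & forall t : R, 0 < t ->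
  (L2norm mu (sol t) <= (C * t `^ (- (alpha * (d%:R / (2 * beta)))))%:E)%E.
Proof.
move=> db; have /andP[al0 al1] := halpha; have /andP[be0 be2] := hbeta.
have d0 : 0 < d%:R :> R by rewrite ltr0n.
(* At the critical abscissa k the squared bound is a multiple of |x|^(- d). The abscissa a1 < k
   gives square integrability at infinity, a2 > k at the origin; a2 < min (1, 2 k) keeps a2
   admissible, since 2 k beta = d. *)
pose k : R := d%:R / (2 * beta).
have k0 : 0 < k by rewrite divr_gt0// mulr_gt0.
have kb : 2 * (beta * k) = d%:R by rewrite /k; field; rewrite gt_eqF.
have k1 : k < 1 by rewrite ltr_pdivrMr ?mulr_gt0// mul1r.
pose m : R := Num.min 1 (2 * k).
have km : k < m by rewrite lt_min k1; lra.
pose a1 := k / 2; pose a2 := (k + m) / 2.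
have a10 : 0 < a1 by rewrite divr_gt0.
have a1k : a1 < k by rewrite /a1; lra.
have a2k : k < a2 by rewrite /a2; lra.
have [a21 a22] : a2 < 1 /\ a2 < 2 * k.
  have : a2 < m by rewrite /a2; lra.
  by rewrite lt_min => /andP.
have ba1 : beta * a1 < beta * k by rewrite ltr_pM2l.
have ba2 : beta * k < beta * a2 by rewrite ltr_pM2l.
have ba22 : beta * a2 < beta * (2 * k) by rewrite ltr_pM2l.
have [C1 C10 H1] := @Zkernel_le R d _ _ _ halpha hbeta hc a1 a10 (ltac:(lra)) (ltac:(lra)).
have [C2 C20 H2] := @Zkernel_le R d _ _ _ halpha hbeta hc a2 (ltac:(lra)) a21 (ltac:(lra)).
pose g1 := 2 * (d%:R - beta * a1); pose g2 := 2 * (d%:R - beta * a2).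
have [I1 I10 HI1] := @integral_outside_le R d g1 (ltac:(rewrite /g1; lra)).
have [I2 I20 HI2] := @integral_inside_le R d g2 (ltac:(rewrite /g2; lra)) (ltac:(rewrite /g2; lra)).
have [N N0 HN] := norm1.
pose M0 := C1 ^+ 2 * I1 + C2 ^+ 2 * I2.
have M00 : 0 <= M0 by rewrite addr_ge0// mulr_ge0 ?sqr_ge0// ltW.
(* The added 1 keeps the constant positive when u0 vanishes almost everywhere. *)
exists (2 * (N * Num.sqrt M0) + 1); first by rewrite ltr_wpDl// mulr_ge0// mulr_ge0// sqrtr_ge0.
move=> t t0; set T := t `^ (- (alpha * k)).
have T0 : 0 <= T by exact: powR_ge0.
have NM : 0 <= N * Num.sqrt M0 by rewrite mulr_ge0 ?sqrtr_ge0.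
apply: (@le_trans _ _ (2 * (N * Num.sqrt M0 * T))%:E); last first.
  by rewrite lee_fin mulrA ler_wpM2r// lerDl.
apply: L2norm_sol_le; first by rewrite mulr_ge0.
pose f x := K t x ^+ 2.
have f0 x : 0 <= f x by exact: sqr_ge0.
have mf : measurable_fun setT f by exact: measurable_funX.
(* The self-similar radius, at which |x|^beta and t^alpha are equal. *)
pose rho := t `^ (alpha / beta).
have rho0 : 0 < rho by exact: powR_gt0.
have sq a C x : 0 < enorm x -> 0 <= C ->
    K t x <= C * t `^ (- (alpha * a)) * enorm x `^ (- (d%:R - beta * a)) ->
    f x <= (C ^+ 2 * t `^ (- (2 * (alpha * a)))) * enorm x `^ (- (2 * (d%:R - beta * a))).
  move=> x0 C0 h; apply: (le_trans (lerXn2r 2 _ _ h)); rewrite ?nnegrE//.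
    by rewrite !mulr_ge0 ?powR_ge0.
  rewrite !exprMn -!(powR_mulrn 2) ?powR_ge0// -!powRrM.
  rewrite le_eqVlt; apply/orP; left; apply/eqP.
  by congr (_ * _ `^ _ * _ `^ _); ring.
(* At this radius the power of t no longer depends on the abscissa, so inner and outer parts both
   contribute T^2. *)
have pw a : t `^ (- (2 * (alpha * a))) * rho `^ (d%:R - 2 * (d%:R - beta * a)) = T ^+ 2.
  rewrite -(powR_mulrn 2 T0) /T /rho -!powRrM -powRD; last by rewrite (gt_eqF t0) implybT.
  by congr (_ `^ _); rewrite -kb; field; rewrite gt_eqF.
have i2 : (\int[mu]_x (inside rho f x)%:E <= (C2 ^+ 2 * I2 * T ^+ 2)%:E)%E.
  have := HI2 f (C2 ^+ 2 * t `^ (- (2 * (alpha * a2)))) rho rho0 _ mf f0.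
  rewrite -(pw a2) -/g2 (_ : C2 ^+ 2 * I2 * _ = C2 ^+ 2 * t `^ (- (2 * (alpha * a2))) * (I2 * rho `^ (d%:R - g2))); last by ring.
  apply; first by rewrite mulr_ge0 ?sqr_ge0 ?powR_ge0.
    by move=> x /Kz h; rewrite /f h expr0n.
  by move=> x /andP[x0 _]; apply: sq; rewrite ?(ltW C20)//; exact: H2.
have i1 : (\int[mu]_x (outside rho f x)%:E <= (C1 ^+ 2 * I1 * T ^+ 2)%:E)%E.
  have := HI1 f (C1 ^+ 2 * t `^ (- (2 * (alpha * a1)))) rho rho0 _ mf f0.
  rewrite -(pw a1) -/g1 (_ : C1 ^+ 2 * I1 * _ = C1 ^+ 2 * t `^ (- (2 * (alpha * a1))) * (I1 * rho `^ (d%:R - g1))); last by ring.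
  apply; first by rewrite mulr_ge0 ?sqr_ge0 ?powR_ge0.
  by move=> x rx; have x0 := lt_trans rho0 rx; apply: sq; rewrite ?(ltW C10)//; exact: H1.
have iK : (\int[mu]_x (K t x ^+ 2)%:E <= (M0 * T ^+ 2)%:E)%E.
  have -> : (\int[mu]_x (K t x ^+ 2)%:E = \int[mu]_x (inside rho f x)%:E + \int[mu]_x (outside rho f x)%:E)%E.
    rewrite -ge0_integralD//.
    - by apply: eq_integral => x _; rewrite -EFinD inside_outside.
    - by move=> x _; rewrite lee_fin inside_ge0.
    - by apply/measurable_EFinP; exact: measurable_inside.
    - by move=> x _; rewrite lee_fin outside_ge0.
    - by apply/measurable_EFinP; exact: measurable_outside.
  by rewrite /M0 mulrDl addrC EFinD leeD.
apply: (le_trans (conv_sqr_le21 (mK t) mu0 (K0 t))); rewrite HN.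
apply: (@le_trans _ _ (N%:E * ((M0 * T ^+ 2)%:E * N%:E))%E).
  by rewrite lee_wpmul2l ?lee_fin// lee_wpmul2r ?lee_fin.
by rewrite -!EFinM lee_fin !exprMn sqr_sqrtr// le_eqVlt; apply/orP; left; apply/eqP; ring.
Qed.

(** The Riesz bound has its whole dependence on t in front, so the kernel is cut at the fixed radius
    1. The inner part is integrable and acts on u0 in L^2; the outer part is square integrable
    because d > 2 beta, and acts on u0 in L^1. *)
Lemma L2_decay_high_dim : 2 * beta < d%:R -> exists2 C : R, 0 < C & forall t : R, 0 < t ->
  (L2norm mu (sol t) <= (C * t `^ (- alpha))%:E)%E.
Proof.
move=> db; have /andP[be0 be2] := hbeta.
have [C C0 HC] := @Zkernel_le_Riesz R d _ _ _ halpha hbeta hc (ltW db).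
have [I1 I10 HI1] := @integral_inside_le R d (d%:R - beta) (ltac:(lra)) (ltac:(lra)).
have [I2 I20 HI2] := @integral_outside_le R d (2 * (d%:R - beta)) (ltac:(lra)).
have [N1 N10 HN1] := norm1; have [N2 N20 HN2] := norm2.
pose M0 := 2 * ((C * I1) ^+ 2 * N2) + 2 * (N1 ^+ 2 * (C ^+ 2 * I2)).
have M00 : 0 <= M0 by rewrite addr_ge0// mulr_ge0// mulr_ge0 ?sqr_ge0// mulr_ge0 ?sqr_ge0// ltW.
exists (2 * Num.sqrt M0 + 1); first by rewrite ltr_wpDl// mulr_ge0// sqrtr_ge0.
move=> t t0; set T := t `^ (- alpha); have T0 : 0 <= T by exact: powR_ge0.
apply: (@le_trans _ _ (2 * (Num.sqrt M0 * T))%:E); last first.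
  by rewrite lee_fin mulrA ler_wpM2r// lerDl.
apply: L2norm_sol_le; first by rewrite mulr_ge0 ?sqrtr_ge0.
pose Ki := inside 1 (K t); pose Ko := outside 1 (K t).
have Ki0 x : 0 <= Ki x by exact: inside_ge0.
have Ko0 x : 0 <= Ko x by exact: outside_ge0.
have mKi : measurable_fun setT Ki by exact: measurable_inside.
have mKo : measurable_fun setT Ko by exact: measurable_outside.
have Kie x y : Ki (esub x y) = Ki (esub y x) by rewrite /Ki /inside enorm_esubC Keven.
have CT0 : 0 <= C * T by rewrite mulr_ge0// ltW.
have i1 : (\int[mu]_x (Ki x)%:E <= (C * T * I1)%:E)%E.
  have := HI1 (K t) (C * T) 1 ltr01 CT0 (mK t) (K0 t) (@Kz t).
  rewrite powR1 mulr1; apply=> x /andP[x0 _]; exact: HC.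
have i2 : (\int[mu]_x (Ko x ^+ 2)%:E <= ((C * T) ^+ 2 * I2)%:E)%E.
  have := HI2 (fun x => K t x ^+ 2) ((C * T) ^+ 2) 1 ltr01 (sqr_ge0 _) (measurable_funX 2 (mK t)) (fun x => sqr_ge0 _).
  rewrite powR1 mulr1 => H.
  rewrite (eq_integral (fun x => (outside 1 (fun x => K t x ^+ 2) x)%:E)); last first.
    by move=> x _; rewrite /Ko /outside; case: ifP; rewrite ?expr0n.
  apply: H => x x1; have x0 := lt_trans ltr01 x1.
  apply: (le_trans (lerXn2r 2 _ _ (HC t x t0 x0))); rewrite ?nnegrE ?mulr_ge0 ?powR_ge0 ?normc_ge0 ?(ltW C0)//.
  rewrite exprMn -(powR_mulrn 2 (powR_ge0 _ _)) -powRrM le_eqVlt; apply/orP; left; apply/eqP.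
  by congr (_ * _ `^ _); ring.
have ci := conv_sqr_le12 mKi mu0 Ki0 Kie; have co := conv_sqr_le21 mKo mu0 Ko0.
rewrite HN2 in ci; rewrite HN1 in co.
have mci := measurable_conv mKi mu0 Ki0; have mco := measurable_conv mKo mu0 Ko0.
have ci0 x := @conv_ge0 R d Ki u0 x Ki0; have co0 x := @conv_ge0 R d Ko u0 x Ko0.
have mci2 : measurable_fun setT (fun x => conv Ki u0 x * conv Ki u0 x)%E by exact: emeasurable_funM.
have mco2 : measurable_fun setT (fun x => conv Ko u0 x * conv Ko u0 x)%E by exact: emeasurable_funM.
have {}ci : (\int[mu]_x (conv Ki u0 x * conv Ki u0 x) <= ((C * T * I1) ^+ 2 * N2)%:E)%E.
  apply: (le_trans ci); have k0 : (0 <= \int[mu]_x (Ki x)%:E)%E by apply: integral_ge0 => x _; rewrite lee_fin.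
  rewrite expr2 -mulrA EFinM; apply: lee_pmul => //.
    by rewrite mule_ge0// lee_fin.
  by rewrite EFinM lee_wpmul2r// lee_fin.
have {}co : (\int[mu]_x (conv Ko u0 x * conv Ko u0 x) <= (N1 ^+ 2 * ((C * T) ^+ 2 * I2))%:E)%E.
  apply: (le_trans co).
  apply: (@le_trans _ _ (N1%:E * (((C * T) ^+ 2 * I2)%:E * N1%:E))%E).
    by rewrite lee_wpmul2l ?lee_fin// lee_wpmul2r ?lee_fin.
  by rewrite -!EFinM lee_fin le_eqVlt; apply/orP; left; apply/eqP; ring.
have cK x : conv (K t) u0 x = (conv Ki u0 x + conv Ko u0 x)%E.
  rewrite -convD//; apply: eq_integral => y _.
  by rewrite /Ki /Ko inside_outside.
(* Infinite values are included because the two convolutions are not known to be finite at every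
   point. *)
have sq2 (a b : \bar R) : (0 <= a -> 0 <= b -> (a + b) * (a + b) <= 2%:E * (a * a) + 2%:E * (b * b))%E.
  move: a b => [a| |] [b| |]// a0 b0.
  - rewrite -!EFinM -!EFinD lee_fin; have := sqr_ge0 (a - b); nra.
  - by rewrite [in leRHS]mulyy [in leRHS]gt0_muley ?lte_fin// [in leRHS]addey ?leey// -!EFinM.
  - by rewrite [in leRHS]mulyy [in leRHS]gt0_muley ?lte_fin// [in leRHS]addye ?leey// -!EFinM.
  - by rewrite mulyy gt0_muley ?lte_fin// addye ?leey.
apply: (@le_trans _ _ (\int[mu]_x (2%:E * (conv Ki u0 x * conv Ki u0 x) + 2%:E * (conv Ko u0 x * conv Ko u0 x)))%E).
  apply: ge0_le_integral => //.
  - by move=> x _; rewrite mule_ge0// conv_ge0.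
  - by apply: emeasurable_funM; exact: measurable_conv.
  - by apply: emeasurable_funD; exact: measurable_funeM.
  - by move=> x _; rewrite cK sq2.
rewrite ge0_integralD//; last 4 first.
- by move=> x _; rewrite mule_ge0// mule_ge0.
- exact: measurable_funeM.
- by move=> x _; rewrite mule_ge0// mule_ge0.
- exact: measurable_funeM.
rewrite !ge0_integralZl_EFin//; last 2 first.
- by move=> x _; rewrite mule_ge0.
- by move=> x _; rewrite mule_ge0.
apply: (@le_trans _ _ (2%:E * ((C * T * I1) ^+ 2 * N2)%:E + 2%:E * (N1 ^+ 2 * ((C * T) ^+ 2 * I2))%:E)%E).
  by rewrite leeD// lee_wpmul2l// lee_fin.
rewrite -!EFinM -EFinD lee_fin [in leRHS]exprMn sqr_sqrtr// /M0 le_eqVlt; apply/orP; left; apply/eqP; ring.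
Qed.

(** Here the majorant is a multiple of t^(- alpha) |x|^(- beta), with squared modulus of order
    |x|^(- d): a weak L^2 function. The radius of the cut therefore depends on the level l. *)
Lemma weak_L2_decay_level : d%:R = 2 * beta -> exists2 C : R, 0 < C & forall t l : R, 0 < t -> 0 < l ->
  (l%:E * mu [set x : E | (l < normc (sol t x))%R] `^ 2^-1 <= (C * t `^ (- alpha))%:E)%E.
Proof.
move=> db; have /andP[be0 be2] := hbeta.
have [C C0 HC] := @Zkernel_le_Riesz R d _ _ _ halpha hbeta hc (ltac:(lra)).
have dbb : d%:R - beta = beta by lra.
have [I I0 HI] := @integral_inside_le R d beta be0 (ltac:(lra)).
have [N N0 HN] := norm1; have N1 : 0 < N + 1 by lra.
exists (4 * Num.sqrt I * (N + 1) * C); first by rewrite !mulr_gt0 ?sqrtr_gt0.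
move=> t l t0 l0; move: (sol t) (@msol t) (@sol_le t) => g mg gle.
set T := t `^ (- alpha); have T0 : 0 < T by exact: powR_gt0.
pose B := C * T; have B0 : 0 < B by rewrite mulr_gt0.
(* With rho^beta = q the outer kernel is at most B / q, so its convolution with u0 is at most B N /
   q <= l / 4. Using N + 1 keeps q positive when u0 has zero norm. *)
pose q := 4 * B * (N + 1) / l; have q0 : 0 < q by rewrite divr_gt0// !mulr_gt0.
pose rho := q `^ beta^-1; have rho0 : 0 < rho by exact: powR_gt0.
have rhob : rho `^ beta = q by rewrite /rho -powRrM mulVf ?gt_eqF// powRr1// ltW.
pose Ki := inside rho (K t); pose Ko := outside rho (K t).
have Ki0 x : 0 <= Ki x by exact: inside_ge0.
have Ko0 x : 0 <= Ko x by exact: outside_ge0.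
have mKi : measurable_fun setT Ki by exact: measurable_inside.
have mKo : measurable_fun setT Ko by exact: measurable_outside.
have cK x : conv (K t) u0 x = (conv Ki u0 x + conv Ko u0 x)%E.
  rewrite -convD//; apply: eq_integral => y _.
  by rewrite /Ki /Ko inside_outside.
have i1 : (\int[mu]_x (Ki x)%:E <= (B * (I * q))%:E)%E.
  have := HI (K t) B rho rho0 (ltW B0) (mK t) (K0 t) (@Kz t).
  rewrite dbb rhob; apply=> x /andP[x0 _].
  by have := HC t x t0 x0; rewrite dbb.
have Kole x : Ko x <= B / q.
  rewrite /Ko /outside; case: ifPn => [_|]; first by rewrite divr_ge0// ltW.
  rewrite -ltNge => h; have x0 := lt_trans rho0 h; have := HC t x t0 x0; rewrite dbb => /le_trans; apply.
  rewrite ler_wpM2l ?(ltW B0)// -rhob powRN lef_pV2 ?posrE ?powR_gt0//.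
  by apply: ge0_ler_powR; rewrite ?nnegrE ?(ltW be0) ?(ltW rho0) ?enorm_ge0// ltW.
have mabs : measurable_fun setT (fun y => `|u0 y|) by exact: measurableT_comp.
have cole x : (conv Ko u0 x <= (l / 4)%:E)%E.
  have Bq : 0 <= B / q by rewrite divr_ge0// ltW.
  apply: (@le_trans _ _ (conv (cst (B / q)) u0 x)); first by apply: conv_le.
  rewrite /conv (eq_integral (fun y => (B / q)%:E * `|u0 y|%:E)%E) => [|y _]; last by rewrite -EFinM.
  rewrite ge0_integralZl_EFin//; last exact/measurable_EFinP.
  rewrite HN -EFinM lee_fin /q.
  have -> : B / (4 * B * (N + 1) / l) * N = l / 4 * (N / (N + 1)).
    by field; rewrite !gt_eqF.
  by rewrite ler_piMr ?divr_ge0 ?(ltW l0)// ler_pdivrMr// mul1r lerDl.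
have mci := measurable_conv mKi mu0 Ki0.
have ci0 x := @conv_ge0 R d Ki u0 x Ki0.
pose S := [set x : E | ((l / 4)%:E < conv Ki u0 x)%E].
have mS : measurable S.
  by rewrite -[X in measurable X]setTI; apply: emeasurable_fun_o_infty.
have mD : measurable [set x : E | l < normc (g x)].
  rewrite (_ : [set x | _] = setT `&` (fun x => normc (g x)) @^-1` `]l, +oo[%classic).
    by apply: (cmeasurable_normc mg) => //; exact: measurable_itv.
  by rewrite setTI; apply/seteqP; split=> x; rewrite /= in_itv/= andbT.
have sub : [set x : E | l < normc (g x)] `<=` S.
  move=> x /= lx; rewrite /S /= ltNge; apply/negP => h.
  (* If the inner part were also at most l / 4, the factor 2 from real and imaginary parts would
     give at most l in total. *)
  have : (l%:E < 2%:E * ((l / 4)%:E + (l / 4)%:E))%E.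
    apply: (@lt_le_trans _ _ (normc (g x))%:E); first by rewrite lte_fin.
    apply: (le_trans (gle x)); rewrite cK lee_wpmul2l ?lee_fin// leeD//.
  by rewrite -EFinD -EFinM lte_fin; lra.
have mle : (mu [set x : E | (l < normc (g x))%R] <= mu S)%E.
  by apply: le_measure; rewrite ?inE.
have l40 : 0 < l / 4 by rewrite divr_gt0.
have mk := Markov_le l40 mci ci0.
have icv : (\int[mu]_x conv Ki u0 x <= (B * (I * q) * N)%:E)%E.
  rewrite /conv integral_conv// HN EFinM lee_wpmul2r// lee_fin//.
(* As d - beta = beta, the inner kernel has integral at most B I q. Markov's inequality at level l /
   4, with q proportional to 1 / l, produces the factor l^(-2), and N (N + 1) <= (N + 1)^2 makes the
   bound a square. *)
have bnd : (mu [set x : E | (l < normc (g x))%R] <= ((4 * (N + 1) * B / l) ^+ 2 * I)%:E)%E.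
  apply: (le_trans mle).
  have : ((l / 4)%:E * mu S <= (B * (I * q) * N)%:E)%E by exact: le_trans icv.
  rewrite muleC -lee_pdivlMr//.
  move=> /le_trans; apply; rewrite -EFinM lee_fin.
  have -> : B * (I * q) * N * (l / 4)^-1 = (4 * B / l) ^+ 2 * I * ((N + 1) * N).
    by rewrite /q; field; rewrite gt_eqF.
  have -> : (4 * (N + 1) * B / l) ^+ 2 * I = (4 * B / l) ^+ 2 * I * ((N + 1) * (N + 1)) by ring.
  apply: ler_wpM2l; first by apply: mulr_ge0; [exact: sqr_ge0|exact: ltW].
  by apply: ler_wpM2l; [exact: ltW|rewrite lerDl].
apply: (@le_trans _ _ (l%:E * ((4 * (N + 1) * B / l) ^+ 2 * I)%:E `^ 2^-1)%E).
  rewrite lee_wpmul2l ?lee_fin ?(ltW l0)//; apply: gt0_ler_poweR => //; rewrite ?in_itv/= ?leey ?andbT//.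
  by rewrite lee_fin mulr_ge0 ?sqr_ge0// ltW.
have nn : 0 <= 4 * (N + 1) * B / l by rewrite divr_ge0 ?mulr_ge0// ltW.
rewrite poweR_EFin powR12_sqrt; last by apply: mulr_ge0; [exact: sqr_ge0|exact: ltW].
rewrite sqrtrM ?sqr_ge0// sqrtr_sqr ger0_norm//.
by rewrite -EFinM lee_fin le_eqVlt; apply/orP; left; apply/eqP; rewrite /B; field; rewrite gt_eqF.
Qed.

Lemma weak_L2_decay_critical : d%:R = 2 * beta -> exists2 C : R, 0 < C & forall t : R, 0 < t ->
  (weakL2norm mu (sol t) <= (C * t `^ (- alpha))%:E)%E.
Proof.
move=> /weak_L2_decay_level[C C0 HC]; exists C => // t t0.
move: (sol t) (fun l => HC t l t0) => g H.
by apply: ge_ereal_sup => _ [l l0 <-]; exact: H.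
Qed.

End decay.

Theorem theorem2p36 (R : realType) (alpha beta : R) (d : nat) (c : R)
    (halpha : 0 < alpha < 1) (hbeta : 0 < beta <= 2) (hd : (1 <= d)%N)
    (hc : 0 < c < Num.min 1 (d%:R / beta))
    (u0 : euclid R d -> R)
    (hu0_1 : u0 \in Lfun (lebesgue_measure_euclid d) 1%E)
    (hu0_2 : u0 \in Lfun (lebesgue_measure_euclid d) 2%:E) :
  (d%:R <> 2 * beta ->
    exists2 C : R, 0 < C & forall t : R, 0 < t ->
      (L2norm (lebesgue_measure_euclid d) (mild_solution alpha beta c u0 t)
       <= (C * t `^ (- (alpha * Num.min 1 (d%:R / (2 * beta)))))%:E)%E) /\
  (d%:R = 2 * beta ->
    exists2 C : R, 0 < C & forall t : R, 0 < t ->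
      (weakL2norm (lebesgue_measure_euclid d) (mild_solution alpha beta c u0 t)
       <= (C * t `^ (- alpha))%:E)%E).
Proof.
have /andP[be0 _] := hbeta.
split=> db; last exact: weak_L2_decay_critical.
have [lt|gt|/db//] := ltgtP d%:R (2 * beta).
- rewrite (_ : Num.min 1 (d%:R / (2 * beta)) = d%:R / (2 * beta)).
    exact: L2_decay_low_dim.
  by apply/min_idPr; rewrite ler_pdivrMr ?mulr_gt0// mul1r ltW.
- rewrite (_ : Num.min 1 (d%:R / (2 * beta)) = 1) ?mulr1.
    exact: L2_decay_high_dim.
  by apply/min_idPl; rewrite ler_pdivlMr ?mulr_gt0// mul1r ltW.
Qed.
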